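(* Let $1\leq r\leq n-5$ and $\eta=\Sigma^+\mu$. The risk of estimators of the form $aS^+\bar X$ for a constant $a\leq\frac{n-r-2}{n}$ can be bounded in terms of the risk of $\frac{n-r-2}{n}S^+\bar X$ by $$E\left[\big\|aS^+\bar X-\eta\big\|_2^2\right]\leq E\left[\Big\|\frac{n-r-2}{n}S^+\bar X-\eta\Big\|_2^2\right]+\left(a-\frac{n-r-2}{n}\right)\left(a-\frac{n-r-4}{n}\right)E\left[\bar X^tS^{+2}\bar X\right].$$ The constant that minimizes this upper bound is $a=\frac{n-r-3}{n}$, and the corresponding estimator $\hat{\eta}_{\mathrm{TK1}}=\frac{n-r-3}{n}S^+\bar X$ dominates $\frac{n-r-2}{n}S^+\bar X$, which itself dominates $S^+\bar X$.
   Context: Model: $X_1,\dots,X_n$ are i.i.d. from the $p$-dimensional normal distribution $N_p(\mu,\Sigma)$ with $\mu\in\mathbb{R}^p$ and $\Sigma$ (symmetric positive semidefinite) unknown, where $r=\mathrm{rk}\,\Sigma<\min(n,p)$. The sample mean is $\bar X=\frac1n\sum_{i=1}^n X_i$ and the sample covariance matrix is $S=\frac1n\sum_{i=1}^n (X_i-\bar X)(X_i-\bar X)^t$. $A^+$ denotes the Moore-Penrose pseudoinverse of a matrix $A$, and $S^{+2}=(S^+)^2$. The estimation of $\eta$ is under the square loss $\|\hat\eta-\eta\|_2^2$, and the risk is the expected loss. ''Dominates'' is in the usual decision-theoretic sense with respect to this risk: the risk of the dominating estimator is no larger for every $(\mu,\Sigma)$ with $\mathrm{rk}\,\Sigma=r$,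 and strictly smaller for at least one. *)

(* Defs.v *)
From HB Require Import structures.
From mathcomp Require Import all_boot all_order all_algebra.
From mathcomp Require Import all_classical all_reals all_analysis.

Set Implicit Arguments.
Unset Strict Implicit.
Unset Printing Implicit Defensive.

Import Order.TTheory GRing.Theory Num.Theory.

Local Open Scope classical_set_scope.
Local Open Scope ring_scope.

(* The sigma-algebra on 'M[T]_(m, n) is the product one, generated by the
   entries; on 'cV[R]_p it is the Borel sigma-algebra of R^p. *)
Definition measure_matrix_display : measure_display -> measure_display.
Proof. exact. Qed.

Section measurable_matrix.
Context {d} {T : measurableType d} (m n : nat).

Definition matrix_measurable : set (set 'M[T]_(m, n)) :=
  <<s \bigcup_(ij in [set: 'I_m * 'I_n])
        preimage_set_system setT (fun M : 'M[T]_(m, n) => M ij.1 ij.2)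
          measurable >>.

Let matrix_set0 : matrix_measurable set0.
Proof. exact: sigma_algebra0. Qed.

Let matrix_setC A : matrix_measurable A -> matrix_measurable (~` A).
Proof. exact: sigma_algebraC. Qed.

Let matrix_bigcup (F : (set 'M[T]_(m, n))^nat) :
  (forall i, matrix_measurable (F i)) -> matrix_measurable (\bigcup_i (F i)).
Proof. exact: sigma_algebra_bigcup. Qed.

HB.instance Definition _ := @isMeasurable.Build (measure_matrix_display d)
  'M[T]_(m, n) matrix_measurable matrix_set0 matrix_setC matrix_bigcup.

End measurable_matrix.

(* mathcomp's pinvmx is only a partial inverse, not the Moore-Penrose one. *)
Definition penrose (R : realType) (m n : nat)
    (A : 'M[R]_(m, n)) (G : 'M[R]_(n, m)) : Prop :=
  [/\ A *m G *m A = A, G *m A *m G = G,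
      (A *m G)^T = A *m G & (G *m A)^T = G *m A].

Definition mpinv (R : realType) (m n : nat) (A : 'M[R]_(m, n)) : 'M[R]_(n, m) :=
  xget 0 [set G | penrose A G].

Lemma row_free_gram (R : realType) (m n : nat) (F : 'M[R]_(m, n)) :
  row_free F -> F *m F^T \in unitmx.
Proof.
move=> fF; rewrite -row_free_unit -kermx_eq0; apply/eqP/row_matrixP => i.
rewrite row0; set x := row i _.
have xFF : x *m (F *m F^T) = 0 by rewrite -row_mul mulmx_ker row0.
suff xF0 : x *m F = 0 by apply: (row_free_inj fF); rewrite xF0 mul0mx.
have : (x *m F *m (x *m F)^T) 0 0 = 0.
  by rewrite trmx_mul mulmxA -(mulmxA x) xFF mul0mx mxE.
move: (x *m F) => v; rewrite mxE (eq_bigr (fun j => v 0 j ^+ 2)); last first.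
  by move=> j _; rewrite [_^T _ _]mxE -expr2.
move=> /psumr_eq0P v0; apply/rowP => j; rewrite [RHS]mxE; apply/eqP.
by rewrite -sqrf_eq0 v0// => k _; exact: sqr_ge0.
Qed.

Lemma penrose_mpinv (R : realType) (m n : nat) (A : 'M[R]_(m, n)) :
  penrose A (mpinv A).
Proof.
rewrite /mpinv; apply: (xgetPex 0 (P := [set G | penrose A G])).
have : row_free (col_base A)^T by rewrite /row_free mxrank_tr; exact: col_base_full.
have : row_free (row_base A) by exact: row_base_free.
have := mulmx_base A; move: (\rank A) (col_base A) (row_base A).
move=> k C F <- {A} /row_free_gram uF /row_free_gram; rewrite trmxK => uC.
pose G := F^T *m invmx (F *m F^T) *m (invmx (C^T *m C) *m C^T).
have AG : C *m F *m G = C *m (invmx (C^T *m C) *m C^T).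
  rewrite /G mulmxA -(mulmxA C F) (mulmxA F) mulmxV// mulmx1.
  by rewrite mulmxA.
have GA : G *m (C *m F) = F^T *m invmx (F *m F^T) *m F.
  rewrite /G -!mulmxA (mulmxA C^T C) (mulmxA (invmx (C^T *m C))).
  by rewrite mulVmx// mul1mx.
exists G; split.
- rewrite AG -!mulmxA (mulmxA C^T C) (mulmxA (invmx (C^T *m C))).
  by rewrite mulVmx// mul1mx.
- rewrite GA /G -!mulmxA (mulmxA F F^T) (mulmxA (F *m F^T)).
  by rewrite mulmxV// mul1mx.
- by rewrite AG !trmx_mul trmxK trmx_inv trmx_mul trmxK mulmxA.
- by rewrite GA !trmx_mul trmxK trmx_inv trmx_mul trmxK mulmxA.
Qed.

Lemma penrose_uniq (R : realType) (m n : nat) (A : 'M[R]_(m, n))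
    (G H : 'M[R]_(n, m)) :
  penrose A G -> penrose A H -> G = H.
Proof.
move=> [AGA GAG AGt GAt] [AHA HAH AHt HAt].
have E1 : A *m G = A *m H.
  by rewrite -{1}AHA -mulmxA -AHt -AGt -trmx_mul mulmxA AGA AHt.
have E2 : G *m A = H *m A.
  by rewrite -{1}AHA -(mulmxA A) mulmxA -GAt -HAt -trmx_mul -mulmxA
     (mulmxA A) AGA HAt.
by rewrite -GAG -mulmxA E1 mulmxA E2 HAH.
Qed.

Definition psdmx (R : realType) (p : nat) (Sigma : 'M[R]_p) : Prop :=
  Sigma^T = Sigma /\ forall x : 'cV[R]_p, 0 <= (x^T *m Sigma *m x) 0 0.

(* nu is the law of a vector with independent N(0, 1) entries. *)
Definition std_normal_law (R : realType) (l : nat)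
    (nu : probability 'cV[R]_l R) : Prop :=
  forall B : 'I_l -> set R, (forall i, measurable (B i)) ->
    nu [set z : 'cV[R]_l | forall i, B i (z i 0)] =
    (\prod_(i < l) normal_prob (0 : R) 1 (B i))%E.

(* N_p(mu, Sigma), possibly singular: the law of mu + A Z with Z standard normal
   and A *m A^T = Sigma. *)
Definition mvnormal_law (R : realType) (p : nat)
    (mu : 'cV[R]_p) (Sigma : 'M[R]_p) (Q : set 'cV[R]_p -> \bar R) : Prop :=
  exists (A : 'M[R]_p) (nu : probability 'cV[R]_p R),
    [/\ A *m A^T = Sigma, std_normal_law nu &
        forall B : set 'cV[R]_p, measurable B ->
          Q B = nu [set z : 'cV[R]_p | B (mu + A *m z)]].

Definition mutually_independent (R : realType) d (T : measurableType d)
    (P : probability T R) (n : nat) d' (U : measurableType d')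
    (X : 'I_n -> {mfun T >-> U}) : Prop :=
  forall (J : {set 'I_n}) (B : 'I_n -> set U),
    (forall i, measurable (B i)) ->
    P [set w | forall i, i \in J -> B i (X i w)] =
    (\prod_(i in J) P (X i @^-1` B i))%E.

Definition iid_mvnormal (R : realType) d (T : measurableType d)
    (P : probability T R) (n p : nat) (X : 'I_n -> {mfun T >-> 'cV[R]_p})
    (mu : 'cV[R]_p) (Sigma : 'M[R]_p) : Prop :=
  mutually_independent P X /\
  forall i, mvnormal_law mu Sigma (distribution P (X i)).

Definition param_space (R : realType) (p r : nat) : set ('cV[R]_p * 'M[R]_p) :=
  [set th | psdmx th.2 /\ \rank th.2 = r].

(* A statistical experiment: one observation X, and a family of probabilities
   P mu Sigma on its sample space; P is unconstrained off the parameter space. *)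
Definition normal_experiment (R : realType) d (T : measurableType d)
    (n p r : nat) (P : 'cV[R]_p -> 'M[R]_p -> probability T R)
    (X : 'I_n -> {mfun T >-> 'cV[R]_p}) : Prop :=
  forall mu Sigma, param_space r (mu, Sigma) ->
    iid_mvnormal (P mu Sigma) X mu Sigma.

Definition smean (R : realType) (n p : nat) (x : 'I_n -> 'cV[R]_p) : 'cV[R]_p :=
  n%:R^-1 *: \sum_(i < n) x i.

Definition scov (R : realType) (n p : nat) (x : 'I_n -> 'cV[R]_p) : 'M[R]_p :=
  n%:R^-1 *: \sum_(i < n) ((x i - smean x) *m (x i - smean x)^T).

Definition sqnorm2 (R : realType) (p : nat) (v : 'cV[R]_p) : R :=
  \sum_(i < p) v i 0 ^+ 2.

Definition eta (R : realType) (p : nat) (mu : 'cV[R]_p) (Sigma : 'M[R]_p) :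
  'cV[R]_p := mpinv Sigma *m mu.

Definition risk (R : realType) d (T : measurableType d) (n p : nat)
    (P : 'cV[R]_p -> 'M[R]_p -> probability T R)
    (X : 'I_n -> {mfun T >-> 'cV[R]_p})
    (delta : ('I_n -> 'cV[R]_p) -> 'cV[R]_p)
    (mu : 'cV[R]_p) (Sigma : 'M[R]_p) : \bar R :=
  ('E_(P mu Sigma)
    [fun w => (sqnorm2 (delta (fun i => X i w) - eta mu Sigma))%R])%E.

Definition dominates (R : realType) d (T : measurableType d) (n p r : nat)
    (P : 'cV[R]_p -> 'M[R]_p -> probability T R)
    (X : 'I_n -> {mfun T >-> 'cV[R]_p})
    (delta1 delta2 : ('I_n -> 'cV[R]_p) -> 'cV[R]_p) : Prop :=
  (forall mu Sigma, param_space r (mu, Sigma) ->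
     (risk P X delta1 mu Sigma <= risk P X delta2 mu Sigma)%E) /\
  (exists mu Sigma, param_space r (mu, Sigma) /\
     (risk P X delta1 mu Sigma < risk P X delta2 mu Sigma)%E).

Definition plugin (R : realType) (n p : nat) (x : 'I_n -> 'cV[R]_p) :
  'cV[R]_p := mpinv (scov x) *m smean x.

Definition scaled_plugin (R : realType) (n p : nat) (a : R)
    (x : 'I_n -> 'cV[R]_p) : 'cV[R]_p := a *: plugin x.

Definition pinv_quad (R : realType) (n p : nat) (x : 'I_n -> 'cV[R]_p) : R :=
  ((smean x)^T *m (mpinv (scov x) *m mpinv (scov x)) *m smean x) 0 0.

Definition risk_bound (R : realType) d (T : measurableType d) (n p r : nat)
    (P : 'cV[R]_p -> 'M[R]_p -> probability T R)
    (X : 'I_n -> {mfun T >-> 'cV[R]_p}) (a : R)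
    (mu : 'cV[R]_p) (Sigma : 'M[R]_p) : \bar R :=
  (risk P X (scaled_plugin ((n%:R - r%:R - 2) / n%:R)) mu Sigma +
   ((a - (n%:R - r%:R - 2) / n%:R) * (a - (n%:R - r%:R - 4) / n%:R))%:E *
     'E_(P mu Sigma)[fun w => pinv_quad (fun i => X i w)])%E.

(* Main.v *)
(** Write Sigma = B Gam B^T with C B = 1, B C symmetric and Gam invertible, so
    that the columns Y_i = C (X_i - mu) are i.i.d. N(0, Gam) in R^r. Off a null
    set S^+ Xbar = n C^T W^-1 u, where W = Y H Y^T, H is the centering projection
    and u = C mu + Ybar, so with A = C C^T, Psi = Gam^-1 and kappa = n - r - 2
    the risk of a S^+ Xbar is a^2 Q - 2 a t + |eta|^2 with
    Q = n^2 E[u^T W^-1 A W^-1 u] and t = n E[(C eta)^T W^-1 u]. The claims are then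
    quadratic algebra given kappa t = n |eta|^2, Q > 0 and
    n^2 |eta|^2 <= kappa (kappa - 1) Q.
    These moments come from Gaussian integration by parts,
    E[tr (Psi Y F(Y))] = E[div F(Y)], for F(Y) = H Y^T S_e N and its variants,
    where S_e = (W + e)^-1 is smooth and bounded. The same identities bound the
    second moments of S_e uniformly in e; hence W is almost surely invertible
    and e -> 0 is dominated by the limit W^-1. The lower bound on Q results from
    dropping the nonnegative term E[tr (A W^-1) tr (W^-1 N)]. *)

Require Import Defs.
From mathcomp Require Import all_boot all_order all_algebra.
From mathcomp Require Import all_classical all_reals all_analysis.
From mathcomp Require Import measurable_realfun.
From mathcomp Require Import ring lra.

Set Implicit Arguments.
Unset Strict Implicit.
Unset Printing Implicit Defensive.

Import Order.TTheory GRing.Theory Num.Theory.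
Import numFieldNormedType.Exports.

Local Open Scope classical_set_scope.
Local Open Scope ring_scope.

(** * Gaussian integration by parts *)

(** The numbers n - r - 2 and n - r - 3 are divergence counts. Differentiating H Y^T W^-1 gives tr H
    = n - 1 from the factor Y^T and -1 and -r from W^-1; a second factor W^-1 gives one more -1. So
    E[W^-1] = Psi / kappa needs no Wishart density, and kappa - 1 appears in the quadratic moment.
    The bound r <= n - 5 enters through a third count: for the field tr (S_e) H Y^T S_e the
    coefficient is at least n - r - 4 >= 1, while the other side of the identity is only linear in
    tr S_e, so E[(tr S_e)^2] bounds itself. The obstacle is that W^-1 is unbounded and not known in
    advance to exist: all differentiation happens at e > 0, and only estimates uniform in e survive
    the limit. Independence of Ybar and W is likewise replaced by integration by parts: H 1 = 0, so
    W does not move when all columns are shifted together. At the end, the risk is a parabola in a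
    with vertex t / Q, and the moment bound says t / Q <= (kappa - 1) / n = (n - r - 3) / n; to the
    right of this value the risk increases. *)

Section gauss1.
Context {R : realType}.
Local Notation mu := (@lebesgue_measure R).
Local Notation phi := (@normal_pdf R 0 1).
Local Notation N01 := (@normal_prob R 0 1).

(** The density agrees almost everywhere with the Radon-Nikodym derivative of [N01], because both
    have the same integral over every measurable set; the change of variables for that derivative
    does the rest. *)
Lemma ge0_integral_normal (f : R -> R) : measurable_fun setT f ->
  (forall x, 0 <= f x) ->
  (\int[N01]_x (f x)%:E = \int[mu]_x (f x * phi x)%:E)%E.
Proof.
move=> mf f0.
pose g := Radon_Nikodym_SigmaFinite.f N01 mu.
have dom : N01 `<< mu := normal_prob_dominates 0 1.
have ig : mu.-integrable setT g by exact: Radon_Nikodym_SigmaFinite.f_integrable.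
have gphi : ae_eq mu setT g (EFin \o phi).
  apply: integral_ae_eq => //.
    by apply/measurable_EFinP; exact: measurable_normal_pdf.
  by move=> A _ mA; rewrite -Radon_Nikodym_SigmaFinite.f_integral.
rewrite -(Radon_Nikodym_SigmaFinite.change_of_variables dom)//; last first.
  exact/measurable_EFinP.
apply: ae_eq_integral => //.
- apply: emeasurable_funM; first exact/measurable_EFinP.
  exact: measurable_int ig.
- apply/measurable_EFinP; apply: measurable_funM => //.
  exact: measurable_normal_pdf.
- under [X in ae_eq _ _ _ X]eq_fun do rewrite EFinM.
  exact: ae_eqe_mul2l.
Qed.

Lemma normal_pdf1E x : phi x = normal_peak 1 * expR (- x ^+ 2 / 2).
Proof. by rewrite normal_pdfE ?oner_neq0// /normal_fun subr0 expr1n. Qed.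

(* x^2 exp(-x^2/2) <= 4 exp(-x^2/4), and the right-hand side is an integrable
   Gaussian density of variance 2. *)
Lemma sqr_normal_pdf_le (x : R) :
  x ^+ 2 * phi x <= 4 * (normal_peak 1 / normal_peak (Num.sqrt 2)) *
    normal_pdf 0 (Num.sqrt (2 : R)) x.
Proof.
have s2 : Num.sqrt (2 : R) != 0 by rewrite gt_eqF// sqrtr_gt0.
rewrite normal_pdf1E normal_pdfE// /normal_fun subr0 sqr_sqrtr//.
have p0 : normal_peak (Num.sqrt (2 : R)) != 0 by rewrite gt_eqF// normal_peak_gt0.
rewrite [leRHS](_ : _ = normal_peak 1 * (4 * expR (- x ^+ 2 / (2 *+ 2)))); last first.
  by field.
rewrite mulrCA ler_wpM2l ?normal_peak_ge0//.
have -> : expR (- x ^+ 2 / 2) = expR (- x ^+ 2 / (2 *+ 2)) * expR (- (x ^+ 2 / 4)).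
  by rewrite -expRD; congr expR; field.
rewrite mulrCA [leRHS]mulrC ler_wpM2l ?expR_ge0//.
rewrite expRN ler_pdivrMr ?expR_gt0// mulrC.
have := expR_ge1Dx (x ^+ 2 / 4); lra.
Qed.

Lemma integrable_sqr_normal_pdf :
  mu.-integrable setT (fun x => (x ^+ 2 * phi x)%:E).
Proof.
apply: (@le_integrable _ _ _ mu _ measurableT _
  (fun x => (4 * (normal_peak 1 / normal_peak (Num.sqrt 2)))%:E *
    (normal_pdf 0 (Num.sqrt (2 : R)) x)%:E)%E).
- apply/measurable_EFinP/measurable_funM; first exact: measurable_funX.
  exact: measurable_normal_pdf.
- move=> x _; rewrite !lee_fin ger0_norm; last first.
    by rewrite mulr_ge0 ?sqr_ge0 ?normal_pdf_ge0.
  apply: le_trans (sqr_normal_pdf_le x) _.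
  exact: ler_norm.
- by apply: integrableZl => //; exact: integrable_normal_pdf.
Qed.

Lemma integrable_quad_normal (f : R -> R) (K : R) : measurable_fun setT f ->
  (forall x, `|f x| <= K * (1 + x ^+ 2)) ->
  [/\ mu.-integrable setT (fun x => (f x * phi x)%:E),
      N01.-integrable setT (EFin \o f) &
  (\int[N01]_x (f x)%:E = \int[mu]_x (f x * phi x)%:E)%E].
Proof.
move=> mf fK.
have mfp : measurable_fun setT (fun x => (f x * phi x)%:E).
  by apply/measurable_EFinP/measurable_funM => //; exact: measurable_normal_pdf.
have i1 : mu.-integrable setT (fun x => (f x * phi x)%:E).
  apply: (@le_integrable _ _ _ mu _ measurableT _ (fun x => K%:E *
    ((phi x)%:E + (x ^+ 2 * phi x)%:E))%E) => //.
    move=> x _; rewrite lee_fin [leLHS]normrM (ger0_norm (normal_pdf_ge0 0 1 x)).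
    apply: (le_trans _ (ler_norm _)); rewrite -[X in _ * (X + _)]mul1r -mulrDl mulrA.
    by rewrite ler_wpM2r ?normal_pdf_ge0.
  apply: integrableZl => //; apply: integrableD => //.
    exact: integrable_normal_pdf.
  exact: integrable_sqr_normal_pdf.
have mfpo : measurable_fun setT (f^\+)%R by exact: measurable_funrpos.
have mfne : measurable_fun setT (f^\-)%R by exact: measurable_funrneg.
have i2 : N01.-integrable setT (EFin \o f).
  apply/integrableP; split; first exact/measurable_EFinP.
  rewrite (ge0_integral_normal (f := fun x => `|f x|))//; last first.
    exact: measurableT_comp.
  move/integrableP : i1 => [_]; congr (_ < _)%E.
  apply: eq_integral => x _; rewrite /= normrM.
  by rewrite (ger0_norm (normal_pdf_ge0 0 1 x)).
split => //.
(* The density formula is known for nonnegative functions, so both sides are split into positive and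
   negative parts; [phi], being nonnegative, passes through the maxima. *)
rewrite [LHS]integralE [RHS]integralE; congr (_ - _)%E.
  transitivity (\int[N01]_x ((f^\+)%R x)%:E)%E.
    by apply: eq_integral => x _; rewrite funeposE /funrpos -EFin_max.
  rewrite ge0_integral_normal//; apply: eq_integral => x _.
  by rewrite funeposE /funrpos -EFin_max maxr_pMl ?normal_pdf_ge0// mul0r.
transitivity (\int[N01]_x ((f^\-)%R x)%:E)%E.
  by apply: eq_integral => x _; rewrite funenegE /funrneg -EFinN -EFin_max.
rewrite ge0_integral_normal//; apply: eq_integral => x _.
by rewrite funenegE /funrneg -EFinN -EFin_max maxr_pMl ?normal_pdf_ge0// mul0r mulNr.
Qed.


Lemma is_derive_normal_pdf (x : R) : is_derive x (1 : R) phi (- x * phi x).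
Proof.
have -> : phi = normal_peak 1 \*: (expR \o ((- 2^-1) \*: (id ^+ 2 : R -> R))).
  apply/funext => y; rewrite normal_pdf1E /=; congr (_ * expR _).
  by rewrite /GRing.scale /= exprfctE mulrC mulrN mulNr mulrC.
apply: is_derive_eq; rewrite /GRing.scale/= exprfctE.
rewrite -![_ *: _]/(_ * _) mulr_natl expr1.
by field.
Qed.

(** Controls the boundary terms of the integration by parts: if f grows linearly, then f phi is O(1
    / |x|). *)
Lemma normal_pdf_sqr_bound : exists2 C : R, 0 <= C & forall x : R, x ^+ 2 * phi x <= C.
Proof.
exists (4 * (normal_peak 1 / normal_peak (Num.sqrt 2)) * normal_peak (Num.sqrt 2)).
  by rewrite !mulr_ge0 ?invr_ge0 ?normal_peak_ge0.
move=> x; apply: le_trans (sqr_normal_pdf_le x) _.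
rewrite ler_wpM2l//; first by rewrite !mulr_ge0 ?invr_ge0 ?normal_peak_ge0.
by apply: normal_pdf_ub; rewrite gt_eqF// sqrtr_gt0.
Qed.

(** Since phi' = - x phi, the difference of the two integrands is the derivative of f phi. Its
    integral over [-a, a] is a boundary term, which vanishes as a grows; linear growth gives both
    the integrability and this decay. *)
Lemma stein_normal (f f' : R -> R) (K : R) :
  (forall x, is_derive x (1 : R) f (f' x)) -> continuous f' ->
  (forall x, `|f x| <= K * (1 + `|x|)) -> (forall x, `|f' x| <= K * (1 + `|x|)) ->
  (\int[N01]_x (x * f x)%:E = \int[N01]_x (f' x)%:E)%E.
Proof.
move=> df cf' fK f'K.
have K0 : 0 <= K by have := le_trans (normr_ge0 _) (fK 0); rewrite normr0 addr0 mulr1.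
have dcf x : derivable f x 1 by have [] := df x.
have cf : continuous f.
  by move=> x; apply: differentiable_continuous; exact/derivable1_diffP.
have cphi : continuous phi by apply: continuous_normal_pdf; rewrite oner_neq0.
have mf : measurable_fun setT f by exact: continuous_measurable_fun.
have mf' : measurable_fun setT f' by exact: continuous_measurable_fun.
have absx (x : R) : `|x| <= 1 + x ^+ 2.
  rewrite ler_norml; apply/andP; split; nra.
have [i1 j1 ->] : [/\ mu.-integrable setT (fun x => (x * f x * phi x)%:E),
      N01.-integrable setT (EFin \o (fun x => x * f x)) &
  (\int[N01]_x (x * f x)%:E = \int[mu]_x (x * f x * phi x)%:E)%E].
  apply: (@integrable_quad_normal _ (2 * K)); first exact: measurable_funM.
  move=> x; rewrite normrM.
  apply: (le_trans (ler_wpM2l (normr_ge0 x) (fK x))).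
  have := absx x; rewrite -(real_normK (num_real x)).
  move: (normr_ge0 x); nra.
have [i2 j2 ->] : [/\ mu.-integrable setT (fun x => (f' x * phi x)%:E),
      N01.-integrable setT (EFin \o f') &
  (\int[N01]_x (f' x)%:E = \int[mu]_x (f' x * phi x)%:E)%E].
  apply: (@integrable_quad_normal _ (2 * K)) => // x.
  apply: (le_trans (f'K x)).
  have := absx x; nra.
pose h x := f' x * phi x - x * f x * phi x.
have ih : mu.-integrable setT (EFin \o h).
  by apply: eq_integrable (integrableB measurableT i2 i1).
suff : (\int[mu]_x (h x)%:E = 0)%E.
  under eq_integral do rewrite EFinB.
  rewrite integralB// => /eqP; rewrite sube_eq ?fin_num_adde_defl ?integrable_fin_num//.
  by rewrite add0e => /eqP.
have mh : measurable_fun setT h.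
  by apply: measurable_funB; apply: measurable_funM => //; [exact: measurable_normal_pdf
    |exact: measurable_funM|exact: measurable_normal_pdf].
have ch : continuous h.
  move=> x; apply: (@cvgB _ R^o); first exact: cvgM (cf' x) (cphi x).
  exact: cvgM (cvgM cvg_id (cf x)) (cphi x).
pose F x := f x * phi x.
have dF x : is_derive x (1 : R) F (h x).
  have := is_derive_normal_pdf x; have := df x => ? ?.
  apply: is_derive_eq.
  by rewrite -![_ *: _]/(_ * _) /h; ring.
pose a (N : nat) : R := N.+1%:R.
have ftc (N : nat) : (\int[mu]_(x in `[(- a N)%R, a N]) (h x)%:E =
    (F (a N))%:E - (F (- a N)%R)%:E)%E.
  have cF : continuous F by move=> x; exact: cvgM (cf x) (cphi x).
  apply: continuous_FTC2.
  - by rewrite gtrN// /a ltr0n.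
  - exact: continuous_subspaceT.
  - split=> [x _||]; first by have [] := dF x.
      by apply: cvg_at_right_filter; exact: cF.
    by apply: cvg_at_left_filter; exact: cF.
  - by move=> x _; rewrite derive1E; have [] := dF x.
have lim1 : (\int[mu]_(x in `[(- a N)%R, a N]) (h x)%:E)%E @[N --> \oo] -->
    (\int[mu]_x (h x)%:E)%E.
  under eq_fun do rewrite integral_mkcond.
  apply: (@dominated_cvg _ _ _ mu setT measurableT _ _ (fun x => `|h x|%:E)).
  - move=> N; apply/(measurable_restrictT _ _).1 => //.
    exact/measurable_EFinP/measurable_funTS.
  - move=> x _; apply: cvg_near_cst; near=> N.
    rewrite patchE mem_set//= in_itv/= -ler_norml.
    near: N; have [M _ HM] := nbhs_infty_ger `|x|.
    exists M => // N /HM /=; move=> /le_trans; apply.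
    by rewrite /a ler_nat.
  - by [].
  - by move/integrable_norm : ih.
  - move=> N x _; rewrite patchE; case: ifP => // _.
    by rewrite abse0.
have lim2 : ((F (a N))%:E - (F (- a N)%R)%:E)%E @[N --> \oo] --> (0 : \bar R)%E.
  have [C C0 HC] := normal_pdf_sqr_bound.
  have FC x : 1 <= `|x| -> `|F x| <= 2 * K * C * `|x|^-1.
    move=> x1; rewrite /F normrM (ger0_norm (normal_pdf_ge0 0 1 x)).
    have x0 : 0 < `|x| by apply: lt_le_trans x1.
    rewrite ler_pdivlMr//.
    have := HC x; rewrite -(real_normK (num_real x)) => {}HC.
    have p0 := normal_pdf_ge0 0 1 x.
    apply: (@le_trans _ _ (2 * K * (`|x| ^+ 2 * phi x))); last first.
      by rewrite -mulrA -[leRHS]mulrA ler_wpM2l// ler_wpM2l.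
    rewrite mulrAC [leRHS]mulrA ler_wpM2r//.
    rewrite expr2 mulrA ler_wpM2r//; apply: le_trans (fK x) _; nra.
  have aN N : 1 <= a N by rewrite /a ler1n.
  have aN' N : `|a N| = a N by rewrite ger0_norm// /a.
  under eq_fun do rewrite -EFinB.
  apply: cvg_EFin; first by near=> N.
  rewrite /comp/=; apply/cvgrPdist_le => e e0.
  have /cvgrPdist_le /(_ e e0) : (4 * K * C * harmonic N @[N --> \oo] --> (0 : R)).
    by rewrite -[X in _ --> X](mulr0 (4 * K * C)); apply: cvgMr; exact: cvg_harmonic.
  apply: filterS => N; rewrite !sub0r !normrN; apply: le_trans.
  apply: le_trans (ler_normB _ _) _.
  have h1 := FC _ (eq_ind_r (fun z => 1 <= z) (aN N) (aN' N)).
  have := FC (- a N); rewrite normrN aN' => /(_ (aN N)) h2.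
  apply: le_trans (lerD h1 h2) _.
  rewrite aN' ger0_norm; first by rewrite [leRHS](_ : _ = 2 * K * C / a N + 2 * K * C / a N)//
    /harmonic /a /=; ring.
  by rewrite !mulr_ge0// invr_ge0.
move: lim1; under eq_fun do rewrite ftc.
by move=> /cvg_unique /(_ lim2); apply; exact: ereal_hausdorff.
Unshelve. all: by end_near.
Qed.
End gauss1.

(** * Equality of laws and resampling of one coordinate *)

Section law_unique.
Context d d' (V : measurableType d) (U : measurableType d') (R : realType).
Variables (n : nat) (pr : 'I_n -> V -> U) (m1 m2 : {measure set V -> \bar R}).
Hypothesis mpr : forall j, measurable_fun setT (pr j).
Hypothesis gen : forall A : set V, measurable A ->
  <<s [set pr j @^-1` B | j in setT & B in measurable] >> A.

(** Boxes are stable under intersection and, by [gen], generate the sigma-algebra. Keeping [pr]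
    abstract lets one statement serve both for the entries of a vector and for the columns of a
    matrix. *)
Lemma law_unique : m1 setT = 1%E ->
  (forall B : 'I_n -> set U, (forall j, measurable (B j)) ->
     m1 [set v | forall j, B j (pr j v)] = m2 [set v | forall j, B j (pr j v)]) ->
  forall A, measurable A -> m1 A = m2 A.
Proof.
move=> m1T m12.
pose G : set (set V) := [set [set v | forall j, B j (pr j v)] | B in
  [set B : 'I_n -> set U | forall j, measurable (B j)]].
have GT : G setT.
  by exists (fun=> setT); [move=> j; exact: measurableT|apply/seteqP; split].
apply: (measure_unique G (fun=> setT)) => //.
- apply/seteqP; split.
    move=> A /gen; apply: sub_sigma_algebra2 => _ [j _ [B mB <-]].
    exists (fun i => if i == j then B else setT).
      by move=> i; case: ifP.
    apply/seteqP; split=> v /=; first by move=> /(_ j); rewrite eqxx.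
    by move=> Bv i; case: eqP => // ->.
  apply: smallest_sub; first exact: sigma_algebra_measurable.
  move=> _ [B mB <-].
  rewrite (_ : [set v | _] = \bigcap_(j in setT) (pr j @^-1` B j)); last first.
    by apply/seteqP; split=> v /= Bv; [move=> j _; exact: Bv|move=> j; exact: Bv].
  apply: fin_bigcap_measurable => // j _.
  by rewrite -[X in measurable X]setTI; exact: mpr.
- move=> _ _ [B mB <-] [C mC <-]; exists (fun j => B j `&` C j).
    by move=> j; exact: measurableI.
  apply/seteqP; split=> v /=; first by move=> h; split=> j; have [] := h j.
  by move=> [h1 h2] j; split; [exact: h1|exact: h2].
- by rewrite bigcup_const.
- by move=> _ [B mB <-]; exact: m12.
- by move=> _; rewrite m1T ltry.
Qed.

End law_unique.

Section matrix_measurability.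
Context (R : realType).

Lemma measurable_mxentry m n (i : 'I_m) (j : 'I_n) :
  measurable_fun setT (fun M : 'M[R]_(m, n) => M i j).
Proof.
move=> _ B mB; rewrite setTI; apply: sub_sigma_algebra.
by exists (i, j) => //; exists B => //; rewrite setTI.
Qed.

Lemma measurable_mxP d (T : measurableType d) m n (f : T -> 'M[R]_(m, n)) :
  (forall i j, measurable_fun setT (fun t => f t i j)) -> measurable_fun setT f.
Proof.
move=> mf; apply: (measurability (\bigcup_(ij in [set: 'I_m * 'I_n])
  preimage_set_system setT (fun M : 'M[R]_(m, n) => M ij.1 ij.2) measurable)).
  by [].
move=> _ [_ [[i j] _ [B mB <-]] <-]; rewrite !setTI.
by rewrite -[X in measurable X]setTI; exact: mf.
Qed.

Lemma mx_sigma_algebra_cols m n (A : set 'M[R]_(m, n)) : measurable A ->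
  <<s [set (fun M => col j M) @^-1` B | j in [set: 'I_n] &
    B in (measurable : set (set 'cV[R]_m))] >> A.
Proof.
apply: sub_sigma_algebra2 => _ [[i j] _ [B mB <-]].
exists j => //; exists ((fun v : 'cV[R]_m => v i 0) @^-1` B).
  by rewrite -[X in measurable X]setTI; exact: measurable_mxentry.
by apply/seteqP; split=> M /=; rewrite mxE => //; case.
Qed.

Lemma cV_sigma_algebra_entries m (A : set 'cV[R]_m) : measurable A ->
  <<s [set (fun v : 'cV[R]_m => v i 0) @^-1` B | i in [set: 'I_m] &
    B in (measurable : set (set R))] >> A.
Proof.
apply: sub_sigma_algebra2 => _ [[i j] _ [B mB <-]].
exists i => //; exists B => //.
by apply/seteqP; split=> M /=; rewrite (ord1 j) => //; case.
Qed.

Lemma measurable_col m n (j : 'I_n) :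
  measurable_fun setT (fun M : 'M[R]_(m, n) => col j M).
Proof.
apply: measurable_mxP => i k; under eq_fun do rewrite mxE.
exact: measurable_mxentry.
Qed.

End matrix_measurability.

Section resample.
Context d1 d2 d3 (T : measurableType d1) (U : measurableType d2)
  (V : measurableType d3) (R : realType).
Variables (P : probability T R) (nu : probability U R).
Variables (X : T -> V) (Z : T * U -> V).
Hypotheses (mX : measurable_fun setT X) (mZ : measurable_fun setT Z).
Hypothesis XZ : forall A, measurable A -> P (X @^-1` A) = (P \x nu)%E (Z @^-1` A).

Lemma ge0_resample (f : V -> \bar R) : measurable_fun setT f ->
  (forall v, 0 <= f v)%E ->
  (\int[P]_w f (X w) = \int[(P \x nu)]_z f (Z z))%E.
Proof.
move=> mf f0.
transitivity (\int[pushforward P X]_v f v)%E.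
  by rewrite ge0_integral_pushforward.
transitivity (\int[pushforward (P \x nu)%E Z]_v f v)%E; last first.
  by rewrite ge0_integral_pushforward.
by apply: eq_measure_integral => A mA _; exact: XZ.
Qed.

(** Replaces conditioning. In its uses [Z] is [X] with one coordinate redrawn independently from its
    own law, which does not change the joint law; Fubini then integrates that coordinate first, the
    others being frozen. *)
Lemma resample (f : V -> R) : measurable_fun setT f ->
  P.-integrable setT (EFin \o f \o X) ->
  (\int[P]_w (f (X w))%:E = \int[P]_w \int[nu]_u (f (Z (w, u)))%:E)%E.
Proof.
move=> mf iX.
have iZ : (P \x nu)%E.-integrable setT (EFin \o f \o Z).
  move/integrableP : iX => [mfX iX]; apply/integrableP; split.
    by apply: measurableT_comp => //; exact/measurable_EFinP.
  rewrite -(ge0_resample (f := fun v => `|(f v)%:E|%E))//.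
  by apply: measurableT_comp => //; exact/measurable_EFinP.
rewrite [RHS](integral12_prod_meas1 (f := EFin \o f \o Z))//.
transitivity (\int[pushforward P X]_v (f v)%:E)%E.
  by rewrite integral_pushforward//; exact/measurable_EFinP.
transitivity (\int[pushforward (P \x nu)%E Z]_v (f v)%:E)%E; last first.
  by rewrite integral_pushforward//; exact/measurable_EFinP.
by apply: eq_measure_integral => A mA _; exact: XZ.
Qed.

End resample.

Section norm1.
Context (R : realType).

(** The entrywise l^1 norm is submultiplicative for all rectangular shapes and bounds every entry
    and the trace, all with constant 1. *)
Definition norm1 m n (A : 'M[R]_(m, n)) : R := \sum_i \sum_j `|A i j|.

Lemma norm1_ge0 m n (A : 'M[R]_(m, n)) : 0 <= norm1 A.
Proof. by apply: sumr_ge0 => i _; apply: sumr_ge0. Qed.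

Lemma le_entry_norm1 m n (A : 'M[R]_(m, n)) i j : `|A i j| <= norm1 A.
Proof.
rewrite /norm1 (bigD1 i)//= (bigD1 j)//= -addrA lerDl addr_ge0//.
  by apply: sumr_ge0.
by apply: sumr_ge0 => ? _; apply: sumr_ge0.
Qed.

Lemma norm1_le m n (A : 'M[R]_(m, n)) (c : R) : (forall i j, `|A i j| <= c) ->
  norm1 A <= c *+ (m * n).
Proof.
move=> Ac; apply: (@le_trans _ _ (\sum_(i < m) \sum_(j < n) c)).
  by apply: ler_sum => i _; apply: ler_sum => j _.
by rewrite !sumr_const !card_ord -mulrnA mulnC.
Qed.

Lemma norm1D m n (A B : 'M[R]_(m, n)) : norm1 (A + B) <= norm1 A + norm1 B.
Proof.
rewrite -big_split /=; apply: ler_sum => i _; rewrite -big_split /=.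
by apply: ler_sum => j _; rewrite mxE ler_normD.
Qed.

Lemma norm1N m n (A : 'M[R]_(m, n)) : norm1 (- A) = norm1 A.
Proof.
by apply: eq_bigr => i _; apply: eq_bigr => j _; rewrite mxE normrN.
Qed.

Lemma norm1B m n (A B : 'M[R]_(m, n)) : norm1 (A - B) <= norm1 A + norm1 B.
Proof. by rewrite -(norm1N B) norm1D. Qed.

Lemma norm1Z m n (c : R) (A : 'M[R]_(m, n)) : norm1 (c *: A) = `|c| * norm1 A.
Proof.
rewrite mulr_sumr; apply: eq_bigr => i _; rewrite mulr_sumr.
by apply: eq_bigr => j _; rewrite mxE normrM.
Qed.

Lemma norm1_tr m n (A : 'M[R]_(m, n)) : norm1 A^T = norm1 A.
Proof.
rewrite /norm1 exchange_big; apply: eq_bigr => i _; apply: eq_bigr => j _.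
by rewrite mxE.
Qed.

Lemma norm1M m n p (A : 'M[R]_(m, n)) (B : 'M[R]_(n, p)) :
  norm1 (A *m B) <= norm1 A * norm1 B.
Proof.
apply: (@le_trans _ _ (\sum_i \sum_k \sum_j `|A i j| * `|B j k|)).
  apply: ler_sum => i _; apply: ler_sum => k _; rewrite mxE.
  by apply: le_trans (ler_norm_sum _ _ _) _; apply: ler_sum => j _; rewrite normrM.
rewrite /norm1 mulr_suml; apply: ler_sum => i _; rewrite exchange_big mulr_suml.
apply: ler_sum => j _; rewrite -mulr_sumr ler_wpM2l//.
by rewrite [leRHS](bigD1 j)//= lerDl; apply: sumr_ge0 => ? _; apply: sumr_ge0.
Qed.

Lemma norm1_trace n (A : 'M[R]_n) : `|\tr A| <= norm1 A.
Proof.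
apply: le_trans (ler_norm_sum _ _ _) _; apply: ler_sum => i _.
by rewrite (bigD1 i)//= lerDl sumr_ge0.
Qed.

Lemma norm1_delta m n i j : norm1 (delta_mx i j : 'M[R]_(m, n)) = 1.
Proof.
rewrite /norm1 (bigD1 i)//= (bigD1 j)//= big1 ?big1 ?addr0.
- by rewrite mxE !eqxx normr1.
- by move=> k ki; apply: big1 => h _; rewrite mxE (negbTE ki) normr0.
- by move=> k kj; rewrite mxE (negbTE kj) andbF normr0.
Qed.

(** Cauchy-Schwarz against the constant 1, obtained by summing 2 |x| |y| <= x^2 + y^2 over all pairs
    of entries. *)
Lemma sqr_norm1_le m n (A : 'M[R]_(m, n)) :
  norm1 A ^+ 2 <= (m * n)%:R * \sum_i \sum_j A i j ^+ 2.
Proof.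
rewrite /norm1 !pair_bigA/=.
have -> : (m * n)%:R = \sum_(p : 'I_m * 'I_n) 1 :> R.
  by rewrite sumr_const cardT -cardE card_prod !card_ord.
rewrite expr2 !mulr_suml.
under [leLHS]eq_bigr do rewrite mulr_sumr; under [leRHS]eq_bigr do rewrite mul1r.
rewrite -(ler_pM2l (ltr0Sn R 1)) mulr_sumr [leRHS](_ : _ =
  \sum_(p : 'I_m * 'I_n) \sum_(q : 'I_m * 'I_n) (A p.1 p.2 ^+ 2 + A q.1 q.2 ^+ 2)).
  apply: ler_sum => p _; rewrite mulr_sumr; apply: ler_sum => q _.
  rewrite -(real_normK (num_real (A p.1 p.2))) -(real_normK (num_real (A q.1 q.2))).
  have := sqr_ge0 (`|A p.1 p.2| - `|A q.1 q.2|); nra.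
under [RHS]eq_bigr do rewrite big_split.
by rewrite big_split/= [in RHS]exchange_big/= mulr_natl mulr2n.
Qed.

Lemma measurable_norm1 d (T : measurableType d) m n (f : T -> 'M[R]_(m, n)) :
  (forall i j, measurable_fun setT (fun t => f t i j)) ->
  measurable_fun setT (fun t => norm1 (f t)).
Proof.
move=> mf; apply: measurable_sum => i; apply: measurable_sum => j.
exact: measurableT_comp (mf i j).
Qed.

End norm1.

Lemma integrable_quad_growth d (T : measurableType d) (R : realType)
    (P : {measure set T -> \bar R}) m n (W : T -> 'M[R]_(m, n)) (K : R) (F : T -> R) :
  P.-integrable setT (fun w => ((1 + norm1 (W w)) ^+ 2)%:E) ->
  measurable_fun setT F -> (forall w, `|F w| <= K * (1 + norm1 (W w)) ^+ 2) ->
  P.-integrable setT (EFin \o F).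
Proof.
move=> iW mF FK.
apply: (@le_integrable _ _ _ P _ measurableT _
    (fun w => K%:E * ((1 + norm1 (W w)) ^+ 2)%:E)%E).
- exact/measurable_EFinP.
- by move=> w _; rewrite lee_fin; apply: le_trans (FK w) (ler_norm _).
- exact: integrableZl.
Qed.

(** * Stein's identity for standard normal vectors *)

Section std_normal.
Context (R : realType) (l : nat) (nu : probability 'cV[R]_l R).
Hypothesis nuN : std_normal_law nu.
Local Notation N01 := (@normal_prob R 0 1).

Definition set_entry (k : 'I_l) (zx : 'cV[R]_l * measurableTypeR R) : 'cV[R]_l :=
  \col_i (if i == k then zx.2 else zx.1 i 0).

Lemma measurable_set_entry k : measurable_fun setT (set_entry k).
Proof.
apply: measurable_mxP => i j; under eq_fun do rewrite mxE.
case: (eqVneq i k) => _; first exact: measurable_snd.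
exact: measurableT_comp (measurable_mxentry i 0) measurable_fst.
Qed.

Lemma std_normal_resample k A : measurable A ->
  nu (id @^-1` A) = (nu \x N01)%E (set_entry k @^-1` A).
Proof.
rewrite preimage_id.
have mz := measurable_set_entry k.
apply: (@law_unique _ _ _ (measurableTypeR R) R l (fun i (v : 'cV[R]_l) => v i 0) nu
  (pushforward (nu \x N01)%E (set_entry k))).
- by move=> j; exact: measurable_mxentry.
- exact: cV_sigma_algebra_entries.
- exact: probability_setT.
move=> B mB; transitivity (\prod_(i < l) N01 (B i))%E; first exact: nuN mB.
(* [B'] lifts the constraint on entry k, which turns the box event into a product: the old vector
   must meet the other constraints, and the fresh entry must lie in [B k]. *)
pose B' i := if i == k then setT else B i.
have mB' i : measurable (B' i) by rewrite /B'; case: ifP.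
transitivity ((nu \x N01)%E
  ([set z : 'cV[R]_l | forall i, B' i (z i 0)] `*` B k)); last first.
  congr (_ _); apply/esym.
  apply/seteqP; split=> -[z x] /=.
    move=> H; split=> [i|]; last by have := H k; rewrite mxE eqxx.
    by have := H i; rewrite mxE /B'; case: eqP.
  by move=> [H Bx] i; have := H i; rewrite mxE /B'; case: eqP => // ->.
rewrite product_measure1E//; last first.
  rewrite (_ : mkset _ = \bigcap_(i in setT) ((fun z : 'cV[R]_l => z i 0) @^-1` B' i)).
    apply: fin_bigcap_measurable => // i _.
    have := @measurable_mxentry R l 1 i 0 measurableT _ (mB' i).
    by rewrite setTI.
  by apply/seteqP; split=> z H i; [move=> _; exact: H|exact: (H i Logic.I)].
rewrite [X in _ = (X * _)%E](_ : _ = \prod_(i < l) N01 (B' i))%E; last exact: nuN mB'.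
rewrite (bigD1 k)//= [in RHS](bigD1 k)//= muleC; congr (_ * _)%E.
rewrite {1}/B' eqxx [X in (X * _)%E]probability_setT mul1e.
by apply: eq_bigr => i ik; rewrite /B' (negbTE ik).
Qed.

Lemma set_entryE k z x :
  set_entry k (z, x) = set_entry k (z, 0) + x *: delta_mx k 0.
Proof.
apply/colP => i; rewrite !mxE eqxx andbT.
by case: eqP => _; rewrite ?add0r ?mulr1// mulr0 addr0.
Qed.

Lemma integrable_sqr_entry k : nu.-integrable setT (fun z => (z k 0 ^+ 2)%:E).
Proof.
have mz : measurable_fun setT (fun z : 'cV[R]_l => z k 0) := measurable_mxentry k 0.
apply/integrableP; split.
  by apply/measurable_EFinP; exact: measurable_funX.
have m2 : measurable_fun setT (fun v : 'cV[R]_l => `|(v k 0 ^+ 2)%:E|%E).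
  apply: measurableT_comp => //.
  by apply/measurable_EFinP; exact: measurable_funX.
rewrite (ge0_resample (X := id) _ (measurable_set_entry k) (std_normal_resample k)
   (f := fun v => `|(v k 0 ^+ 2)%:E|%E))//.
rewrite fubini_tonelli1//; last by apply: measurableT_comp m2 _; exact: measurable_set_entry.
rewrite (eq_integral (cst (\int[N01]_x `|(x ^+ 2)%:E|)%E)); last first.
  by move=> z _; apply: eq_integral => x _; rewrite mxE eqxx.
rewrite integral_cst// [X in (_ * X)%E]probability_setT mule1.
have [||_ /integrableP[]//] := @integrable_quad_normal R (fun x => x ^+ 2) 1.
  exact: measurable_funX.
by move=> x; rewrite mul1r ger0_norm ?sqr_ge0// lerDr.
Qed.

Lemma integrable_sqr_norm1 :
  nu.-integrable setT (fun z => ((1 + norm1 z) ^+ 2)%:E).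
Proof.
have mn : measurable_fun setT (fun z : 'cV[R]_l => norm1 z).
  by apply: measurable_norm1 => i j; exact: measurable_mxentry.
apply: (@le_integrable _ _ _ nu _ measurableT _
  (fun z => 2%:E * (1%:E + l%:R%:E * \sum_(i < l) (z i 0 ^+ 2)%:E))%E).
- by apply/measurable_EFinP/measurable_funX/measurable_funD.
- move=> z _; rewrite sumEFin.
  rewrite [X in (_ <= `|X|)%E](_ : _ = (2 * (1 + l%:R * \sum_(i < l) z i 0 ^+ 2))%:E)//.
  rewrite lee_fin.
  apply: le_trans (ler_norm _).
  have := sqr_norm1_le z; rewrite muln1.
  under eq_bigr do rewrite big_ord1.
  rewrite ger0_norm ?sqr_ge0//.
  have := sqr_ge0 (norm1 z - 1); nra.
- apply: integrableZl => //; apply: integrableD => //.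
    exact: finite_measure_integrable_cst.
  apply: integrableZl => //; apply: integrable_sum => // i _.
  exact: integrable_sqr_entry.
Qed.

(** After entry k is redrawn, the inner integral runs along the line z0 + x e_k, where the
    one-dimensional identity applies. The growth constant used there may depend on the line, that
    is, on z0. *)
Lemma stein_std_normal k (f f' : 'cV[R]_l -> R) (K : R) :
  measurable_fun setT f -> measurable_fun setT f' ->
  (forall z t, is_derive t (1 : R) (fun s => f (z + s *: delta_mx k 0))
     (f' (z + t *: delta_mx k 0))) ->
  (forall z, continuous (fun t : R => f' (z + t *: delta_mx k 0))) ->
  (forall z, `|f z| <= K * (1 + norm1 z)) ->
  (forall z, `|f' z| <= K * (1 + norm1 z)) ->
  (\int[nu]_z (z k 0 * f z)%:E = \int[nu]_z (f' z)%:E)%E.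
Proof.
move=> mf mf' df cf fK f'K.
have K0 : 0 <= K.
  have := le_trans (normr_ge0 _) (fK 0); rewrite pmulr_lge0//.
  by rewrite ltr_pwDl// norm1_ge0.
have mzk := measurable_set_entry k.
have i1 : nu.-integrable setT (EFin \o (fun z : 'cV[R]_l => z k 0 * f z)).
  apply: (@le_integrable _ _ _ nu _ measurableT _
    (fun z : 'cV[R]_l => K%:E * ((1 + norm1 z) ^+ 2)%:E)%E).
  - apply/measurable_EFinP/measurable_funM => //; exact: measurable_mxentry.
  - move=> z _; rewrite lee_fin; apply: le_trans (ler_norm _).
    rewrite normrM expr2 mulrCA; apply: ler_pM => //.
    by apply: le_trans (le_entry_norm1 z k 0) _; rewrite lerDr.
  - by apply: integrableZl => //; exact: integrable_sqr_norm1.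
have i2 : nu.-integrable setT (EFin \o f').
  apply: (@le_integrable _ _ _ nu _ measurableT _
    (fun z : 'cV[R]_l => K%:E * ((1 + norm1 z) ^+ 2)%:E)%E).
  - exact/measurable_EFinP.
  - move=> z _; rewrite lee_fin; apply: le_trans (ler_norm _).
    apply: le_trans (f'K z) _; rewrite ler_wpM2l// expr2 ler_peMr//.
      by rewrite addr_ge0// norm1_ge0.
    by rewrite lerDl norm1_ge0.
  - by apply: integrableZl => //; exact: integrable_sqr_norm1.
rewrite (resample (X := id) _ mzk (std_normal_resample k)
  (f := fun v => v k 0 * f v))//; last 1 first.
  by apply: measurable_funM => //; exact: measurable_mxentry.
rewrite (resample (X := id) _ mzk (std_normal_resample k) (f := f'))//.
apply: eq_integral => z _.
under eq_integral do rewrite set_entryE.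
under [RHS]eq_integral do rewrite set_entryE.
set z0 := set_entry k (z, 0).
have zk0 : z0 k 0 = 0 by rewrite mxE eqxx.
have ent x : (z0 + x *: delta_mx k 0) k 0 = x.
  rewrite mxE [X in X + _]zk0 add0r.
  by rewrite !mxE !eqxx mulr1.
under eq_integral do rewrite ent.
have bd x : 1 + norm1 (z0 + x *: delta_mx k 0) <= (1 + norm1 z0) * (1 + `|x|).
  apply: le_trans (lerD (lexx 1) (norm1D _ _)) _.
  rewrite norm1Z norm1_delta mulr1.
  have := norm1_ge0 z0; have := normr_ge0 x; nra.
apply: (@stein_normal R _ _ (K * (1 + norm1 z0))) => //.
- by move=> x; rewrite -mulrA; apply: le_trans (fK _) _; rewrite ler_wpM2l.
- by move=> x; rewrite -mulrA; apply: le_trans (f'K _) _; rewrite ler_wpM2l.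
Qed.

End std_normal.

(** * Stein's identity for matrices with Gaussian columns *)

Section c1.
Context (R : realType) (r n : nat).
Implicit Types (F : 'M[R]_(r, n) -> R) (dF : 'M[R]_(r, n) -> 'M[R]_(r, n) -> R).

(* dF y E is the derivative of F at y in the direction E. *)
Record line_C1 F dF : Prop := LineC1 {
  line_derive : forall y E t,
    is_derive t (1 : R) (fun s => F (y + s *: E)) (dF (y + t *: E) E);
  line_continuous : forall y E, continuous (fun t : R => dF (y + t *: E) E);
  line_linear : forall y a E E', dF y (a *: E + E') = a * dF y E + dF y E';
  line_measurable : measurable_fun setT F;
  line_dmeasurable : forall E, measurable_fun setT (dF ^~ E) }.

Record linear_growth (K : R) F dF : Prop := LinearGrowth {
  growth_fun : forall y, `|F y| <= K * (1 + norm1 y);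
  growth_derive : forall y E, `|dF y E| <= K * norm1 E * (1 + norm1 y) }.

End c1.

Section gaussian_columns.
Context (R : realType) (r n : nat) d (T : measurableType d).

(** The factor [L] is rectangular and may vary with the column, because the columns of interest are
    C (X_j - mu), with factor C A_j where each X_j brings its own A_j. *)
Record gaussian_columns (P : probability T R) (Y : T -> 'M[R]_(r, n))
    (Gam : 'M[R]_r) : Prop := GaussianColumns {
  gcol_measurable : measurable_fun setT Y;
  gcol_indep : forall (J : {set 'I_n}) (D : 'I_n -> set 'cV[R]_r),
    (forall j, measurable (D j)) ->
    P [set w | forall j, j \in J -> D j (col j (Y w))] =
    (\prod_(j in J) P [set w | D j (col j (Y w))])%E;
  gcol_law : forall j, exists l (L : 'M[R]_(r, l)) (nu : probability 'cV[R]_l R),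
    [/\ L *m L^T = Gam, std_normal_law nu &
      forall D : set 'cV[R]_r, measurable D ->
        P [set w | D (col j (Y w))] = nu [set z | D (L *m z)]] }.

Context (P : probability T R) (Y : T -> 'M[R]_(r, n)) (Gam : 'M[R]_r).
Hypothesis gY : gaussian_columns P Y Gam.

Let mY := gcol_measurable gY.

Lemma measurable_mulmx_entry m l (L : 'M[R]_(m, l)) i :
  measurable_fun setT (fun z : 'cV[R]_l => (L *m z) i 0).
Proof.
under eq_fun do rewrite mxE; apply: measurable_sum => j.
apply: measurable_funM => //; exact: measurable_mxentry.
Qed.

Lemma measurable_mulmxr m l (L : 'M[R]_(m, l)) :
  measurable_fun setT (fun z : 'cV[R]_l => L *m z).
Proof.
by apply: measurable_mxP => i j; rewrite (ord1 j); exact: measurable_mulmx_entry.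
Qed.

Definition set_col (i : 'I_n) (y : 'M[R]_(r, n)) (v : 'cV[R]_r) : 'M[R]_(r, n) :=
  \matrix_(b, j) if j == i then v b 0 else y b j.

Lemma set_colD i y v u : set_col i y (v + u) = set_col i y v + u *m delta_mx 0 i.
Proof.
apply/matrixP => b j; rewrite !mxE big_ord1 !mxE eqxx /=.
by case: eqP => _; rewrite ?mulr1// mulr0 addr0.
Qed.

Lemma norm1_set_col i y v : norm1 (set_col i y v) <= norm1 y + norm1 v.
Proof.
have -> : norm1 y + norm1 v = \sum_b (\sum_j `|y b j| + `|v b 0|).
  by rewrite big_split; congr (_ + _); apply: eq_bigr => b _; rewrite big_ord1.
apply: ler_sum => b _; rewrite (bigD1 i)//= mxE eqxx addrC lerD//.
rewrite [leRHS](bigD1 i)//= -[leLHS]add0r lerD//.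
by apply: ler_sum => j ji; rewrite mxE (negbTE ji).
Qed.

Lemma integrable_sqr_entryY b j : P.-integrable setT (fun w => (Y w b j ^+ 2)%:E).
Proof.
have [l [L [nu [_ nuN law]]]] := gcol_law gY j.
have me : measurable_fun setT (fun w => Y w b j).
  exact: measurableT_comp (measurable_mxentry b j) mY.
have mc : measurable_fun setT (fun w => col j (Y w)).
  exact: measurableT_comp (measurable_col j) mY.
apply/integrableP; split; first by apply/measurable_EFinP; exact: measurable_funX.
have mg : measurable_fun setT (fun v : 'cV[R]_r => `|(v b 0 ^+ 2)%:E|%E).
  apply: measurableT_comp => //; apply/measurable_EFinP/measurable_funX.
  exact: measurable_mxentry.
have -> : (\int[P]_w `|(Y w b j ^+ 2)%:E| =
    \int[pushforward P (fun w => col j (Y w))]_v `|(v b 0 ^+ 2)%:E|)%E.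
  rewrite ge0_integral_pushforward//; apply: eq_integral => w _ /=.
  by rewrite mxE.
have -> : (\int[pushforward P (fun w => col j (Y w))]_v `|(v b 0 ^+ 2)%:E| =
    \int[pushforward nu (fun z => L *m z)]_v `|(v b 0 ^+ 2)%:E|)%E.
  apply: eq_measure_integral; first exact: measurable_mulmxr.
  by move=> mL A mA _; exact: (law A mA).
rewrite ge0_integral_pushforward//; last exact: measurable_mulmxr.
suff /integrableP[] : nu.-integrable setT (fun z => ((L *m z) b 0 ^+ 2)%:E) by [].
apply: (@le_integrable _ _ _ nu _ measurableT _
    (fun z : 'cV[R]_l => (norm1 L ^+ 2)%:E * ((1 + norm1 z) ^+ 2)%:E)%E).
- by apply/measurable_EFinP/measurable_funX; exact: measurable_mulmx_entry.
- move=> z _; rewrite lee_fin; apply: le_trans (ler_norm _).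
  rewrite -exprMn normrX lerXn2r// ?nnegrE ?mulr_ge0 ?addr_ge0 ?norm1_ge0//.
  apply: le_trans (le_entry_norm1 _ _ _) _; apply: le_trans (norm1M _ _) _.
  by rewrite ler_wpM2l ?norm1_ge0// lerDr.
- by apply: integrableZl => //; exact: integrable_sqr_norm1.
Qed.

Lemma integrable_sqr_norm1Y :
  P.-integrable setT (fun w => ((1 + norm1 (Y w)) ^+ 2)%:E).
Proof.
have mn : measurable_fun setT (fun w => norm1 (Y w)).
  apply: measurable_norm1 => i j; exact: measurableT_comp (measurable_mxentry i j) mY.
apply: (@le_integrable _ _ _ P _ measurableT _
  (fun w => 2%:E * (1%:E + (r * n)%:R%:E *
     \sum_(i < r) \sum_(j < n) (Y w i j ^+ 2)%:E))%E).
- by apply/measurable_EFinP/measurable_funX/measurable_funD.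
- move=> w _; under eq_bigr do rewrite sumEFin; rewrite sumEFin.
  rewrite [X in (_ <= `|X|)%E](_ : _ = (2 * (1 + (r * n)%:R *
    \sum_(i < r) \sum_(j < n) Y w i j ^+ 2))%:E)//.
  rewrite lee_fin.
  apply: le_trans (ler_norm _).
  have := sqr_norm1_le (Y w).
  rewrite ger0_norm ?sqr_ge0//.
  have := sqr_ge0 (norm1 (Y w) - 1); nra.
- apply: integrableZl => //; apply: integrableD => //.
    exact: finite_measure_integrable_cst.
  apply: integrableZl => //; apply: integrable_sum => // i _.
  by apply: integrable_sum => // j _; exact: integrable_sqr_entryY.
Qed.

Section col.
Context (i : 'I_n) (l : nat) (L : 'M[R]_(r, l)) (nu : probability 'cV[R]_l R).
Hypothesis nuN : std_normal_law nu.
Hypothesis law : forall D : set 'cV[R]_r, measurable D ->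
  P [set w | D (col i (Y w))] = nu [set z | D (L *m z)].

Let Z (wz : T * 'cV[R]_l) := set_col i (Y wz.1) (L *m wz.2).

Let mZ : measurable_fun setT Z.
Proof.
apply: measurable_mxP => b j; under eq_fun do rewrite mxE.
have [_|_] := eqVneq j i.
  exact: measurableT_comp (measurable_mulmx_entry L b) measurable_snd.
exact: measurableT_comp (measurableT_comp (measurable_mxentry b j) mY) measurable_fst.
Qed.

Lemma column_resample A : measurable A ->
  P (Y @^-1` A) = (P \x nu)%E (Z @^-1` A).
Proof.
apply: (@law_unique _ _ _ _ R n (fun j (M : 'M[R]_(r, n)) => col j M)
  (pushforward P Y) (pushforward (P \x nu)%E Z)).
- by move=> j; exact: measurable_col.
- exact: mx_sigma_algebra_cols.
- exact: probability_setT.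
move=> D mD.
have mDc j : measurable [set w | D j (col j (Y w))].
  have := measurableT_comp (measurable_col j) mY measurableT (mD j).
  by rewrite setTI.
transitivity (\prod_(j < n) P [set w | D j (col j (Y w))])%E.
  transitivity (\prod_(j in [set: 'I_n]%SET) P [set w | D j (col j (Y w))])%E; last first.
    by apply: eq_bigl => j; rewrite inE.
  rewrite -[RHS](gcol_indep gY)//; congr (P _); apply/seteqP; split=> w /= H j;
    first by move=> _; exact: H.
  by apply: H; rewrite inE.
transitivity ((P \x nu)%E
  ([set w | forall j, j \in [set~ i]%SET -> D j (col j (Y w))] `*` [set z | D i (L *m z)])).
  rewrite product_measure1E//; last 2 first.
  - rewrite (_ : mkset _ = \bigcap_(j in [set j | j \in [set~ i]%SET]) [set w | D j (col j (Y w))]).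
      exact: fin_bigcap_measurable.
    by apply/seteqP; split.
  - have := measurable_mulmxr L measurableT (mD i).
    by rewrite setTI.
  rewrite (bigD1 i)//= muleC; congr (_ * _)%E; last exact: law.
  transitivity (\prod_(j in [set~ i]%SET) P [set w | D j (col j (Y w))])%E.
    by apply: eq_bigl => j; rewrite !inE.
  exact/esym/(gcol_indep gY).
congr (_ _); apply/seteqP; split=> -[w z] /=.
  move=> [H Hi] j; have [->|ji] := eqVneq j i.
    by rewrite (_ : col i _ = L *m z)//; apply/colP => b; rewrite !mxE eqxx.
  rewrite (_ : col j _ = col j (Y w)); first by apply: H; rewrite !inE.
  by apply/colP => b; rewrite !mxE (negbTE ji).
move=> H; split=> [j|].
  rewrite !inE => ji; have := H j.
  by rewrite (_ : col j _ = col j (Y w))//; apply/colP => b; rewrite !mxE (negbTE ji).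
have := H i.
by rewrite (_ : col i _ = L *m z)//; apply/colP => b; rewrite !mxE eqxx.
Qed.

(** With column i written as L z, the entry (a, i) is the sum of L a k z_k, and moving z_k displaces
    the matrix along L e_k e_i^T. Stein's identity in each z_k, weighted by L a k, adds up by
    linearity of [dF] to the direction L L^T e_a e_i^T. *)
Lemma stein_column (K : R) F dF a : line_C1 F dF -> linear_growth K F dF ->
  (\int[P]_w (Y w a i * F (Y w))%:E =
   \int[P]_w (dF (Y w) (L *m L^T *m delta_mx a i))%:E)%E.
Proof.
move=> [F_d F_c F_l F_m F_dm] [FK dFK].
have K0 : 0 <= K.
  have := le_trans (normr_ge0 _) (FK 0); rewrite pmulr_lge0//.
  by rewrite ltr_pwDl// norm1_ge0.
have F0 y : dF y 0 = 0.
  by have := F_l y (-1) 0 0; rewrite scaler0 addr0 mulN1r addNr.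
have FZ y c E : dF y (c *: E) = c * dF y E.
  by have := F_l y c E 0; rewrite addr0 F0 addr0.
have Fsum y (I : finType) (c : I -> R) (E : I -> 'M[R]_(r, n)) :
    dF y (\sum_k c k *: E k) = \sum_k c k * dF y (E k).
  apply: (big_ind2 (fun E x => dF y E = x)) => //.
  by move=> E1 x1 E2 x2 <- <-; have := F_l y 1 E1 E2; rewrite scale1r mul1r.
set E' := L *m L^T *m delta_mx a i.
pose E k : 'M[R]_(r, n) := L *m delta_mx k i.
have EE : E' = \sum_k L a k *: E k.
  rewrite /E' -mulmxA; under [RHS]eq_bigr do rewrite /E scalemxAr.
  rewrite -mulmx_sumr; congr (_ *m _); apply/matrixP => b j.
  rewrite mxE (bigD1 a)//= big1 ?addr0; last first.
    by move=> c ca; rewrite !mxE (negbTE ca) mulr0.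
  rewrite !mxE eqxx summxE (bigD1 b)//= big1 ?addr0 ?mxE ?eqxx//.
  by move=> c cb; rewrite !mxE eq_sym (negbTE cb) mulr0.
have n1 w : 1 <= 1 + norm1 (Y w) by rewrite lerDl norm1_ge0.
have mYE b j : measurable_fun setT (fun y : 'M[R]_(r, n) => y b j).
  exact: measurable_mxentry.
have i1 : P.-integrable setT (EFin \o (fun w => Y w a i * F (Y w))).
  apply: (integrable_quad_growth (K := K) integrable_sqr_norm1Y).
    apply: measurable_funM; first exact: measurableT_comp (mYE a i) mY.
    exact: measurableT_comp F_m mY.
  move=> w; rewrite normrM expr2 mulrCA ler_pM//.
  by apply: le_trans (le_entry_norm1 _ a i) _; rewrite lerDr.
have i2 : P.-integrable setT (EFin \o (fun w => dF (Y w) E')).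
  apply: (integrable_quad_growth (K := K * norm1 E') integrable_sqr_norm1Y).
    exact: measurableT_comp (F_dm E') mY.
  move=> w; apply: le_trans (dFK _ _) _.
  rewrite ler_wpM2l ?mulr_ge0 ?norm1_ge0// expr2 ler_peMr//.
  by rewrite (le_trans ler01).
rewrite (resample mY mZ column_resample (f := fun y => y a i * F y))//; last first.
  exact: measurable_funM.
rewrite (resample mY mZ column_resample (f := fun y => dF y E'))//.
apply: eq_integral => w _.
have ZD z k t : Z (w, z + t *: delta_mx k 0) = Z (w, z) + t *: E k.
  rewrite /Z/= mulmxDr set_colD; congr (_ + _).
  by rewrite -scalemxAr -scalemxAl -mulmxA mul_delta_mx.
have Zai z : Z (w, z) a i = \sum_k L a k * z k 0 by rewrite mxE eqxx mxE.
have nZ z : 1 + norm1 (Z (w, z)) <= (1 + norm1 (Y w)) * (1 + norm1 L) * (1 + norm1 z).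
  apply: le_trans (lerD (lexx 1) (le_trans (norm1_set_col _ _ _) (lerD (lexx _) (norm1M _ _)))) _.
  have := norm1_ge0 (Y w); have := norm1_ge0 L; have := norm1_ge0 z.
  set x := norm1 (Y w); set y := norm1 L; set z0 := norm1 z => hz hy hx.
  have : 0 <= x * y by exact: mulr_ge0.
  have : 0 <= x * z0 by exact: mulr_ge0.
  have : 0 <= y * z0 by exact: mulr_ge0.
  have : 0 <= x * y * z0 by rewrite !mulr_ge0.
  lra.
have mZw : measurable_fun setT (fun z => Z (w, z)) by exact: measurableT_comp mZ _.
have nz (z : 'cV[R]_l) : 1 <= 1 + norm1 z by rewrite lerDl norm1_ge0.
pose C := (1 + norm1 (Y w)) * (1 + norm1 L).
have C0 : 0 <= C by rewrite mulr_ge0// addr_ge0 ?norm1_ge0.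
have KC : 0 <= K * C by rewrite mulr_ge0.
have KEC k : 0 <= K * norm1 (E k) * C by rewrite mulr_ge0// mulr_ge0// norm1_ge0.
have FK' z : `|F (Z (w, z))| <= K * C * (1 + norm1 z).
  by apply: le_trans (FK _) _; rewrite -mulrA ler_wpM2l.
have dFK' k z : `|dF (Z (w, z)) (E k)| <= K * norm1 (E k) * C * (1 + norm1 z).
  by apply: le_trans (dFK _ _) _; rewrite -[leRHS]mulrA ler_wpM2l// mulr_ge0 ?norm1_ge0.
have inu (G : 'cV[R]_l -> R) D : measurable_fun setT G ->
    (forall z, `|G z| <= D * (1 + norm1 z) ^+ 2) ->
    nu.-integrable setT (EFin \o G).
  by move=> mG; apply: integrable_quad_growth => //; exact: integrable_sqr_norm1.
transitivity (\int[nu]_z \sum_k (L a k * (z k 0 * F (Z (w, z))))%:E)%E.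
  apply: eq_integral => z _; rewrite sumEFin Zai mulr_suml; congr (_%:E).
  by apply: eq_bigr => k _; rewrite mulrA.
transitivity (\int[nu]_z \sum_k (L a k * dF (Z (w, z)) (E k))%:E)%E; last first.
  by apply: eq_integral => z _; rewrite sumEFin EE Fsum.
have j1 k : nu.-integrable setT (EFin \o (fun z : 'cV[R]_l => z k 0 * F (Z (w, z)))).
  apply: (inu _ (K * C)).
    apply: measurable_funM; last exact: measurableT_comp F_m mZw.
    exact: measurable_mxentry.
  move=> z; rewrite normrM expr2 mulrCA ler_pM//.
  by apply: le_trans (le_entry_norm1 _ k 0) _; rewrite lerDr.
have mdF k : measurable_fun setT (fun z => dF (Z (w, z)) (E k)).
  exact: measurableT_comp (F_dm (E k)) mZw.
have j2 k : nu.-integrable setT (EFin \o (fun z => dF (Z (w, z)) (E k))).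
  apply: (inu _ (K * norm1 (E k) * C)) => // z; apply: le_trans (dFK' _ _) _.
  by rewrite ler_wpM2l ?KEC// expr2 ler_peMr// (le_trans ler01).
rewrite !integral_sum//; last 2 first.
- by move=> k; exact: (integrableZl measurableT (L a k) (j2 k)).
- by move=> k; exact: (integrableZl measurableT (L a k) (j1 k)).
apply: eq_bigr => k _.
transitivity ((L a k)%:E * \int[nu]_z (z k 0 * F (Z (w, z)))%:E)%E.
  by rewrite -(integralZl measurableT (j1 k)).
transitivity ((L a k)%:E * \int[nu]_z (dF (Z (w, z)) (E k))%:E)%E; last first.
  by rewrite -(integralZl measurableT (j2 k)).
congr (_ * _)%E.
apply: (@stein_std_normal _ _ _ nuN k (fun z => F (Z (w, z)))
  (fun z => dF (Z (w, z)) (E k)) (K * C + K * norm1 (E k) * C)).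
- exact: measurableT_comp F_m mZw.
- by [].
- move=> z t; rewrite ZD.
  under eq_fun do rewrite ZD.
  exact: F_d.
- by move=> z; under eq_fun do rewrite ZD; exact: F_c.
- move=> z; apply: le_trans (FK' z) _.
  by rewrite ler_wpM2r ?addr_ge0 ?norm1_ge0// lerDl KEC.
- move=> z; apply: le_trans (dFK' k z) _.
  by rewrite ler_wpM2r ?addr_ge0 ?norm1_ge0// lerDr.
Qed.

End col.

Lemma stein_identity (K : R) F dF a i : line_C1 F dF -> linear_growth K F dF ->
  (\int[P]_w (Y w a i * F (Y w))%:E =
   \int[P]_w (dF (Y w) (Gam *m delta_mx a i))%:E)%E.
Proof.
have [l [L [nu [<- nuN law]]]] := gcol_law gY i.
by move=> FC FG; apply: (stein_column nuN law _ FC FG).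
Qed.

End gaussian_columns.

(** The line is cut into {0}, where inversion takes the conventional value 0, and its open
    complement, where inversion is continuous. *)
Lemma measurable_inv (R : realType) : measurable_fun setT (fun x : R => x^-1).
Proof.
have -> : [set: R] = [set 0] `|` ~` [set 0] by rewrite setUv.
apply/measurable_funU => //; first exact: measurableC.
split.
  apply: (@eq_measurable_fun _ _ R R [set 0] (cst 0)); last exact: measurable_cst.
  by move=> x; rewrite inE /= => ->; rewrite invr0.
apply: open_continuous_measurable_fun.
  apply: closed_openC; apply: accessible_closed_set1.
  exact/hausdorff_accessible/norm_hausdorff.
by move=> x; rewrite inE /= => /eqP; exact: inv_continuous.
Qed.

(** * Matrix-valued functions *)

Section mx_measurable.
Context (R : realType) d (T : measurableType d).

Definition mxmeas m n (f : T -> 'M[R]_(m, n)) :=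
  forall i j, measurable_fun setT (fun t => f t i j).

Lemma mxmeas_cst m n (A : 'M[R]_(m, n)) : mxmeas (fun=> A).
Proof. by move=> i j; exact: measurable_cst. Qed.

Lemma mxmeasD m n (f g : T -> 'M[R]_(m, n)) :
  mxmeas f -> mxmeas g -> mxmeas (fun t => f t + g t).
Proof.
by move=> mf mg i j; under eq_fun do rewrite mxE; exact: measurable_funD.
Qed.

Lemma mxmeasN m n (f : T -> 'M[R]_(m, n)) : mxmeas f -> mxmeas (fun t => - f t).
Proof. by move=> mf i j; under eq_fun do rewrite mxE; exact: measurableT_comp (mf i j). Qed.

Lemma mxmeas_tr m n (f : T -> 'M[R]_(m, n)) : mxmeas f -> mxmeas (fun t => (f t)^T).
Proof. by move=> mf i j; under eq_fun do rewrite mxE; exact: mf. Qed.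

Lemma mxmeasM m n p (f : T -> 'M[R]_(m, n)) (g : T -> 'M[R]_(n, p)) :
  mxmeas f -> mxmeas g -> mxmeas (fun t => f t *m g t).
Proof.
move=> mf mg i j; under eq_fun do rewrite mxE.
by apply: measurable_sum => k; exact: measurable_funM.
Qed.

Lemma mxmeasZ m n (c : T -> R) (f : T -> 'M[R]_(m, n)) :
  measurable_fun setT c -> mxmeas f -> mxmeas (fun t => c t *: f t).
Proof.
by move=> mc mf i j; under eq_fun do rewrite mxE; exact: measurable_funM.
Qed.

Lemma measurable_mxtrace n (f : T -> 'M[R]_n) : mxmeas f ->
  measurable_fun setT (fun t => \tr (f t)).
Proof. by move=> mf; apply: measurable_sum => i; exact: mf. Qed.

Lemma measurable_det n (f : T -> 'M[R]_n) : mxmeas f ->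
  measurable_fun setT (fun t => \det (f t)).
Proof.
move=> mf; apply: measurable_sum => s; apply: measurable_funM => //.
by apply: measurable_prod => i _; exact: mf.
Qed.

(* The usual formula for the inverse, meaningful only when the determinant does
   not vanish (it gives 0 otherwise); unlike invmx it has no case distinction. *)
Definition adjinv n (A : 'M[R]_n) : 'M[R]_n := (\det A)^-1 *: \adj A.

Lemma adjinvE n (A : 'M[R]_n) : A \in unitmx -> adjinv A = invmx A.
Proof. by move=> uA; rewrite /invmx uA. Qed.

Lemma mxmeas_adjinv n (f : T -> 'M[R]_n) : mxmeas f -> mxmeas (fun t => adjinv (f t)).
Proof.
move=> mf; apply: mxmeasZ.
  by apply: measurableT_comp; [exact: measurable_inv|exact: measurable_det].
move=> i j; under eq_fun do rewrite mxE; apply: measurable_funM => //.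
by apply: measurable_det => k l; under eq_fun do rewrite !mxE; exact: mf.
Qed.

End mx_measurable.

Section mx_cvg.
Context (R : realType) (T : Type) (F : set_system T) {FF : Filter F}.

(** Entrywise and for an arbitrary filter, since it serves both for difference quotients at a real
    point and for sequences e -> 0. *)
Definition mxcvg m n (f : T -> 'M[R]_(m, n)) (l : 'M[R]_(m, n)) :=
  forall i j, (fun t => f t i j) @ F --> l i j.

Lemma mxcvg_cst m n (A : 'M[R]_(m, n)) : mxcvg (fun=> A) A.
Proof. by move=> i j; exact: cvg_cst. Qed.

Lemma cvg_sum_fin (I : Type) (s : seq I) (f : I -> T -> R) (l : I -> R) :
  (forall i, f i @ F --> l i) ->
  (fun t => \sum_(i <- s) f i t) @ F --> \sum_(i <- s) l i.
Proof.
move=> fl; elim: s => [|i s IH].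
  under eq_fun do rewrite big_nil; rewrite big_nil; exact: cvg_cst.
under eq_fun do rewrite big_cons; rewrite big_cons.
by apply: (@cvgD _ R^o); [exact: fl|exact: IH].
Qed.

Lemma mxcvgD m n (f g : T -> 'M[R]_(m, n)) a b : mxcvg f a -> mxcvg g b ->
  mxcvg (fun t => f t + g t) (a + b).
Proof.
move=> fa gb i j; rewrite mxE; under eq_fun do rewrite mxE.
by apply: (@cvgD _ R^o); [exact: fa|exact: gb].
Qed.

Lemma mxcvgN m n (f : T -> 'M[R]_(m, n)) a : mxcvg f a ->
  mxcvg (fun t => - f t) (- a).
Proof.
move=> fa i j; rewrite mxE; under eq_fun do rewrite mxE.
by apply: (@cvgN _ R^o); exact: fa.
Qed.

Lemma mxcvg_tr m n (f : T -> 'M[R]_(m, n)) a : mxcvg f a ->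
  mxcvg (fun t => (f t)^T) a^T.
Proof. by move=> fa i j; rewrite mxE; under eq_fun do rewrite mxE; exact: fa. Qed.

Lemma mxcvgM m n p (f : T -> 'M[R]_(m, n)) (g : T -> 'M[R]_(n, p)) a b :
  mxcvg f a -> mxcvg g b -> mxcvg (fun t => f t *m g t) (a *m b).
Proof.
move=> fa gb i j; rewrite mxE; under eq_fun do rewrite mxE.
by apply: cvg_sum_fin => k; apply: cvgM; [exact: fa|exact: gb].
Qed.

Lemma mxcvgZ m n (c : T -> R) (f : T -> 'M[R]_(m, n)) (x : R) a :
  c @ F --> x -> mxcvg f a -> mxcvg (fun t => c t *: f t) (x *: a).
Proof.
move=> cx fa i j; rewrite mxE; under eq_fun do rewrite mxE.
by apply: cvgM; [exact: cx|exact: fa].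
Qed.

Lemma cvg_mxtrace n (f : T -> 'M[R]_n) a : mxcvg f a ->
  (fun t => \tr (f t)) @ F --> \tr a.
Proof. by move=> fa; apply: cvg_sum_fin => i; exact: fa. Qed.

End mx_cvg.

Section mxC1.
Context (R : realType) (r n : nat).
Local Notation M := 'M[R]_(r, n).

Definition mxC1 k l (F : M -> 'M[R]_(k, l)) (dF : M -> M -> 'M[R]_(k, l)) :=
  forall i j, line_C1 (fun y => F y i j) (fun y E => dF y E i j).

Lemma line_C1_continuous F dF : line_C1 F dF ->
  forall (y E : M), continuous (fun t : R => F (y + t *: E)).
Proof.
move=> [F_d _ _ _ _] y E t; have [dt _] := F_d y E t.
by apply: differentiable_continuous; exact/derivable1_diffP.
Qed.

Lemma line_C1_cst (c : R) : line_C1 (fun=> c) (fun _ _ : M => 0).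
Proof.
split=> //.
- by move=> y E t; exact: is_derive_cst.
- by move=> y E t; exact: cvg_cst.
- by move=> y a E E'; rewrite mulr0 addr0.
Qed.

Lemma line_C1D F dF G dG : line_C1 F dF -> line_C1 G dG ->
  line_C1 (fun y : M => F y + G y) (fun y E => dF y E + dG y E).
Proof.
move=> [F_d F_c F_l F_m F_dm] [G_d G_c G_l G_m G_dm]; split.
- by move=> y E t; apply: is_deriveD.
- move=> y E t; apply: (@cvgD _ R^o); [exact: F_c|exact: G_c].
- by move=> y a E E'; rewrite F_l G_l; ring.
- exact: measurable_funD.
- by move=> E; exact: measurable_funD.
Qed.

Lemma line_C1M F dF G dG : line_C1 F dF -> line_C1 G dG ->
  line_C1 (fun y : M => F y * G y) (fun y E => dF y E * G y + F y * dG y E).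
Proof.
move=> CF CG; move: (CF) (CG) => [F_d F_c F_l F_m F_dm] [G_d G_c G_l G_m G_dm]; split.
- move=> y E t; apply: is_derive_eq (is_deriveM (F_d y E t) (G_d y E t)) _.
  by rewrite addrC [_ *: dF _ _]mulrC.
- move=> y E t; have cF := @line_C1_continuous F dF CF y E t.
  have cG := @line_C1_continuous G dG CG y E t.
  by apply: (@cvgD _ R^o); apply: cvgM => //; [exact: F_c|exact: G_c].
- by move=> y a E E'; rewrite F_l G_l; ring.
- exact: measurable_funM.
- by move=> E; apply: measurable_funD; exact: measurable_funM.
Qed.

Lemma line_C1_sum (I : Type) (s : seq I) (F : I -> M -> R) dF :
  (forall i, line_C1 (F i) (dF i)) ->
  line_C1 (fun y => \sum_(i <- s) F i y) (fun y E => \sum_(i <- s) dF i y E).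
Proof.
move=> CF; elim: s => [|i s IH].
  have -> : (fun y => \sum_(i <- [::]) F i y) = fun=> 0.
    by apply/funext => y; rewrite big_nil.
  have -> : (fun y E => \sum_(i <- [::]) dF i y E) = fun _ _ => 0.
    by apply/funext => y; apply/funext => E; rewrite big_nil.
  exact: line_C1_cst.
have -> : (fun y => \sum_(k <- i :: s) F k y) = fun y => F i y + \sum_(k <- s) F k y.
  by apply/funext => y; rewrite big_cons.
have -> : (fun y E => \sum_(k <- i :: s) dF k y E) =
    fun y E => dF i y E + \sum_(k <- s) dF k y E.
  by apply/funext => y; apply/funext => E; rewrite big_cons.
exact: line_C1D.
Qed.

Lemma line_C1_eq F dF F' dF' : line_C1 F dF -> (forall y : M, F y = F' y) ->
  (forall y E, dF y E = dF' y E) -> line_C1 F' dF'.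
Proof.
move=> CF FF' dFF'; have <- : F = F' by exact/funext.
by have <- : dF = dF' by apply/funext => y; exact/funext.
Qed.

Lemma mxC1_cst k l (A : 'M[R]_(k, l)) : mxC1 (fun=> A) (fun _ _ => 0).
Proof. by move=> i j; apply: line_C1_eq (line_C1_cst (A i j)) _ _ => // y E; rewrite mxE. Qed.

Lemma mxC1_id : mxC1 id (fun _ E => E).
Proof.
move=> i j; split.
- move=> y E t; have -> : (fun s : R => (y + s *: E) i j) = (fun s => y i j + E i j *: s).
    by apply/funext => s; rewrite !mxE mulrC.
  apply: is_derive_eq; rewrite -![_ *: _]/(_ * _); ring.
- by move=> y E t; exact: cvg_cst.
- by move=> y a E E'; rewrite !mxE.
- exact: measurable_mxentry.
- by move=> E.
Qed.

Lemma mxC1_tr k l (F : M -> 'M[R]_(k, l)) dF : mxC1 F dF ->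
  mxC1 (fun y => (F y)^T) (fun y E => (dF y E)^T).
Proof. by move=> CF i j; apply: line_C1_eq (CF j i) _ _ => *; rewrite mxE. Qed.

Lemma mxC1D k l (F G : M -> 'M[R]_(k, l)) dF dG : mxC1 F dF -> mxC1 G dG ->
  mxC1 (fun y => F y + G y) (fun y E => dF y E + dG y E).
Proof.
by move=> CF CG i j; apply: line_C1_eq (line_C1D (CF i j) (CG i j)) _ _ => *; rewrite mxE.
Qed.

Lemma mxC1M k l m (F : M -> 'M[R]_(k, l)) (G : M -> 'M[R]_(l, m)) dF dG :
  mxC1 F dF -> mxC1 G dG ->
  mxC1 (fun y => F y *m G y) (fun y E => dF y E *m G y + F y *m dG y E).
Proof.
move=> CF CG i j.
apply: line_C1_eq (line_C1_sum (index_enum 'I_l)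
  (fun k => line_C1M (CF i k) (CG k j))) _ _ => *.
  by rewrite mxE.
by rewrite big_split !mxE.
Qed.

Lemma line_C1_trace k (F : M -> 'M[R]_k) dF : mxC1 F dF ->
  line_C1 (fun y => \tr (F y)) (fun y E => \tr (dF y E)).
Proof. by move=> CF; apply: line_C1_sum => i; exact: CF. Qed.

Lemma mxC1Z k l (c : M -> R) dc (F : M -> 'M[R]_(k, l)) dF :
  line_C1 c dc -> mxC1 F dF ->
  mxC1 (fun y => c y *: F y) (fun y E => dc y E *: F y + c y *: dF y E).
Proof.
by move=> Cc CF i j; apply: line_C1_eq (line_C1M Cc (CF i j)) _ _ => *; rewrite !mxE.
Qed.

End mxC1.

(** * The regularized inverse *)

Section quadratic_forms.
Context (R : realType).

Definition sqn k (v : 'cV[R]_k) : R := (v^T *m v) 0 0.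
Definition qf k (A : 'M[R]_k) (v : 'cV[R]_k) : R := (v^T *m A *m v) 0 0.

Lemma sqnE k (v : 'cV[R]_k) : sqn v = \sum_i v i 0 ^+ 2.
Proof. by rewrite /sqn mxE; apply: eq_bigr => i _; rewrite mxE expr2. Qed.

Lemma sqn_ge0 k (v : 'cV[R]_k) : 0 <= sqn v.
Proof. by rewrite sqnE; apply: sumr_ge0 => i _; exact: sqr_ge0. Qed.

Lemma sqn_eq0 k (v : 'cV[R]_k) : sqn v = 0 -> v = 0.
Proof.
rewrite sqnE => /psumr_eq0P v0; apply/colP => i; rewrite mxE; apply/eqP.
by rewrite -sqrf_eq0 v0// => j _; exact: sqr_ge0.
Qed.

Lemma sqr_entry_le_sqn k (v : 'cV[R]_k) i : v i 0 ^+ 2 <= sqn v.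
Proof. by rewrite sqnE (bigD1 i)//= lerDl sumr_ge0// => j _; exact: sqr_ge0. Qed.

Lemma mx11_tr (A : 'M[R]_1) : A^T = A.
Proof. by apply/matrixP => i j; rewrite mxE !ord1. Qed.

Lemma mx11D (A B : 'M[R]_1) : (A + B) 0 0 = A 0 0 + B 0 0.
Proof. by rewrite mxE. Qed.

Lemma mx11N (A : 'M[R]_1) : (- A) 0 0 = - A 0 0.
Proof. by rewrite mxE. Qed.

Lemma mx11Z c (A : 'M[R]_1) : (c *: A) 0 0 = c * A 0 0.
Proof. by rewrite mxE. Qed.

Lemma qf_gram k l (G : 'M[R]_(k, l)) v : qf (G *m G^T) v = sqn (G^T *m v).
Proof. by rewrite /qf /sqn trmx_mul trmxK !mulmxA. Qed.

(** Reduces the sign of a trace against a Gram matrix to the sign of a quadratic form, so that no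
    square root of a positive matrix has to be taken. *)
Lemma mxtrace_qf k l (A : 'M[R]_k) (G : 'M[R]_(k, l)) :
  \tr (A *m (G *m G^T)) = \sum_j qf A (col j G).
Proof.
rewrite mulmxA mxtrace_mulC mulmxA; apply: eq_bigr => j _.
rewrite /qf [RHS]mxE [LHS]mxE; apply: eq_bigr => i _.
rewrite [in RHS]mxE [col j G i 0]mxE; congr (_ * _).
by rewrite [LHS]mxE; apply: eq_bigr => k' _; rewrite !mxE.
Qed.

Lemma mxtrace_gram k l (G : 'M[R]_(k, l)) : \tr (G *m G^T) = \sum_i \sum_j G i j ^+ 2.
Proof.
by apply: eq_bigr => i _; rewrite mxE; apply: eq_bigr => j _; rewrite mxE expr2.
Qed.

Lemma qf_delta k (A : 'M[R]_k) i : qf A (delta_mx i 0) = A i i.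
Proof. by rewrite /qf trmx_delta -rowE -colE !mxE. Qed.

Lemma qfD k (A : 'M[R]_k) (s t : R) (u v : 'cV[R]_k) : A^T = A ->
  qf A (s *: u + t *: v) =
  s ^+ 2 * qf A u + 2 * (s * t) * (u^T *m A *m v) 0 0 + t ^+ 2 * qf A v.
Proof.
move=> At; rewrite /qf.
have -> : (s *: u + t *: v)^T = s *: u^T + t *: v^T by rewrite linearD !linearZ.
rewrite !mulmxDl !mulmxDr -!scalemxAl -!scalemxAr.
rewrite !(mx11D, mx11Z).
have -> : (v^T *m A *m u) 0 0 = (u^T *m A *m v) 0 0.
  by rewrite -[u^T *m A *m v]mx11_tr !trmx_mul trmxK At mulmxA.
by ring.
Qed.

Lemma psd_sqr_entry k (A : 'M[R]_k) i j : A^T = A -> (forall v, 0 <= qf A v) ->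
  A i j ^+ 2 <= A i i * A j j.
Proof.
move=> At A0.
have q s t : 0 <= s ^+ 2 * A i i + 2 * (s * t) * A i j + t ^+ 2 * A j j.
  have := A0 (s *: delta_mx i 0 + t *: delta_mx j 0).
  by rewrite qfD// !qf_delta trmx_delta -rowE -colE !mxE.
have [Aii Ajj] : 0 <= A i i /\ 0 <= A j j by rewrite -!qf_delta.
(* The pair (s, t) = (- A i j, A i i) gives A i i (A i i A j j - A i j ^+ 2) >= 0, enough when A i i
   > 0. If A i i = 0, the pairs (A j j, - A i j) and (1, - A i j) together force A i j = 0. *)
have := q (A j j) (- A i j); have := q (- A i j) (A i i).
have := q 1 (- A i j); have := q 1 (A i j).
have [Aii0|Aii0] := eqVneq (A i i) 0.
  by rewrite Aii0; nra.
have : 0 < A i i by rewrite lt_def Aii0.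
move: (A i i) (A j j) (A i j) => x y z; nra.
Qed.

(** By symmetry the left side is the sum of all A i j ^+ 2, and each is at most A i i A j j. *)
Lemma psd_trace_sqr k (A : 'M[R]_k) : A^T = A -> (forall v, 0 <= qf A v) ->
  \tr (A *m A) <= \tr A ^+ 2.
Proof.
move=> At A0; rewrite -{2}At mxtrace_gram expr2 mulr_suml.
apply: ler_sum => i _; rewrite mulr_sumr; apply: ler_sum => j _.
exact: psd_sqr_entry.
Qed.

Lemma psd_trace_ge0 k (A : 'M[R]_k) : (forall v, 0 <= qf A v) -> 0 <= \tr A.
Proof. by move=> A0; apply: sumr_ge0 => i _; rewrite -qf_delta. Qed.

End quadratic_forms.

Section resolvent.
Context (R : realType) (r n : nat) (H : 'M[R]_n).
Hypotheses (Ht : H^T = H) (HH : H *m H = H).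
Implicit Types (y E : 'M[R]_(r, n)) (e : R).

Definition gram y : 'M[R]_r := y *m H *m y^T.

(* Locked, lest unification compare adjugates; (W + e)^-1, with junk value 0 when
   W + e is singular. *)
Definition res e y : 'M[R]_r := locked (adjinv (gram y + e%:M)).

Lemma resE e y : res e y = adjinv (gram y + e%:M).
Proof. by rewrite /res -lock. Qed.

Lemma gram_tr y : (gram y)^T = gram y.
Proof. by rewrite /gram !trmx_mul trmxK Ht mulmxA. Qed.

Lemma gram_gram y : gram y = (y *m H) *m (y *m H)^T.
Proof. by rewrite trmx_mul Ht /gram -!mulmxA (mulmxA H H) HH. Qed.

Lemma qf_gram_ge0 y v : 0 <= qf (gram y) v.
Proof. by rewrite gram_gram qf_gram sqn_ge0. Qed.

Lemma gram_reg_tr e y : (gram y + e%:M)^T = gram y + e%:M.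
Proof. by rewrite linearD/= gram_tr tr_scalar_mx. Qed.

Lemma qf_reg e y v : qf (gram y + e%:M) v = qf (gram y) v + e * sqn v.
Proof.
rewrite /qf mulmxDr mulmxDl mxE; congr (_ + _).
by rewrite mul_mx_scalar -scalemxAl mxE.
Qed.

Lemma unitmx_reg e y : 0 < e -> gram y + e%:M \in unitmx.
Proof.
move=> e0; rewrite -row_free_unit -kermx_eq0; apply/eqP/row_matrixP => i.
rewrite row0; set x := row i _.
have x0 : x *m (gram y + e%:M) = 0 by rewrite -row_mul mulmx_ker row0.
have : qf (gram y + e%:M) x^T = 0 by rewrite /qf trmxK x0 mul0mx mxE.
rewrite qf_reg => q0.
have s0 : sqn x^T = 0.
  have := qf_gram_ge0 y x^T; have := sqn_ge0 x^T.
  move: (sqn _) (qf _ _) q0 => a b; nra.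
by apply: trmx_inj; rewrite trmx0; exact: sqn_eq0.
Qed.

Section regular.
Variables (e : R) (y : 'M[R]_(r, n)).
Hypothesis uW : gram y + e%:M \in unitmx.
Local Notation W := (gram y).
Local Notation S := (res e y).

Lemma res_mulV : (W + e%:M) *m S = 1%:M.
Proof. by rewrite resE adjinvE// mulmxV. Qed.

Lemma res_Vmul : S *m (W + e%:M) = 1%:M.
Proof. by rewrite resE adjinvE// mulVmx. Qed.

Lemma res_tr : S^T = S.
Proof. by rewrite resE adjinvE// trmx_inv gram_reg_tr. Qed.

(** Holds as soon as W + e is invertible, hence also at e = 0 for invertible W, where it reads W S =
    1. For e > 0 it is the rule that removes W from the traces at the cost of a term of known
    sign. *)
Lemma gram_res : W *m S = 1%:M - e *: S.
Proof. by rewrite -res_mulV mulmxDl mul_scalar_mx addrK. Qed.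

Lemma res_gram : S *m W = 1%:M - e *: S.
Proof. by rewrite -res_Vmul mulmxDr mul_mx_scalar addrK. Qed.

Lemma qf_res v : qf S v = qf W (S *m v) + e * sqn (S *m v).
Proof.
rewrite -qf_reg /qf trmx_mul res_tr -!mulmxA; congr (_ _ 0 0).
by rewrite (mulmxA (W + _)) res_mulV mul1mx.
Qed.

Lemma sqn_res_le v : e * sqn (S *m v) <= qf S v.
Proof. by rewrite qf_res lerDr qf_gram_ge0. Qed.

End regular.

Section positive.
Variables (e : R) (y : 'M[R]_(r, n)).
Hypothesis e0 : 0 < e.
Local Notation W := (gram y).
Local Notation S := (res e y).
Let uW := unitmx_reg y e0.

Lemma qf_res_ge0 v : 0 <= qf S v.
Proof. by apply: le_trans (sqn_res_le uW v); rewrite mulr_ge0 ?sqn_ge0// ltW. Qed.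

(** The spectral bound S <= 1 / e without eigenvalues: e S_jj^2 <= e |S e_j|^2 <= S_jj. *)
Lemma res_diag_le j : S j j <= e^-1.
Proof.
have := sqn_res_le uW (delta_mx j 0); rewrite qf_delta => h1.
have := sqr_entry_le_sqn (S *m delta_mx j 0) j; rewrite -colE mxE => h2.
have h3 : e * S j j ^+ 2 <= S j j.
  by apply: le_trans h1; rewrite ler_pM2l// -colE.
have h4 : 0 <= S j j by rewrite -qf_delta qf_res_ge0.
rewrite -[e^-1]mul1r ler_pdivlMr//.
have [->|S0] := eqVneq (S j j) 0; first by rewrite mul0r.
have S1 : 0 < S j j by rewrite lt_def S0.
by rewrite -(ler_pM2l S1) mulr1 mulrA mulrC -expr2.
Qed.

Lemma res_entry_le i j : `|S i j| <= e^-1.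
Proof.
rewrite -(ler_pXn2r (n := 2))// ?nnegrE ?invr_ge0 ?(ltW e0)//.
rewrite real_normK ?num_real//.
apply: le_trans (psd_sqr_entry i j (res_tr uW) qf_res_ge0) _.
by rewrite expr2 ler_pM ?res_diag_le// -qf_delta qf_res_ge0.
Qed.

Definition Gres : 'M[R]_(n, r) := H *m y^T *m S.

Lemma Gres_gram : Gres^T *m Gres = S *m W *m S.
Proof.
rewrite /Gres !trmx_mul trmxK Ht (res_tr uW) /gram -!mulmxA.
by rewrite (mulmxA H H) HH.
Qed.

(** Although y is unbounded, H y^T S is bounded: the squared norm of its column j is (S W S)_jj =
    S_jj - e (S S)_jj <= 1 / e. The constant 1 + 1 / e avoids a square root. *)
Lemma Gres_entry_le k j : `|Gres k j| <= 1 + e^-1.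
Proof.
have h : Gres k j ^+ 2 <= e^-1.
  apply: le_trans (res_diag_le j).
  have := sqr_entry_le_sqn (col j Gres) k; rewrite mxE => /le_trans; apply.
  have -> : sqn (col j Gres) = (S *m W *m S) j j.
    rewrite -Gres_gram sqnE [RHS]mxE; apply: eq_bigr => i _.
    by rewrite !mxE expr2.
  rewrite res_gram// mulmxBl mul1mx -scalemxAl !mxE gerBl.
  rewrite mulr_ge0 ?(ltW e0)//.
  have : 0 <= sqn (S *m delta_mx j 0) by exact: sqn_ge0.
  rewrite /sqn trmx_mul (res_tr uW) mulmxA -(mulmxA _ S S) -/(qf (S *m S) _) qf_delta.
  by rewrite mxE.
have e1 : 0 < e^-1 by rewrite invr_gt0.
rewrite -(ler_pXn2r (n := 2))// ?nnegrE ?addr_ge0 ?(ltW e1)//.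
rewrite real_normK ?num_real//; nra.
Qed.

(** In this and the next two bounds, S W = W S = 1 - e S produces a term with factor -e and
    nonnegative trace, which is dropped; what remains does not mention e outside S. *)
Lemma mxtrace_gram_res_le : \tr (W *m S) <= r%:R.
Proof.
rewrite gram_res// linearB/= mxtraceZ mxtrace1 gerBl mulr_ge0 ?(ltW e0)//.
exact/psd_trace_ge0/qf_res_ge0.
Qed.

Lemma mxtrace_res_gram_res_le : \tr (S *m W *m S) <= \tr S.
Proof.
rewrite res_gram// mulmxBl mul1mx -scalemxAl linearB/= mxtraceZ gerBl.
rewrite mulr_ge0 ?(ltW e0)//.
rewrite -{2}(res_tr uW) mxtrace_gram.
by apply: sumr_ge0 => i _; apply: sumr_ge0 => j _; exact: sqr_ge0.
Qed.

Lemma mxtrace_res2_gram_res_le : \tr (S *m S *m W *m S) <= \tr (S *m S).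
Proof.
rewrite -(mulmxA S S) res_gram// mulmxBr mulmx1 mulmxBl -scalemxAr -scalemxAl.
rewrite linearB/= mxtraceZ gerBl mulr_ge0 ?(ltW e0)//.
rewrite -mulmxA -{3}(res_tr uW) mxtrace_qf.
by apply: sumr_ge0 => j _; exact: qf_res_ge0.
Qed.

(** In contrast to the bounds on S, this one is uniform in e, because the entries of e S are at most
    1. *)
Lemma norm1_gram_res_le : norm1 (W *m S) <= norm1 (1%:M : 'M[R]_r) + 1 *+ (r * r).
Proof.
rewrite gram_res//; apply: le_trans (norm1B _ _) _; rewrite lerD2l.
apply: norm1_le => i j; rewrite mxE normrM gtr0_norm//.
by rewrite -ler_pdivlMl// mulr1 res_entry_le.
Qed.

(* A kernel vector x of W satisfies x = e S x. *)
Lemma norm1_res_singular : W \notin unitmx -> e^-1 <= norm1 S.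
Proof.
rewrite -row_free_unit -kermx_eq0 => /rowV0Pn[x /sub_kermxP xW x0].
have xS : x = e *: (x *m S).
  rewrite -[LHS]mulmx1 -(res_mulV uW) mulmxA mulmxDr xW add0r.
  by rewrite mul_mx_scalar -scalemxAl.
have nx : 0 < norm1 x.
  rewrite lt_def norm1_ge0 andbT; apply: contra x0 => /eqP n0.
  apply/eqP/matrixP => i j; rewrite mxE; apply/eqP.
  by rewrite -normr_le0 -n0 le_entry_norm1.
have := norm1M x S; have -> : norm1 (x *m S) = e^-1 * norm1 x.
  by rewrite {2}xS norm1Z gtr0_norm// mulKf// gt_eqF.
by rewrite mulrC ler_pM2l.
Qed.

Section invertible.
Hypothesis uW0 : W \in unitmx.

Let uW0' : W + 0%:M \in unitmx. Proof. by rewrite raddf0 addr0. Qed.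
Local Notation S0 := (res 0 y).

Lemma res_res0 : S = S0 - e *: (S *m S0).
Proof.
have := gram_res uW0'; rewrite scale0r subr0 => WS0.
rewrite -[LHS]mulmx1 -WS0 mulmxA res_gram// mulmxBl mul1mx.
by rewrite -scalemxAl.
Qed.

(** With u = S0 v the resolvent identity gives S v = u - e S u, and |u|^2 - |u - e S u|^2 = 2 e u^T
    S u - e^2 |S u|^2 is nonnegative since e |S u|^2 <= u^T S u. This makes S0 a dominating function
    for the limit e -> 0. *)
Lemma sqn_res_le_res0 v : sqn (S *m v) <= sqn (S0 *m v).
Proof.
rewrite {1}res_res0 mulmxBl -scalemxAl -mulmxA.
move: (S0 *m v) => u.
have -> : sqn (u - e *: (S *m u)) = sqn u - 2 * e * qf S u + e ^+ 2 * sqn (S *m u).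
  have tE : (u - e *: (S *m u))^T = u^T - e *: (u^T *m S).
    by apply/matrixP => i j; rewrite -{2}(res_tr uW) -trmx_mul !mxE.
  rewrite /sqn /qf tE trmx_mul (res_tr uW).
  rewrite mulmxBl !mulmxBr -!scalemxAl -!scalemxAr.
  rewrite !(mx11D, mx11N, mx11Z) !mulmxA.
  ring.
rewrite -subr_ge0 (_ : _ - _ = e * (qf S u + (qf S u - e * sqn (S *m u)))).
  by rewrite mulr_ge0 ?(ltW e0)// addr_ge0 ?qf_res_ge0// subr_ge0 sqn_res_le.
by ring.
Qed.

End invertible.
End positive.
End resolvent.

Lemma mxcvg_cont (R : realType) (r n k l : nat) (F : 'M[R]_(r, n) -> 'M[R]_(k, l)) dF :
  mxC1 F dF -> forall (y E : 'M[R]_(r, n)) (t : R),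
  mxcvg (nbhs t) (fun s : R => F (y + s *: E)) (F (y + t *: E)).
Proof. by move=> CF y E t i j; exact: (line_C1_continuous (CF i j)). Qed.

(** * Derivatives of the resolvent *)

Section resolvent_derivative.
Context (R : realType) (r n : nat) (H : 'M[R]_n).
Hypotheses (Ht : H^T = H) (HH : H *m H = H).
Variable e : R.
Hypothesis e0 : 0 < e.
Local Notation S := (res H e).
Implicit Types y E : 'M[R]_(r, n).

Let uW y := unitmx_reg Ht HH y e0.

Lemma norm1_res_le y : norm1 (S y) <= e^-1 *+ (r * r).
Proof. by apply: norm1_le => i j; exact: res_entry_le. Qed.

Lemma norm1_Gres_le y : norm1 (Gres H e y) <= (1 + e^-1) *+ (n * r).
Proof. by apply: norm1_le => i j; exact: Gres_entry_le. Qed.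

Definition dgram y E : 'M[R]_r := E *m H *m y^T + y *m H *m E^T.

Lemma gram_line y E (t h : R) : gram H (y + (h + t) *: E) =
  gram H (y + t *: E) + h *: dgram (y + t *: E) E + h ^+ 2 *: (E *m H *m E^T).
Proof.
rewrite scalerDl addrCA; move: (y + t *: E) => z; rewrite addrC.
rewrite /gram /dgram linearD linearZ /= !mulmxDl !mulmxDr -!scalemxAl -!scalemxAr.
rewrite scalerA -expr2 scalerDr !addrA; congr (_ + _).
by rewrite -!addrA; congr (_ + _); rewrite addrC.
Qed.

(** The identity A^-1 - B^-1 = - A^-1 (A - B) B^-1. It yields first continuity and then the
    derivative of S, so the adjugate formula is never differentiated. *)
Lemma res_diff y E (t h : R) :
  S (y + (h + t) *: E) - S (y + t *: E) =
  - (h *: (S (y + (h + t) *: E) *m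
       (dgram (y + t *: E) E + h *: (E *m H *m E^T)) *m S (y + t *: E))).
Proof.
have -> : h *: (S (y + (h + t) *: E) *m
       (dgram (y + t *: E) E + h *: (E *m H *m E^T)) *m S (y + t *: E)) =
  S (y + (h + t) *: E) *m ((gram H (y + (h + t) *: E) + e%:M) -
     (gram H (y + t *: E) + e%:M)) *m S (y + t *: E).
  rewrite scalemxAl scalemxAr; congr (_ *m _ *m _).
  by rewrite gram_line scalerDr scalerA -expr2; apply/matrixP => i j; rewrite !mxE; ring.
rewrite mulmxBr mulmxBl (res_Vmul (uW _)) mul1mx -mulmxA (res_mulV (uW _)) mulmx1.
by rewrite opprB.
Qed.

(** As S is bounded on the whole space for fixed e, the right side of [res_diff] is at most |h|
    times a constant when |h| <= 1. *)
Lemma res_line_cvg y E (t : R) :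
  mxcvg (nbhs (0 : R)) (fun h => S (y + (h + t) *: E)) (S (y + t *: E)).
Proof.
move=> i j.
have h0 : (fun h : R => (S (y + (h + t) *: E) - S (y + t *: E)) i j) @ (0 : R) --> (0 : R).
  pose C := (e^-1 *+ (r * r)) * (norm1 (dgram (y + t *: E) E) + norm1 (E *m H *m E^T)) *
     (e^-1 *+ (r * r)).
  have a0 : (fun h : R => `|h| * C) @ (0 : R) --> (0 : R).
    have : (fun h : R => `|h| * C) @ (0 : R) --> `|0 : R| * C.
      by apply: cvgM; [exact: (@cvg_norm _ R^o)|exact: cvg_cst].
    by rewrite normr0 mul0r.
  apply: (@squeeze_cvgr R (nbhs (0 : R)) _ R (fun h : R => - (`|h| * C)) (fun h : R => `|h| * C)).
  - have : \forall h \near (0 : R), `|h| <= 1 by apply: nbhs0_le; exact: ltr01.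
    apply: filterS => h h1; rewrite -ler_norml res_diff mxE normrN.
    apply: le_trans (le_entry_norm1 _ _ _) _.
    rewrite norm1Z ler_wpM2l//.
    apply: le_trans (norm1M _ _) _; rewrite /C ler_pM ?norm1_ge0 ?norm1_res_le//.
    apply: le_trans (norm1M _ _) _; rewrite ler_pM ?norm1_ge0 ?norm1_res_le//.
    apply: le_trans (norm1D _ _) _; rewrite lerD2l norm1Z ler_piMl ?norm1_ge0//.
  - by have := @cvgN _ R^o _ _ _ _ _ a0 _; rewrite oppr0; apply.
  - exact: a0.
rewrite -[X in _ --> X]add0r.
have -> : (fun h : R => S (y + (h + t) *: E) i j) =
   (fun h => (S (y + (h + t) *: E) - S (y + t *: E)) i j + S (y + t *: E) i j).
  by apply/funext => h; rewrite !mxE subrK.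
by apply: (@cvgD _ R^o) => //; exact: cvg_cst.
Qed.

Definition dres y E : 'M[R]_r := - (S y *m dgram y E *m S y).

Lemma is_derive_res y E (t : R) i j :
  is_derive t (1 : R) (fun s => S (y + s *: E) i j) (dres (y + t *: E) E i j).
Proof.
have cv : (fun h : R => h^-1 *: (S (y + (h *: 1 + t) *: E) i j - S (y + t *: E) i j))
    @ (0 : R)^' --> dres (y + t *: E) E i j.
  have c1 : (fun h : R => (- (S (y + (h + t) *: E) *m
       (dgram (y + t *: E) E + h *: (E *m H *m E^T)) *m S (y + t *: E))) i j)
      @ (0 : R)^' --> dres (y + t *: E) E i j.
    apply: cvg_within_filter; move: i j.
    apply: mxcvgN; apply: mxcvgM; last exact: mxcvg_cst.
    apply: mxcvgM; first exact: res_line_cvg.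
    rewrite -[X in mxcvg _ _ X]addr0 -[X in mxcvg _ _ (_ + X)](scale0r (E *m H *m E^T)).
    apply: mxcvgD; first exact: mxcvg_cst.
    by apply: mxcvgZ; [exact: cvg_id|exact: mxcvg_cst].
  apply: cvg_trans c1; apply: near_eq_cvg; near=> h.
  have h0 : h != 0 by near: h; exact: nbhs_dnbhs_neq.
  have -> : h *: 1 = h :> R by rewrite /GRing.scale/= mulr1.
  have sE (A B : 'M[R]_r) : A i j - B i j = (A - B) i j by rewrite !mxE.
  rewrite sE res_diff; move: (S _ *m _ *m _) => X.
  have -> : (- (h *: X)) i j = - (h * X i j) by rewrite !mxE.
  have sc (a b : R) : a *: b = a * b :> R by [].
  by rewrite [RHS]sc mulrN mulKf// mxE.
apply: DeriveDef; first by apply/cvg_ex; exists (dres (y + t *: E) E i j).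
exact: cvg_lim cv.
Unshelve. all: by end_near.
Qed.

Lemma mxmeas_res : mxmeas (fun y : 'M[R]_(r, n) => S y).
Proof.
move=> i j; under eq_fun do rewrite resE; move: i j.
apply: mxmeas_adjinv; apply: mxmeasD; last exact: mxmeas_cst.
apply: mxmeasM; last by apply: mxmeas_tr => i j; exact: measurable_mxentry.
by apply: mxmeasM; [move=> i j; exact: measurable_mxentry|exact: mxmeas_cst].
Qed.

Lemma mxC1_res : mxC1 (fun y => S y) dres.
Proof.
have cS y E (t : R) : mxcvg (nbhs t) (fun s : R => S (y + s *: E)) (S (y + t *: E)).
  move=> i j; have [dt _] := is_derive_res y E t i j.
  by apply: differentiable_continuous; exact/derivable1_diffP.
have cy y E (t : R) := @mxcvg_cont R r n _ _ _ _ (@mxC1_id R r n) y E t.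
move=> i j; split.
- by move=> y E t; exact: is_derive_res.
- move=> y E t; move: i j; apply: mxcvgN; apply: mxcvgM; last exact: cS.
  apply: mxcvgM; first exact: cS.
  apply: mxcvgD.
    apply: mxcvgM; first exact: mxcvg_cst.
    by apply: mxcvg_tr; exact: cy.
  apply: mxcvgM; last exact: mxcvg_cst.
  by apply: mxcvgM; [exact: cy|exact: mxcvg_cst].
- move=> y a E E'; have -> : dres y (a *: E + E') = a *: dres y E + dres y E'.
    rewrite /dres; have -> : dgram y (a *: E + E') = a *: dgram y E + dgram y E'.
      rewrite /dgram linearD linearZ/= !mulmxDl !mulmxDr -!scalemxAl -!scalemxAr.
      by apply/matrixP => k l; rewrite !mxE; ring.
    by rewrite mulmxDr mulmxDl -scalemxAr -scalemxAl opprD scalerN.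
  by rewrite !mxE.
- exact: mxmeas_res.
- move=> E; move: i j; apply: mxmeasN; apply: mxmeasM; last exact: mxmeas_res.
  apply: mxmeasM; first exact: mxmeas_res.
  have my : mxmeas (fun y : 'M[R]_(r, n) => y) by move=> i j; exact: measurable_mxentry.
  apply: mxmeasD.
    by apply: mxmeasM; [exact: mxmeas_cst|exact: mxmeas_tr].
  apply: mxmeasM; last exact: mxmeas_cst.
  by apply: mxmeasM => //; exact: mxmeas_cst.
Qed.

(** Groups the unbounded y with S into the bounded [Gres]; so the derivative of S is bounded in y,
    and its divergence splits into terms in E and in E^T. *)
Lemma dres_Gres y E :
  dres y E = - (S y *m E *m Gres H e y + (Gres H e y)^T *m E^T *m S y).
Proof.
rewrite /dres /dgram /Gres !trmx_mul trmxK Ht (res_tr Ht (uW y)).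
by rewrite mulmxDr mulmxDl !mulmxA.
Qed.

Definition dGres y E : 'M[R]_(n, r) :=
  H *m E^T *m S y + H *m y^T *m dres y E.

Lemma dGresE y E : dGres y E = H *m E^T *m S y -
  (Gres H e y *m E *m Gres H e y +
   H *m y^T *m (Gres H e y)^T *m E^T *m S y).
Proof.
by rewrite /dGres dres_Gres mulmxN mulmxDr -!mulmxA.
Qed.

Lemma mxC1_Gres : mxC1 (fun y => Gres H e y) dGres.
Proof.
have C1 := mxC1M (mxC1M (@mxC1_cst R r n _ _ H) (mxC1_tr (@mxC1_id R r n))) mxC1_res.
move=> i j; apply: line_C1_eq (C1 i j) _ _ => // y E.
by rewrite mul0mx add0r.
Qed.

End resolvent_derivative.

(** * Expectations of real functions, and growth classes *)

Section expectation.
Context d (T : measurableType d) (R : realType) (P : probability T R).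
Implicit Types f g : T -> R.

Definition L1 f := P.-integrable setT (EFin \o f).
(** [fine] sends an infinite integral to 0, so the value is the expectation only together with
    [L1 f]. *)
Definition Ex f : R := fine (\int[P]_w (f w)%:E)%E.

Lemma ExE f : L1 f -> (\int[P]_w (f w)%:E)%E = (Ex f)%:E.
Proof. by move=> lf; rewrite fineK//; exact: integrable_fin_num. Qed.

Lemma eq_Ex f g : f =1 g -> Ex f = Ex g.
Proof. by move=> /funext ->. Qed.

Lemma eq_L1 f g : f =1 g -> L1 f -> L1 g.
Proof. by move=> /funext ->. Qed.

Lemma L1_cst (c : R) : L1 (fun=> c).
Proof. exact: finite_measure_integrable_cst. Qed.

Lemma Ex_cst (c : R) : Ex (fun=> c) = c.
Proof. by rewrite /Ex integral_cst// [X in (_ * X)%E]probability_setT mule1. Qed.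

Lemma L1D f g : L1 f -> L1 g -> L1 (fun w => f w + g w).
Proof. by move=> lf lg; exact: (integrableD measurableT lf lg). Qed.

Lemma ExD f g : L1 f -> L1 g -> Ex (fun w => f w + g w) = Ex f + Ex g.
Proof.
move=> lf lg; rewrite /Ex -fineD ?integrable_fin_num//; congr fine.
by under eq_integral do rewrite EFinD; rewrite integralD.
Qed.

Lemma L1Z (c : R) f : L1 f -> L1 (fun w => c * f w).
Proof. by move=> lf; exact: (integrableZl measurableT c lf). Qed.

Lemma ExZ (c : R) f : L1 f -> Ex (fun w => c * f w) = c * Ex f.
Proof.
move=> lf; apply: EFin_inj; rewrite -ExE; last exact: L1Z.
by under eq_integral do rewrite EFinM; rewrite integralZl// ExE.
Qed.

Lemma L1N f : L1 f -> L1 (fun w => - f w).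
Proof. by move=> /(L1Z (-1)); apply: eq_L1 => w; rewrite mulN1r. Qed.

Lemma ExN f : L1 f -> Ex (fun w => - f w) = - Ex f.
Proof.
by move=> lf; rewrite -mulN1r -ExZ//; apply: eq_Ex => w; rewrite mulN1r.
Qed.

Lemma L1B f g : L1 f -> L1 g -> L1 (fun w => f w - g w).
Proof. by move=> lf lg; apply: L1D => //; exact: L1N. Qed.

Lemma ExB f g : L1 f -> L1 g -> Ex (fun w => f w - g w) = Ex f - Ex g.
Proof. by move=> lf lg; rewrite ExD//; [rewrite ExN|exact: L1N]. Qed.

Lemma L1_sum (I : Type) (s : seq I) (f : I -> T -> R) : (forall i, L1 (f i)) ->
  L1 (fun w => \sum_(i <- s) f i w).
Proof.
move=> lf; elim: s => [|i s IH].
  by apply: eq_L1 (L1_cst 0) => w; rewrite big_nil.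
by apply: eq_L1 (L1D (lf i) IH) => w; rewrite big_cons.
Qed.

Lemma Ex_sum (I : Type) (s : seq I) (f : I -> T -> R) : (forall i, L1 (f i)) ->
  Ex (fun w => \sum_(i <- s) f i w) = \sum_(i <- s) Ex (f i).
Proof.
move=> lf; elim: s => [|i s IH].
  by rewrite big_nil -[RHS](Ex_cst 0); apply: eq_Ex => w; rewrite big_nil.
rewrite big_cons -IH -ExD//; last exact: L1_sum.
by apply: eq_Ex => w; rewrite big_cons.
Qed.

Lemma le_Ex f g : L1 f -> L1 g -> (forall w, f w <= g w) -> Ex f <= Ex g.
Proof.
move=> lf lg fg; rewrite -lee_fin -!ExE//.
by apply: le_integral => // w _; rewrite lee_fin.
Qed.

Lemma Ex_ge0 f : (forall w, 0 <= f w) -> 0 <= Ex f.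
Proof. by move=> f0; apply/fine_ge0/integral_ge0 => w _; rewrite lee_fin. Qed.

Lemma L1_le f g : measurable_fun setT f -> (forall w, `|f w| <= g w) -> L1 g -> L1 f.
Proof.
move=> mf fg lg; apply: le_integrable lg => //; first exact/measurable_EFinP.
by move=> w _; rewrite lee_fin; apply: le_trans (fg w) (ler_norm _).
Qed.

Lemma L1_meas f : L1 f -> measurable_fun setT f.
Proof. by move=> /measurable_int /measurable_EFinP. Qed.

End expectation.

Section tame.
Context (R : realType) (r n : nat).
Local Notation M := 'M[R]_(r, n).

(** The degrees of F and of its derivative are recorded separately so that the product rule can add
    them; degrees 1 and 1 are what integration by parts accepts, as only second moments of the
    Gaussian matrix are used. *)
Definition poly_growth (a b : nat) k l (F : M -> 'M[R]_(k, l)) (dF : M -> M -> 'M[R]_(k, l)) :=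
  exists2 K : R, 0 <= K &
    (forall y, norm1 (F y) <= K * (1 + norm1 y) ^+ a) /\
    (forall y E, norm1 (dF y E) <= K * norm1 E * (1 + norm1 y) ^+ b).

Definition tame a b k l (F : M -> 'M[R]_(k, l)) dF :=
  mxC1 F dF /\ poly_growth a b F dF.

Lemma tame_eq a b k l (F F' : M -> 'M[R]_(k, l)) dF dF' : tame a b F dF ->
  (forall y, F y = F' y) -> (forall y E, dF y E = dF' y E) -> tame a b F' dF'.
Proof.
move=> tF FF' dFF'; have <- : F = F' by exact/funext.
by have <- : dF = dF' by apply/funext => y; exact/funext.
Qed.

Let n1 (y : M) : 1 <= 1 + norm1 y. Proof. by rewrite lerDl norm1_ge0. Qed.

Lemma tame_weaken a b a' b' k l (F : M -> 'M[R]_(k, l)) dF :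
  (a <= a')%N -> (b <= b')%N -> tame a b F dF -> tame a' b' F dF.
Proof.
move=> aa bb [CF [K K0 [FK dFK]]]; split=> //; exists K => //; split.
  move=> y; apply: le_trans (FK y) _; rewrite ler_wpM2l//.
  exact: ler_weXn2l.
move=> y E; apply: le_trans (dFK y E) _.
by rewrite ler_wpM2l ?mulr_ge0 ?norm1_ge0//; exact: ler_weXn2l.
Qed.

Lemma tame_cst k l (A : 'M[R]_(k, l)) : tame 0 0 (fun=> A) (fun _ _ => 0).
Proof.
split; first exact: mxC1_cst.
exists (norm1 A); first exact: norm1_ge0.
split=> [y|y E]; rewrite expr0 mulr1//.
have -> : norm1 (0 : 'M[R]_(k, l)) = 0.
  by rewrite /norm1 big1// => i _; rewrite big1// => j _; rewrite mxE normr0.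
by rewrite mulr_ge0 ?norm1_ge0.
Qed.

Lemma tame_id : tame 1 0 (fun y : M => y) (fun _ E => E).
Proof.
split; first exact: mxC1_id.
by exists 1 => //; split=> [y|y E]; rewrite ?mulr1 mul1r// expr1 lerDr.
Qed.

Lemma tameD a b k l (F G : M -> 'M[R]_(k, l)) dF dG : tame a b F dF -> tame a b G dG ->
  tame a b (fun y => F y + G y) (fun y E => dF y E + dG y E).
Proof.
move=> [CF [K K0 [FK dFK]]] [CG [L L0 [GL dGL]]]; split; first exact: mxC1D.
exists (K + L); first exact: addr_ge0.
split=> [y|y E]; apply: le_trans (norm1D _ _) _; rewrite !mulrDl.
  by rewrite lerD.
by rewrite lerD.
Qed.

Lemma tameM a b a' b' c k l m (F : M -> 'M[R]_(k, l)) (G : M -> 'M[R]_(l, m)) dF dG :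
  (b + a' <= c)%N -> (a + b' <= c)%N -> tame a b F dF -> tame a' b' G dG ->
  tame (a + a') c (fun y => F y *m G y) (fun y E => dF y E *m G y + F y *m dG y E).
Proof.
move=> bac abc [CF [K K0 [FK dFK]]] [CG [L L0 [GL dGL]]]; split; first exact: mxC1M.
exists (2 * (K * L)); first by rewrite !mulr_ge0.
split=> [y|y E].
  apply: le_trans (norm1M _ _) _.
  apply: le_trans (ler_pM (norm1_ge0 _) (norm1_ge0 _) (FK y) (GL y)) _.
  rewrite mulrACA -exprD ler_wpM2r ?exprn_ge0 ?(le_trans ler01 (n1 y))//.
  by rewrite ler_peMl ?mulr_ge0// ler1n.
have KL : 0 <= K * L * norm1 E by rewrite !mulr_ge0// norm1_ge0.
apply: le_trans (norm1D _ _) _.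
rewrite [leRHS](_ : _ = K * L * norm1 E * (1 + norm1 y) ^+ c +
    K * L * norm1 E * (1 + norm1 y) ^+ c);
  last by ring.
rewrite lerD//.
  apply: le_trans (norm1M _ _) _.
  apply: le_trans (ler_pM (norm1_ge0 _) (norm1_ge0 _) (dFK y E) (GL y)) _.
  rewrite mulrACA -exprD [K * _ * L]mulrAC ler_wpM2l//.
  exact: ler_weXn2l.
apply: le_trans (norm1M _ _) _.
apply: le_trans (ler_pM (norm1_ge0 _) (norm1_ge0 _) (FK y) (dGL y E)) _.
rewrite mulrACA -exprD mulrA ler_wpM2l//.
exact: ler_weXn2l.
Qed.

Lemma tameMr a b k l m (F : M -> 'M[R]_(k, l)) (A : 'M[R]_(l, m)) dF :
  tame a b F dF -> tame a b (fun y => F y *m A) (fun y E => dF y E *m A).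
Proof.
move=> [CF [K K0 [FK dFK]]]; split.
  have C := mxC1M CF (@mxC1_cst R r n _ _ A).
  move=> i j; apply: (line_C1_eq (C i j)) => // y E.
  by rewrite mulmx0 addr0.
exists (K * norm1 A); first by rewrite mulr_ge0 ?norm1_ge0.
split=> [y|y E]; apply: le_trans (norm1M _ _) _.
  by rewrite mulrAC ler_wpM2r ?norm1_ge0.
rewrite -!mulrA [norm1 A * _]mulrC !mulrA; rewrite ler_wpM2r ?norm1_ge0//.
Qed.

Lemma tameMl a b k l m (F : M -> 'M[R]_(k, l)) (A : 'M[R]_(m, k)) dF :
  tame a b F dF -> tame a b (fun y => A *m F y) (fun y E => A *m dF y E).
Proof.
move=> [CF [K K0 [FK dFK]]]; split.
  have C := mxC1M (@mxC1_cst R r n _ _ A) CF.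
  move=> i j; apply: (line_C1_eq (C i j)) => // y E.
  by rewrite mul0mx add0r.
exists (norm1 A * K); first by rewrite mulr_ge0 ?norm1_ge0.
by split=> [y|y E]; apply: le_trans (norm1M _ _) _; rewrite -!mulrA ler_wpM2l ?norm1_ge0// ?mulrA.
Qed.

Lemma tame_tr a b k l (F : M -> 'M[R]_(k, l)) dF : tame a b F dF ->
  tame a b (fun y => (F y)^T) (fun y E => (dF y E)^T).
Proof.
move=> [CF [K K0 [FK dFK]]]; split; first exact: mxC1_tr.
by exists K => //; split=> [y|y E]; rewrite norm1_tr.
Qed.

Lemma tame_traceZ a b a' b' c k l m (F : M -> 'M[R]_k) (G : M -> 'M[R]_(l, m)) dF dG :
  (b + a' <= c)%N -> (a + b' <= c)%N -> tame a b F dF -> tame a' b' G dG ->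
  tame (a + a') c (fun y => \tr (F y) *: G y)
    (fun y E => \tr (dF y E) *: G y + \tr (F y) *: dG y E).
Proof.
move=> bac abc [CF [K K0 [FK dFK]]] [CG [L L0 [GL dGL]]]; split.
  by apply: mxC1Z => //; exact: line_C1_trace.
exists (2 * (K * L)); first by rewrite !mulr_ge0.
split=> [y|y E].
  rewrite norm1Z.
  apply: le_trans (ler_pM (normr_ge0 _) (norm1_ge0 _)
    (le_trans (norm1_trace _) (FK y)) (GL y)) _.
  rewrite mulrACA -exprD ler_wpM2r ?exprn_ge0 ?(le_trans ler01 (n1 y))//.
  by rewrite ler_peMl ?mulr_ge0// ler1n.
have KL : 0 <= K * L * norm1 E by rewrite !mulr_ge0// norm1_ge0.
apply: le_trans (norm1D _ _) _; rewrite !norm1Z.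
rewrite [leRHS](_ : _ = K * L * norm1 E * (1 + norm1 y) ^+ c +
    K * L * norm1 E * (1 + norm1 y) ^+ c);
  last by ring.
rewrite lerD//.
  apply: le_trans (ler_pM (normr_ge0 _) (norm1_ge0 _)
    (le_trans (norm1_trace _) (dFK y E)) (GL y)) _.
  rewrite mulrACA -exprD [K * _ * L]mulrAC ler_wpM2l//.
  exact: ler_weXn2l.
apply: le_trans (ler_pM (normr_ge0 _) (norm1_ge0 _)
    (le_trans (norm1_trace _) (FK y)) (dGL y E)) _.
rewrite mulrACA -exprD mulrA ler_wpM2l//.
exact: ler_weXn2l.
Qed.

Lemma tame_linear a b k l (F : M -> 'M[R]_(k, l)) dF : tame a b F dF ->
  forall y c E E', dF y (c *: E + E') = c *: dF y E + dF y E'.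
Proof.
move=> [CF _] y c E E'; apply/matrixP => i j; rewrite !mxE.
exact: line_linear (CF i j) _ _ _ _.
Qed.

Lemma tame_sum a b k l (F : M -> 'M[R]_(k, l)) dF (I : Type) (s : seq I)
    (c : I -> R) (E : I -> M) : tame a b F dF ->
  forall y, dF y (\sum_(i <- s) c i *: E i) = \sum_(i <- s) c i *: dF y (E i).
Proof.
move=> /tame_linear lF y; elim: s => [|i s IH]; last by rewrite !big_cons lF IH.
by rewrite !big_nil; have := lF y (-1) 0 0; rewrite scaler0 addr0 scaleN1r addNr.
Qed.

End tame.

(** * Stein-Haff identities *)

Section divergence.
Context (R : realType) (r n : nat).

(* The divergence of a vector field stored as an n x r matrix, that is, transposed
   with respect to its variable. *)
Definition mxdiv (dF : 'M[R]_(r, n) -> 'M[R]_(n, r)) : R :=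
  \sum_a \sum_i dF (delta_mx a i) i a.

Lemma mxdivD dF dG : mxdiv (fun E => dF E + dG E) = mxdiv dF + mxdiv dG.
Proof.
rewrite /mxdiv -big_split; apply: eq_bigr => a _; rewrite -big_split.
by apply: eq_bigr => i _; rewrite mxE.
Qed.

Lemma mxdivN dF : mxdiv (fun E => - dF E) = - mxdiv dF.
Proof.
rewrite /mxdiv -sumrN; apply: eq_bigr => a _; rewrite -sumrN.
by apply: eq_bigr => i _; rewrite mxE.
Qed.

Lemma mxdivZ c dF : mxdiv (fun E => c *: dF E) = c * mxdiv dF.
Proof.
rewrite /mxdiv mulr_sumr; apply: eq_bigr => a _; rewrite mulr_sumr.
by apply: eq_bigr => i _; rewrite mxE.
Qed.

Lemma mul_delta_mx_entry k l p q (A : 'M[R]_(k, l)) (B : 'M[R]_(p, q)) a b i j :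
  (A *m delta_mx a b *m B) i j = A i a * B b j.
Proof.
rewrite mxE (bigD1 b)//= big1 ?addr0.
  rewrite mxE (bigD1 a)//= big1 ?addr0; first by rewrite mxE !eqxx mulr1.
  by move=> c ca; rewrite mxE (negbTE ca) mulr0.
move=> c cb; rewrite mxE big1 ?mul0r// => c' _.
by rewrite mxE (negbTE cb) andbF mulr0.
Qed.

(** A transposed direction separates into a product of two traces, whence the dimension factors tr H
    and tr (W S); a direction that is not transposed, as in [mxdiv_id], closes up into a single
    trace. *)
Lemma mxdiv_tr (A : 'M[R]_n) (B : 'M[R]_r) :
  mxdiv (fun E => A *m E^T *m B) = \tr A * \tr B.
Proof.
rewrite /mxdiv exchange_big mulr_suml; apply: eq_bigr => i _.
rewrite mulr_sumr; apply: eq_bigr => a _.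
by rewrite trmx_delta mul_delta_mx_entry.
Qed.

Lemma mxdiv_id (A B : 'M[R]_(n, r)) :
  mxdiv (fun E => A *m E *m B) = \tr (A^T *m B).
Proof.
rewrite /mxdiv; apply: eq_bigr => a _; rewrite mxE; apply: eq_bigr => i _.
by rewrite mul_delta_mx_entry mxE.
Qed.

Lemma mxdiv_traceZ (A : 'M[R]_(n, r)) (B : 'M[R]_(n, r)) :
  mxdiv (fun E => \tr (A *m E) *: B) = \tr (A^T *m B).
Proof.
rewrite /mxdiv; apply: eq_bigr => a _; rewrite mxE; apply: eq_bigr => i _.
rewrite [LHS]mxE [A^T a i]mxE; congr (_ * _).
rewrite /mxtrace (bigD1 i)//= big1 ?addr0 => [|j ji]; rewrite -[A *m _]mulmx1.
  by rewrite mul_delta_mx_entry mxE eqxx mulr1.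
by rewrite mul_delta_mx_entry mxE eq_sym (negbTE ji) mulr0.
Qed.

End divergence.

Section stein_div.
Context (R : realType) (r n : nat) d (T : measurableType d) (P : probability T R).
Context (Y : T -> 'M[R]_(r, n)) (Gam Psi : 'M[R]_r).
Hypothesis gY : gaussian_columns P Y Gam.
Hypotheses (Psit : Psi^T = Psi) (GP : Gam *m Psi = 1%:M).
Local Notation Ex := (Ex P).
Local Notation L1 := (L1 P).

Let mY := gcol_measurable gY.

Lemma L1_growth (F : 'M[R]_(r, n) -> R) (K : R) : measurable_fun setT F ->
  (forall y, `|F y| <= K * (1 + norm1 y) ^+ 2) -> L1 (fun w => F (Y w)).
Proof.
move=> mF FK; apply: (integrable_quad_growth (K := K) (integrable_sqr_norm1Y gY)) => //.
exact: measurableT_comp mF mY.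
Qed.

(** The column identities differentiate along Gam e_a e_i^T; the factor Psi on the left undoes Gam
    and leaves the plain divergence. *)
Lemma stein_div (F : 'M[R]_(r, n) -> 'M[R]_(n, r)) dF : tame 1 1 F dF ->
  [/\ L1 (fun w => \tr (Psi *m Y w *m F (Y w))),
      L1 (fun w => mxdiv (dF (Y w))) &
      Ex (fun w => \tr (Psi *m Y w *m F (Y w))) = Ex (fun w => mxdiv (dF (Y w)))].
Proof.
move=> tF; move: (tF) => [CF [K K0 [FK dFK]]].
have n1 (y : 'M[R]_(r, n)) : 1 <= 1 + norm1 y by rewrite lerDl norm1_ge0.
have gF i b : linear_growth K (fun y => F y i b) (fun y E => dF y E i b).
  split=> [y|y E]; apply: le_trans (le_entry_norm1 _ _ _) _.
    by have := FK y; rewrite expr1.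
  by have := dFK y E; rewrite expr1.
have lYF a i b : L1 (fun w => Y w a i * F (Y w) i b).
  apply: (L1_growth (F := fun y => y a i * F y i b) (K := K)).
    by apply: measurable_funM; [exact: measurable_mxentry|exact: line_measurable (CF i b)].
  move=> y; rewrite normrM expr2 mulrCA ler_pM//.
    by apply: le_trans (le_entry_norm1 _ _ _) _; rewrite lerDr.
  exact: growth_fun (gF i b) y.
have ldF E i b : L1 (fun w => dF (Y w) E i b).
  apply: (L1_growth (F := fun y => dF y E i b) (K := K * norm1 E)).
    exact: line_dmeasurable (CF i b) E.
  move=> y; apply: le_trans (growth_derive (gF i b) y E) _.
  rewrite ler_wpM2l ?mulr_ge0 ?norm1_ge0// expr2 ler_peMr//.
  by rewrite (le_trans ler01).
have trE w : \tr (Psi *m Y w *m F (Y w)) =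
    \sum_b \sum_i \sum_a Psi b a * (Y w a i * F (Y w) i b).
  apply: eq_bigr => b _; rewrite mxE; apply: eq_bigr => i _.
  by rewrite mxE mulr_suml; apply: eq_bigr => a _; rewrite mulrA.
split.
- apply: eq_L1 (fun w => esym (trE w)) _.
  by apply: L1_sum => b; apply: L1_sum => i; apply: L1_sum => a; exact: L1Z.
- by apply: L1_sum => b; apply: L1_sum => i.
rewrite (eq_Ex P trE) /mxdiv Ex_sum; last first.
  by move=> b; apply: L1_sum => i; apply: L1_sum => a; exact: L1Z.
rewrite Ex_sum; last by move=> b; apply: L1_sum.
apply: eq_bigr => b _.
rewrite [LHS]Ex_sum; last by move=> i; apply: L1_sum => a; exact: L1Z.
rewrite [RHS]Ex_sum//; apply: eq_bigr => i _.
rewrite [LHS]Ex_sum; last by move=> a; exact: L1Z.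
transitivity (\sum_a Psi b a * Ex (fun w => dF (Y w) (Gam *m delta_mx a i) i b)).
  apply: eq_bigr => a _; rewrite ExZ//; congr (_ * _); congr fine.
  exact: (stein_identity gY a i (CF i b) (gF i b)).
under eq_bigr do rewrite -ExZ//.
rewrite -Ex_sum; last by move=> a; exact: L1Z.
apply: eq_Ex => w.
(* By symmetry of Psi, row b of Psi is the column Psi e_b, and Gam Psi = 1. *)
have -> : delta_mx b i = \sum_a Psi b a *: (Gam *m delta_mx a i) :> 'M[R]_(r, n).
  under eq_bigr do rewrite scalemxAr.
  rewrite -mulmx_sumr -[LHS]mul1mx -GP -mulmxA; congr (_ *m _).
  apply/matrixP => c j; rewrite summxE -[X in X *m _]Psit mxE (bigD1 b)//= big1 ?addr0.
    rewrite (bigD1 c)//= big1 ?addr0; first by rewrite !mxE !eqxx.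
    by move=> a ac; rewrite !mxE eq_sym (negbTE ac) mulr0.
  by move=> a ab; rewrite !mxE (negbTE ab) mulr0.
rewrite (tame_sum _ _ _ tF) summxE; apply: eq_bigr => a _.
by rewrite mxE.
Qed.

End stein_div.

Section stein_haff.
Context (R : realType) (r n : nat) d (T : measurableType d) (P : probability T R).
Context (Y : T -> 'M[R]_(r, n)) (Gam Psi : 'M[R]_r).
Hypothesis gY : gaussian_columns P Y Gam.
Hypotheses (Psit : Psi^T = Psi) (GP : Gam *m Psi = 1%:M).
Variable H : 'M[R]_n.
Hypotheses (Ht : H^T = H) (HH : H *m H = H).
Variable e : R.
Hypothesis e0 : 0 < e.
Local Notation Ex := (Ex P).
Local Notation L1 := (L1 P).
Local Notation W y := (gram H y).
Local Notation S y := (res H e y).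
Local Notation G y := (Gres H e y).

Let uW (y : 'M[R]_(r, n)) := unitmx_reg Ht HH y e0.

Lemma tame_res : tame 0 0 (fun y : 'M[R]_(r, n) => S y) (dres H e).
Proof.
split; first exact: mxC1_res.
pose c := e^-1 *+ (r * r); pose c' := (1 + e^-1) *+ (n * r).
have c0 : 0 <= c by rewrite mulrn_wge0// invr_ge0 ltW.
have c0' : 0 <= c' by rewrite mulrn_wge0// addr_ge0// invr_ge0 ltW.
exists (c + 2 * (c * c')); first by rewrite addr_ge0 ?mulr_ge0.
split=> [y|y E]; rewrite expr0 mulr1.
  by apply: le_trans (norm1_res_le Ht HH e0 y) _; rewrite lerDl ?mulr_ge0.
rewrite dres_Gres// norm1N.
have hS := norm1_res_le Ht HH e0 y; have hG := norm1_Gres_le Ht HH e0 y.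
apply: (@le_trans _ _ (2 * (c * c') * norm1 E)); last first.
  by rewrite ler_wpM2r ?norm1_ge0// lerDr.
have bnd1 : norm1 (S y *m E *m G y) <= c * c' * norm1 E.
  apply: le_trans (norm1M _ _) _.
  rewrite mulrAC ler_pM ?norm1_ge0//.
  by apply: le_trans (norm1M _ _) _; rewrite ler_wpM2r ?norm1_ge0.
have bnd2 : norm1 ((G y)^T *m E^T *m S y) <= c * c' * norm1 E.
  apply: le_trans (norm1M _ _) _.
  rewrite [c * c']mulrC mulrAC ler_pM ?norm1_ge0//.
  by apply: le_trans (norm1M _ _) _; rewrite !norm1_tr ler_wpM2r ?norm1_ge0.
apply: le_trans (norm1D _ _) _.
rewrite [leRHS](_ : _ = c * c' * norm1 E + c * c' * norm1 E); last by ring.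
exact: lerD.
Qed.

(** The product rule gives degree 1 for the value; the bound on the entries of [Gres] lowers it to
    0. *)
Lemma tame_Gres : tame 0 1 (fun y : 'M[R]_(r, n) => G y) (dGres H e).
Proof.
have t1 := @tameM R r n 1 0 0 0 1 _ _ _ _ _ _ _ isT isT
  (tameMl H (tame_tr (tame_id R r n))) tame_res.
have [C1 [K K0 [_ dK]]] := t1.
have Cd : mxC1 (fun y : 'M[R]_(r, n) => G y) (dGres H e) by exact: mxC1_Gres.
split=> //.
pose c' := (1 + e^-1) *+ (n * r).
have c0' : 0 <= c' by rewrite mulrn_wge0// addr_ge0// invr_ge0 ltW.
exists (K + c'); first exact: addr_ge0.
split=> [y|y E].
  rewrite expr0 mulr1; apply: le_trans (norm1_Gres_le Ht HH e0 y) _.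
  by rewrite lerDr.
apply: le_trans (dK y E) _; rewrite ler_wpM2r ?exprn_ge0 ?addr_ge0 ?norm1_ge0//.
by rewrite ler_wpM2r ?norm1_ge0// lerDl.
Qed.

Let tame11 (F : 'M[R]_(r, n) -> 'M[R]_(n, r)) dF : tame 0 1 F dF -> tame 1 1 F dF.
Proof. exact: tame_weaken. Qed.

Lemma mxtrace_QG (y : 'M[R]_(r, n)) : \tr (H *m y^T *m (G y)^T) = \tr (W y *m S y).
Proof.
rewrite /Gres !trmx_mul trmxK Ht (res_tr Ht (uW y)) mxtrace_mulC -!mulmxA.
rewrite (mulmxA H H) HH mxtrace_mulC /gram.
by rewrite !mulmxA.
Qed.

(** The origin of kappa: once W S has become 1, the three terms are n - 1, -1 and -r times tr (S
    N). *)
Lemma mxdiv_dGres (y : 'M[R]_(r, n)) (N : 'M[R]_r) : mxdiv (fun E => dGres H e y E *m N) =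
  \tr H * \tr (S y *m N) - \tr (S y *m W y *m S y *m N)
  - \tr (W y *m S y) * \tr (S y *m N).
Proof.
pose Q := H *m y^T *m (G y)^T.
have -> : (fun E => dGres H e y E *m N) =
    fun E => H *m E^T *m (S y *m N) +
     - (G y *m E *m (G y *m N) + Q *m E^T *m (S y *m N)).
  apply/funext => E; rewrite dGresE// mulmxBl mulmxDl !mulmxA.
  by [].
rewrite mxdivD mxdivN mxdivD !mxdiv_tr mxdiv_id mulmxA Gres_gram// mxtrace_QG.
by rewrite opprD addrA.
Qed.

Lemma mxdiv_dres (y : 'M[R]_(r, n)) (A : 'M[R]_(n, r)) (N : 'M[R]_r) :
  mxdiv (fun E => A *m dres H e y E *m N) =
  - (\tr (S y *m A^T *m G y *m N) + \tr (A *m (G y)^T) * \tr (S y *m N)).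
Proof.
have -> : (fun E => A *m dres H e y E *m N) =
    fun E => - ((A *m S y) *m E *m (G y *m N) + (A *m (G y)^T) *m E^T *m (S y *m N)).
  apply/funext => E; rewrite dres_Gres// mulmxN mulNmx mulmxDr mulmxDl !mulmxA.
  by [].
by rewrite mxdivN mxdivD mxdiv_tr mxdiv_id trmx_mul (res_tr Ht (uW y)) !mulmxA.
Qed.

Lemma haff_res (N : 'M[R]_r) :
  let lhs w := \tr (Psi *m W (Y w) *m S (Y w) *m N) in
  let rhs w := \tr H * \tr (S (Y w) *m N)
    - \tr (S (Y w) *m W (Y w) *m S (Y w) *m N)
    - \tr (W (Y w) *m S (Y w)) * \tr (S (Y w) *m N) in
  [/\ L1 lhs, L1 rhs & Ex lhs = Ex rhs].
Proof.
move=> lhs rhs.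
have [i1 i2 E12] := stein_div gY Psit GP (tame11 (tameMr N tame_Gres)).
have lE : (fun w => \tr (Psi *m Y w *m (G (Y w) *m N))) = lhs.
  by apply/funext => w; rewrite /lhs /Gres /gram !mulmxA.
have rE : (fun w => mxdiv (fun E => dGres H e (Y w) E *m N)) = rhs.
  by apply/funext => w; rewrite mxdiv_dGres.
by rewrite -lE -rE.
Qed.

(** The field G A S N. Differentiating the second S adds two terms: a single trace, which lowers the
    coefficient from kappa to kappa - 1 in the limit, and the product of traces that the final lower
    bound discards. *)
Lemma haff_quadratic (A N : 'M[R]_r) : A^T = A ->
  let lhs w := \tr (Psi *m W (Y w) *m S (Y w) *m A *m S (Y w) *m N) in
  let rhs w := \tr H * \tr (S (Y w) *m A *m S (Y w) *m N)
    - \tr (S (Y w) *m W (Y w) *m S (Y w) *m A *m S (Y w) *m N)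
    - \tr (W (Y w) *m S (Y w)) * \tr (S (Y w) *m A *m S (Y w) *m N)
    - \tr (S (Y w) *m A *m S (Y w) *m W (Y w) *m S (Y w) *m N)
    - \tr (A *m S (Y w) *m W (Y w) *m S (Y w)) * \tr (S (Y w) *m N) in
  [/\ L1 lhs, L1 rhs & Ex lhs = Ex rhs].
Proof.
move=> At lhs rhs.
have t := @tameM R r n 0 1 0 0 1 _ _ _ _ _ _ _ isT isT tame_Gres (tameMr N (tameMl A tame_res)).
have [i1 i2 E12] := stein_div gY Psit GP (tame11 t).
have lE : (fun w => \tr (Psi *m Y w *m (G (Y w) *m (A *m S (Y w) *m N)))) = lhs.
  by apply/funext => w; rewrite /lhs /Gres /gram !mulmxA.
have rE : (fun w => mxdiv (fun E => dGres H e (Y w) E *m (A *m S (Y w) *m N) +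
    G (Y w) *m (A *m dres H e (Y w) E *m N))) = rhs.
  apply/funext => w; rewrite mxdivD mxdiv_dGres.
  under [X in _ + mxdiv X]eq_fun do rewrite !mulmxA.
  rewrite mxdiv_dres /rhs trmx_mul At !mulmxA opprD addrA; congr (_ - _ - _).
    by rewrite /Gres !trmx_mul trmxK Ht (res_tr Ht (uW _)) !mulmxA -(mulmxA _ H H) HH.
  congr (_ * _); rewrite /Gres !trmx_mul trmxK Ht (res_tr Ht (uW _)).
  by rewrite -[X in \tr X]mulmxA mxtrace_mulC !mulmxA -(mulmxA _ H H) HH.
by rewrite -lE -rE.
Qed.

(** The field tr (S) G. Its divergence is quadratic in S, whereas the left side is linear in S up to
    the uniformly bounded factor W S; this imbalance drives the second moment bound. *)
Lemma haff_trace :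
  let lhs w := \tr (Psi *m W (Y w) *m S (Y w)) * \tr (S (Y w)) in
  let rhs w := \tr (S (Y w)) * (\tr H * \tr (S (Y w))
    - \tr (S (Y w) *m W (Y w) *m S (Y w))
    - \tr (W (Y w) *m S (Y w)) * \tr (S (Y w)))
    - 2 * \tr (S (Y w) *m S (Y w) *m W (Y w) *m S (Y w)) in
  [/\ L1 lhs, L1 rhs & Ex lhs = Ex rhs].
Proof.
move=> lhs rhs.
have t := @tame_traceZ R r n 0 0 0 1 1 _ _ _ _ _ _ _ isT isT tame_res tame_Gres.
have [i1 i2 E12] := stein_div gY Psit GP (tame11 t).
have lE : (fun w => \tr (Psi *m Y w *m (\tr (S (Y w)) *: G (Y w)))) = lhs.
  apply/funext => w; rewrite -scalemxAr mxtraceZ mulrC.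
  by rewrite /lhs /Gres /gram !mulmxA.
have rE : (fun w => mxdiv (fun E => \tr (dres H e (Y w) E) *: G (Y w) +
    \tr (S (Y w)) *: dGres H e (Y w) E)) = rhs.
  apply/funext => w; set y := Y w.
  rewrite mxdivD mxdivZ addrC /rhs -/y; congr (_ * _ + _).
    have := mxdiv_dGres y 1%:M; rewrite !mulmx1.
    by under [X in mxdiv X = _ -> _]eq_fun do rewrite mulmx1.
  (* The two terms of the derivative of S are transposes of each other and have equal traces, hence
     the factor 2. *)
  have -> : (fun E => \tr (dres H e y E) *: G y) =
      fun E => - 2 *: (\tr (G y *m S y *m E) *: G y).
    apply/funext => E; rewrite scalerA; congr (_ *: _).
    rewrite dres_Gres// linearN/= linearD/= mulNr; congr (- _).
    rewrite -[X in _ + X]mxtrace_tr !trmx_mul !trmxK (res_tr Ht (uW y)).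
    by rewrite mulmxA mxtrace_mulC mulmxA mulr_natl mulr2n.
  rewrite mxdivZ mxdiv_traceZ trmx_mul (res_tr Ht (uW y)).
  have -> : S y *m (G y)^T *m G y = S y *m (S y *m W y *m S y).
    by rewrite -Gres_gram// mulmxA.
  by rewrite mulNr !mulmxA.
by rewrite -lE -rE.
Qed.

End stein_haff.

(** * Integration by parts in the direction of the sample mean *)

Section stein_mean.
Context (R : realType) (r n : nat) d (T : measurableType d) (P : probability T R).
Context (Y : T -> 'M[R]_(r, n)) (Gam Psi : 'M[R]_r).
Hypothesis gY : gaussian_columns P Y Gam.
Hypotheses (Psit : Psi^T = Psi) (GP : Gam *m Psi = 1%:M).
Hypothesis n0 : (0 < n)%N.
Local Notation Ex := (Ex P).
Local Notation L1 := (L1 P).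
Local Notation one := (const_mx 1 : 'cV[R]_n).

Definition colmean (y : 'M[R]_(r, n)) : 'cV[R]_r := n%:R^-1 *: (y *m one).

Let nR : n%:R != 0 :> R. Proof. by rewrite pnatr_eq0 -lt0n. Qed.

Lemma sum_delta_mx (a : 'I_r) : \sum_i delta_mx a i = delta_mx a 0 *m one^T :> 'M[R]_(r, n).
Proof.
apply/matrixP => b j; rewrite summxE mxE big_ord1 (bigD1 j)//= big1 ?addr0.
  by rewrite !mxE !eqxx andbT mulr1.
by move=> i ij; rewrite !mxE [j == i]eq_sym (negbTE ij) andbF.
Qed.

Lemma mul_one_entry k (u : 'rV[R]_k) i a : (one *m u) i a = u 0 a.
Proof. by rewrite mxE big_ord1 mxE mul1r. Qed.

Lemma tame_colmean (s : R) (m' : 'cV[R]_r) :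
  tame 1 0 (fun y : 'M[R]_(r, n) => m' + s *: colmean y) (fun _ E => s *: colmean E).
Proof.
have tm := tame_weaken (leq0n 1) (leqnn 0) (@tame_cst R r n _ _ m').
have tc := tameMr ((s * n%:R^-1) *: one) (tame_id R r n).
apply: tame_eq (tameD tm tc) _ _ => y *.
  by rewrite -scalemxAr -scalerA.
by rewrite add0r -scalemxAr -scalerA.
Qed.

(* The vector field 1 (m' + s Ybar)^T K Gam / n; as K is constant along the
   direction of the mean, only the derivative of Ybar contributes. *)
Lemma stein_colmean (s : R) (m' : 'cV[R]_r) (K : 'M[R]_(r, n) -> 'M[R]_r) dK :
  tame 0 0 K dK -> (forall y (v : 'cV[R]_r), dK y (v *m one^T) = 0) ->
  let lhs w := ((m' + s *: colmean (Y w))^T *m K (Y w) *m colmean (Y w)) 0 0 in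
  let rhs w := s / n%:R * \tr (K (Y w) *m Gam) in
  [/\ L1 lhs, L1 rhs & Ex lhs = Ex rhs].
Proof.
move=> tK dK1 lhs rhs.
have t0 := @tameM R r n 1 0 0 0 1 _ _ _ _ _ _ _ isT isT
  (tame_tr (tame_colmean s m')) (tameMr Gam tK).
have t := tameMl (n%:R^-1 *: one) t0.
have [i1 i2 E12] := stein_div gY Psit GP t.
have lE : (fun w => \tr (Psi *m Y w *m (n%:R^-1 *: one *m
    ((m' + s *: colmean (Y w))^T *m (K (Y w) *m Gam))))) = lhs.
  apply/funext => w; rewrite !mulmxA -(mulmxA Psi) -scalemxAr -/(colmean (Y w)).
  rewrite mxtrace_mulC !mulmxA GP mul1mx -!mulmxA mxtrace_mulC.
  by rewrite /mxtrace big_ord1.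
have rE : (fun w => mxdiv (fun E => n%:R^-1 *: one *m
    ((s *: colmean E)^T *m (K (Y w) *m Gam) +
     (m' + s *: colmean (Y w))^T *m (dK (Y w) E *m Gam)))) = rhs.
  apply/funext => w; set y := Y w; rewrite /rhs -/y.
  have -> : (fun E => n%:R^-1 *: one *m
    ((s *: colmean E)^T *m (K y *m Gam) +
     (m' + s *: colmean y)^T *m (dK y E *m Gam))) =
    (fun E => n%:R^-1 *: one *m ((s *: colmean E)^T *m (K y *m Gam)) +
     (n%:R^-1 *: one *m (m' + s *: colmean y)^T) *m dK y E *m Gam).
    by apply/funext => E; rewrite mulmxDr !mulmxA.
  rewrite mxdivD.
  have -> : mxdiv (fun E => (n%:R^-1 *: one *m (m' + s *: colmean y)^T) *m dK y E *m Gam) = 0.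
    set v := (m' + s *: colmean y)^T.
    rewrite /mxdiv big1// => a _.
    (* All rows of the field's left factor are equal, so the divergence only sees the sum over i, a
       derivative along e_a 1^T. *)
    have S0 : \sum_i dK y (delta_mx a i) = 0.
      transitivity (dK y (\sum_i delta_mx a i)); last by rewrite sum_delta_mx dK1.
      have := tame_sum (index_enum 'I_n) (fun=> 1) (delta_mx a) tK y.
      under eq_bigr do rewrite scale1r; under [RHS]eq_bigr do rewrite scale1r.
      by [].
    transitivity (\sum_i n%:R^-1 * (v *m dK y (delta_mx a i) *m Gam) 0 a).
      apply: eq_bigr => i _; rewrite -!scalemxAl [LHS]mxE -!mulmxA.
      by rewrite mul_one_entry.
    by rewrite -mulr_sumr -summxE -mulmx_suml -mulmx_sumr S0 mulmx0 mul0mx mxE mulr0.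
  rewrite addr0 /mxdiv mulr_sumr; apply: eq_bigr => a _.
  transitivity (\sum_(i < n) n%:R^-1 * (s / n%:R * (K y *m Gam) a a)).
    apply: eq_bigr => i _; rewrite -scalemxAl [LHS]mxE mul_one_entry; congr (_ * _).
    have -> : colmean (delta_mx a i) = n%:R^-1 *: delta_mx a 0.
      congr (_ *: _); apply/colP => b; rewrite mxE (bigD1 i)//= big1 ?addr0.
        by rewrite !mxE !eqxx andbT mulr1.
      by move=> j ji; rewrite !mxE (negbTE ji) andbF mul0r.
    rewrite scalerA linearZ/= trmx_delta -scalemxAl.
    by rewrite mxE -rowE mxE.
  by rewrite sumr_const card_ord -[LHS]mulr_natl mulVKf.
by rewrite -lE -rE.
Qed.

End stein_mean.

(** * Letting the regularization vanish *)

Section limit_theorems.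
Context d (T : measurableType d) (R : realType) (P : probability T R).
Local Notation Ex := (Ex P).
Local Notation L1 := (L1 P).
Variables (N : set T).
Hypotheses (mN : measurable N) (PN : P N = 0%E).

Let aeN (Q : T -> Prop) : (forall w, ~ N w -> Q w) -> {ae P, forall w, Q w}.
Proof.
move=> NQ; exists N; split => // w /= nQ; apply: contrapT => nN.
by apply: nQ; exact: NQ.
Qed.

Lemma fatou_L1 (f : nat -> T -> R) (g : T -> R) (C : R) :
  (forall k w, 0 <= f k w) -> (forall w, 0 <= g w) ->
  (forall k, L1 (f k)) -> (forall k, Ex (f k) <= C) -> measurable_fun setT g ->
  (forall w, ~ N w -> f k w @[k --> \oo] --> g w) -> L1 g.
Proof.
move=> f0 g0 lf fC mg fg; apply/integrableP; split; first exact/measurable_EFinP.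
(* Multiplication by [u] makes the sequence converge at every point, also on N, without changing the
   integrals. *)
pose u w : R := \1_(~` N) w.
have mu : measurable_fun setT u by apply: measurable_indic; exact: measurableC.
have uE w : ~ N w -> u w = 1 by move=> nw; rewrite /u indicE mem_set.
have u0 w : N w -> u w = 0 by move=> nw; rewrite /u indicE memNset//; apply.
have u01 w : 0 <= u w <= 1 by rewrite /u indicE; case: (_ \in _); rewrite ?lexx ler01.
have fu k : measurable_fun setT (fun w => (f k w * u w)%:E).
  by apply/measurable_EFinP; apply: measurable_funM => //; exact: L1_meas (lf k).
have -> : (\int[P]_w `|(EFin \o g) w| = \int[P]_w limn_einf (fun k => (f k w * u w)%:E))%E.
  rewrite [RHS](_ : _ = \int[P]_w (g w * u w)%:E)%E; last first.
    apply: eq_integral => w _.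
    have [nw|nw] := pselect (N w).
      rewrite (u0 _ nw) mulr0; have -> : (fun k => (f k w * 0)%:E) = fun=> 0%E.
        by apply/funext => k; rewrite mulr0.
      by have [->] := cvg_limn_einf_sup (@cvg_cst _ (0%E : \bar R) _ \oo _).
    rewrite (uE _ nw) mulr1; have -> : (fun k => (f k w * 1)%:E) = fun k => (f k w)%:E.
      by apply/funext => k; rewrite mulr1.
    have cv : (f k w)%:E @[k --> \oo] --> (g w)%:E.
      by apply: cvg_EFin; [exact: nearW|exact: fg].
    by have [->] := cvg_limn_einf_sup cv.
  apply: ae_eq_integral => //.
  - by apply: measurableT_comp => //; exact/measurable_EFinP.
  - by apply/measurable_EFinP; exact: measurable_funM.
  - by apply: aeN => w nw _; rewrite /= ger0_norm// uE// mulr1.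
apply: (@le_lt_trans _ _ C%:E); last exact: ltry.
apply: le_trans (fatou P measurableT fu _) _.
  by move=> k w _; rewrite lee_fin mulr_ge0//; have /andP[] := u01 w.
rewrite limn_einf_lim; apply: lime_le; first exact: is_cvg_einfs.
apply: nearW => k; apply: (@le_trans _ _ (\int[P]_w (f k w)%:E)%E); last first.
  by rewrite ExE// lee_fin.
apply: (@le_trans _ _ (\int[P]_w (f k w * u w)%:E)%E).
  by apply: ereal_inf_lbound; exists k => //=.
apply: ge0_le_integral => //.
- by move=> w _; rewrite lee_fin mulr_ge0//; have /andP[] := u01 w.
- by apply/measurable_EFinP; exact: L1_meas (lf k).
- by move=> w _; rewrite lee_fin ler_piMr//; have /andP[] := u01 w.
Qed.

Lemma dominated_Ex (f : nat -> T -> R) (g h : T -> R) :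
  (forall k, measurable_fun setT (f k)) -> measurable_fun setT g -> L1 h ->
  (forall k w, ~ N w -> `|f k w| <= h w) ->
  (forall w, ~ N w -> f k w @[k --> \oo] --> g w) ->
  [/\ forall k, L1 (f k), L1 g & Ex (f k) @[k --> \oo] --> Ex g].
Proof.
move=> mf mg lh fh fg.
have lf k : L1 (f k).
  apply/integrableP; split; first exact/measurable_EFinP.
  move/integrableP : (lh) => [mh]; apply: le_lt_trans.
  apply: ae_ge0_le_integral => //.
  - by apply: measurableT_comp => //; exact/measurable_EFinP.
  - exact: measurableT_comp.
  - apply: aeN => w nw _; rewrite lee_fin; apply: le_trans (fh k w nw) _.
    exact: ler_norm.
have [lg _ cv] : [/\ L1 g, ((\int[P]_x `|(f n x)%:E - (g x)%:E|)%E @[n --> \oo] --> 0%E) &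
   (\int[P]_x (f n x)%:E)%E @[n --> \oo] --> (\int[P]_x (g x)%:E)%E].
  apply: (@dominated_convergence _ _ _ P setT measurableT _ _ (EFin \o h)).
  - by move=> n; exact/measurable_EFinP.
  - exact/measurable_EFinP.
  - apply: aeN => w nw _; apply: cvg_EFin; [exact: nearW|exact: fg].
  - exact: lh.
  - by apply: aeN => w nw n _; rewrite lee_fin fh.
split=> //.
by apply: fine_cvg; rewrite -ExE.
Qed.

End limit_theorems.

(** * Second moments of the resolvent, uniformly in e *)

Section uniform_bounds.
Context (R : realType) (r n : nat) d (T : measurableType d) (P : probability T R).
Context (Y : T -> 'M[R]_(r, n)) (Gam Psi : 'M[R]_r).
Hypothesis gY : gaussian_columns P Y Gam.
Hypotheses (Psit : Psi^T = Psi) (GP : Gam *m Psi = 1%:M).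
Variable H : 'M[R]_n.
Hypotheses (Ht : H^T = H) (HH : H *m H = H) (trH : \tr H = n%:R - 1).
Hypothesis nr : (r + 5 <= n)%N.
Local Notation Ex := (Ex P).
Local Notation L1 := (L1 P).
Local Notation W y := (gram H y).

Let mY := gcol_measurable gY.

Lemma mxmeasY k l (F : 'M[R]_(r, n) -> 'M[R]_(k, l)) : mxmeas F ->
  mxmeas (fun w => F (Y w)).
Proof. by move=> mF i j; exact: measurableT_comp (mF i j) mY. Qed.

Lemma mxmeas_Y : mxmeas Y.
Proof. by apply: (mxmeasY (F := id)) => i j; exact: measurable_mxentry. Qed.

Lemma mxmeas_gramY : mxmeas (fun w => W (Y w)).
Proof.
apply: mxmeasM; last by apply: mxmeas_tr; exact: mxmeas_Y.
by apply: mxmeasM; [exact: mxmeas_Y|exact: mxmeas_cst].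
Qed.

Lemma mxmeas_resY e : mxmeas (fun w => res H e (Y w)).
Proof.
move=> i j; under eq_fun do rewrite resE; move: i j.
by apply: mxmeas_adjinv; apply: mxmeasD; [exact: mxmeas_gramY|exact: mxmeas_cst].
Qed.

Lemma L1_bounded (f : T -> R) (c : R) : measurable_fun setT f ->
  (forall w, `|f w| <= c) -> L1 f.
Proof. by move=> mf fc; apply: L1_le mf fc (L1_cst P c). Qed.

(** A bound for tr (Psi W S) that is valid for every e > 0. *)
Let C : R := norm1 Psi * (norm1 (1%:M : 'M[R]_r) + 1 *+ (r * r)).

(** With t = tr S, the trace identity gives E[t^2] <= C E[t] <= C^2 / 2 + E[t^2] / 2. The last term
    may be absorbed because t is bounded for fixed e, and the outcome no longer depends on e. *)
Lemma Ex_trace_res_sqr e : 0 < e ->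
  L1 (fun w => \tr (res H e (Y w)) ^+ 2) /\
  Ex (fun w => \tr (res H e (Y w)) ^+ 2) <= C ^+ 2.
Proof.
move=> e0.
have [] := haff_trace gY Psit GP Ht HH e0.
set lhs := fun w => _; set rhs := fun w => _ => i1 i2 E12.
pose t w := \tr (res H e (Y w)).
have t0 w : 0 <= t w by apply: psd_trace_ge0; exact: qf_res_ge0.
have mt : measurable_fun setT t by apply: measurable_mxtrace; exact: mxmeas_resY.
have tb w : `|t w| <= e^-1 *+ (r * r).
  by apply: le_trans (norm1_trace _) _; exact: norm1_res_le.
have lt2 : L1 (fun w => t w ^+ 2).
  apply: (L1_bounded (c := (e^-1 *+ (r * r)) ^+ 2)); first exact: measurable_funX.
  by move=> w; rewrite normrX lerXn2r ?nnegrE ?mulrn_wge0 ?invr_ge0 ?(ltW e0).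
split=> //.
(* The terms of [rhs] contribute n - 1, -1, -r and -2 times t^2 at worst, and n - r - 4 >= 1; this
   is where r + 5 <= n is used exactly. *)
have h1 w : t w ^+ 2 <= rhs w.
  rewrite /rhs trH -/(t w).
  have b1 := mxtrace_res_gram_res_le Ht HH (Y w) e0.
  have b2 := mxtrace_gram_res_le Ht HH (Y w) e0.
  have b3 := mxtrace_res2_gram_res_le Ht HH (Y w) e0.
  have uW := unitmx_reg Ht HH (Y w) e0.
  have b4 : \tr (res H e (Y w) *m res H e (Y w)) <= t w ^+ 2.
    by apply: psd_trace_sqr; [exact: res_tr|exact: qf_res_ge0].
  rewrite -/(t w) in b1.
  have nr' : r%:R + 5 <= n%:R :> R by rewrite -natrD ler_nat.
  have tw := t0 w.
  set S := res H e (Y w) in b1 b2 b3 b4 *.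
  set x3 := \tr (S *m S *m W (Y w) *m S) in b3 *.
  set x1 := \tr (S *m W (Y w) *m S) in b1 *.
  set x2 := \tr (W (Y w) *m S) in b2 *.
  set x4 := \tr (S *m S) in b3 b4.
  apply: (@le_trans _ _ (t w * ((n%:R - 1) * t w - t w - r%:R * t w) - 2 * t w ^+ 2)).
    have : 0 <= t w ^+ 2 by exact: sqr_ge0.
    nra.
  have : 0 <= t w * (t w - x1) by rewrite mulr_ge0 ?subr_ge0.
  have : 0 <= t w ^+ 2 * (r%:R - x2) by rewrite mulr_ge0 ?sqr_ge0 ?subr_ge0.
  nra.
have h2 w : lhs w <= 2^-1 * C ^+ 2 + 2^-1 * t w ^+ 2.
  apply: (@le_trans _ _ (C * t w)); last first.
    have := sqr_ge0 (C - t w); nra.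
  rewrite /lhs -/(t w) ler_wpM2r//; apply: le_trans (ler_norm _) _.
  apply: le_trans (norm1_trace _) _; rewrite -mulmxA; apply: le_trans (norm1M _ _) _.
  by rewrite /C ler_wpM2l ?norm1_ge0//; exact: norm1_gram_res_le.
have : Ex (fun w => t w ^+ 2) <= 2^-1 * C ^+ 2 + 2^-1 * Ex (fun w => t w ^+ 2).
  apply: le_trans (le_Ex lt2 i2 h1) _; rewrite -E12.
  have lq : L1 (fun w => 2^-1 * C ^+ 2 + 2^-1 * t w ^+ 2).
    by apply: L1D; [exact: L1_cst|exact: L1Z].
  apply: le_trans (le_Ex i1 lq h2) _.
  by rewrite ExD; [rewrite Ex_cst ExZ|exact: L1_cst|exact: L1Z].
rewrite /t; lra.
Qed.

(** The square of the Frobenius norm; as a sum of squared column norms it inherits the monotonicity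
    of the resolvent in e. *)
Definition frob k l (A : 'M[R]_(k, l)) : R := \sum_i \sum_j A i j ^+ 2.

Lemma frob_ge0 k l (A : 'M[R]_(k, l)) : 0 <= frob A.
Proof. by apply: sumr_ge0 => i _; apply: sumr_ge0 => j _; exact: sqr_ge0. Qed.

Lemma frob_cols k l (A : 'M[R]_(k, l)) : frob A = \sum_j sqn (A *m delta_mx j 0).
Proof.
rewrite /frob exchange_big; apply: eq_bigr => j _; rewrite sqnE.
by apply: eq_bigr => i _; rewrite -colE mxE.
Qed.

Lemma measurable_frob d' (T' : measurableType d') k l (F : T' -> 'M[R]_(k, l)) :
  mxmeas F -> measurable_fun setT (fun w => frob (F w)).
Proof.
by move=> mF; apply: measurable_sum => i; apply: measurable_sum => j; exact: measurable_funX.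
Qed.

Lemma frob_res_le (e : R) (y : 'M[R]_(r, n)) : 0 < e -> frob (res H e y) <= \tr (res H e y) ^+ 2.
Proof.
move=> e0; have uW := unitmx_reg Ht HH y e0.
have -> : frob (res H e y) = \tr (res H e y *m res H e y).
  by rewrite -[X in _ *m X](res_tr Ht uW) mxtrace_gram.
by apply: psd_trace_sqr; [exact: res_tr|exact: qf_res_ge0].
Qed.

Lemma Ex_frob_res e : 0 < e ->
  L1 (fun w => frob (res H e (Y w))) /\ Ex (fun w => frob (res H e (Y w))) <= C ^+ 2.
Proof.
move=> e0; have [l2 E2] := Ex_trace_res_sqr e0.
have lf : L1 (fun w => frob (res H e (Y w))).
  apply: L1_le l2; first by apply: measurable_frob; exact: mxmeas_resY.
  by move=> w; rewrite ger0_norm ?frob_ge0// frob_res_le.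
by split=> //; apply: le_trans (le_Ex lf l2 _) E2 => w; exact: frob_res_le.
Qed.

Definition singular : set T := [set w | W (Y w) \notin unitmx].

Lemma measurable_singular : measurable singular.
Proof.
have md : measurable_fun setT (fun w => \det (W (Y w))).
  by apply: measurable_det; exact: mxmeas_gramY.
have -> : singular = (fun w => \det (W (Y w))) @^-1` [set 0].
  apply/seteqP; split=> w; rewrite /singular/= unitmxE unitfE negbK; first by move/eqP.
  by move/eqP.
by have := md measurableT _ (measurable_set1 0); rewrite setTI.
Qed.

(** Where W is singular, S has norm at least 1 / e, while its second moment is bounded uniformly in
    e; Markov's inequality gives P <= K e^2 for all e > 0. No density of Y is involved. *)
Lemma P_singular : P singular = 0%E.
Proof.
have mN := measurable_singular.
pose p := fine (P singular).
have Pp : P singular = p%:E by rewrite fineK// fin_num_measure.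
have p0 : 0 <= p by apply: fine_ge0.
have lI : L1 (\1_singular) by exact: integrable_indic.
have EI : Ex (\1_singular) = p by rewrite /Ex integral_indic// setIT.
pose K := (r * r)%:R * C ^+ 2.
have pK e : 0 < e -> p <= e ^+ 2 * K.
  move=> e0; have [lf Ef] := Ex_frob_res e0.
  have : Ex (fun w => e ^- 2 * \1_singular w) <= Ex (fun w => (r * r)%:R * frob (res H e (Y w))).
    apply: le_Ex; [exact: L1Z|exact: L1Z|move=> w].
    have [sw|sw] := boolP (w \in singular); last first.
      by rewrite indicE (negbTE sw) mulr0 mulr_ge0// frob_ge0.
    rewrite indicE sw mulr1; rewrite inE in sw.
    apply: le_trans (sqr_norm1_le _).
    rewrite -exprVn lerXn2r ?nnegrE ?invr_ge0 ?norm1_ge0 ?(ltW e0)//.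
    exact: norm1_res_singular sw.
  rewrite !ExZ// EI => h.
  have e2 : 0 < e ^+ 2 by rewrite exprn_gt0.
  rewrite -ler_pdivrMl//; apply: le_trans h _.
  by rewrite /K ler_wpM2l.
rewrite Pp; congr _%:E; apply/eqP; rewrite eq_le p0 andbT.
have K0 : 0 <= K by rewrite mulr_ge0 ?sqr_ge0.
apply: contrapT => /negP; rewrite -ltNge => pp.
(* Chosen so that e^2 K <= e K <= p / 2, against p <= e^2 K and p > 0. *)
pose e := Num.min 1 (p / (K + 1) / 2).
have e0 : 0 < e by rewrite lt_min ltr01 !divr_gt0// ltr_wpDl.
have e1 : e <= 1 by rewrite ge_min lexx.
have e2 : e * (K + 1) <= p / 2.
  by rewrite -ler_pdivlMr ?ltr_wpDl// mulrAC ge_min lexx orbT.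
have := pK e e0; rewrite expr2 => peK.
have eK : 0 <= e * K * (1 - e).
  by apply: mulr_ge0; [exact: mulr_ge0 (ltW e0) K0|rewrite subr_ge0].
move: e2 peK eK pp; clearbody e K; lra.
Qed.


Let eps (k : nat) : R := harmonic k.

Let eps0 k : 0 < eps k.
Proof. by rewrite /eps/= invr_gt0 ltr0n. Qed.

Lemma frob_res_le_res0 e (y : 'M[R]_(r, n)) : 0 < e -> W y \in unitmx ->
  frob (res H e y) <= frob (res H 0 y).
Proof.
move=> e0 u0; rewrite !frob_cols; apply: ler_sum => j _.
exact: sqn_res_le_res0.
Qed.

Lemma norm1_le_frob k l (A : 'M[R]_(k, l)) : norm1 A <= (k * l)%:R * Num.sqrt (frob A).
Proof.
rewrite -(ler_pXn2r (n := 2))// ?nnegrE ?norm1_ge0 ?mulr_ge0 ?sqrtr_ge0//.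
rewrite exprMn sqr_sqrtr ?frob_ge0//.
apply: le_trans (sqr_norm1_le A) _.
rewrite ler_wpM2r ?frob_ge0// -natrX ler_nat expnS expn1.
by case: (k * l)%N => // m; rewrite leq_pmulr.
Qed.

(** The resolvent identity gives S0 - S = e S S0, and S is bounded independently of e through S0. *)
Lemma res_mxcvg (y : 'M[R]_(r, n)) : W y \in unitmx ->
  mxcvg \oo (fun k => res H (eps k) y) (res H 0 y).
Proof.
move=> u0 i j.
pose K := (r * r)%:R * Num.sqrt (frob (res H 0 y)) * norm1 (res H 0 y).
have bd k : `|res H 0 y i j - res H (eps k) y i j| <= eps k * K.
  have sE (A B : 'M[R]_r) : A i j - B i j = (A - B) i j by rewrite !mxE.
  rewrite sE {1}(res_res0 Ht HH (eps0 k) u0) opprB addrC subrK.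
  apply: le_trans (le_entry_norm1 _ _ _) _.
  rewrite norm1Z gtr0_norm// ler_wpM2l ?(ltW (eps0 k))//.
  apply: le_trans (norm1M _ _) _; rewrite ler_wpM2r ?norm1_ge0//.
  apply: le_trans (norm1_le_frob _) _; rewrite ler_wpM2l//.
  by rewrite ler_wsqrtr// frob_res_le_res0.
apply/cvgrPdist_le => x x0.
have : eps k * K @[k --> \oo] --> 0 * K by apply: cvgM; [exact: cvg_harmonic|exact: cvg_cst].
rewrite mul0r => /cvgrPdist_le /(_ x x0); apply: filterS => k.
rewrite sub0r normrN => h; apply: le_trans (bd k) _.
by apply: le_trans (ler_norm _) h.
Qed.

Lemma L1_frob_res0 : L1 (fun w => frob (res H 0 (Y w))).
Proof.
apply: (fatou_L1 measurable_singular P_singular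
  (f := fun k w => frob (res H (eps k) (Y w))) (C := C ^+ 2)).
- by move=> k w; exact: frob_ge0.
- by move=> w; exact: frob_ge0.
- by move=> k; have [] := Ex_frob_res (eps0 k).
- by move=> k; have [] := Ex_frob_res (eps0 k).
- by apply: measurable_frob; exact: mxmeas_resY.
- move=> w /negP; rewrite negbK => u0.
  apply: cvg_sum_fin => i; apply: cvg_sum_fin => j.
  have cS := @res_mxcvg (Y w) u0 i j.
  by under eq_fun do rewrite expr2; rewrite expr2; apply: cvgM; exact: cS.
Qed.

Section quadratic.
Local Notation one := (const_mx 1 : 'cV[R]_n).
Hypothesis H1 : H *m one = 0.
Variable m' : 'cV[R]_r.

Let u w := m' + colmean (Y w).
(** The second moment matrix E[u u^T]. *)
Let N : 'M[R]_r := m' *m m'^T + n%:R^-1 *: Gam.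

Let n0 : (0 < n)%N.
Proof. by apply: leq_trans nr; rewrite addnC. Qed.

(** H annihilates 1, so W is unchanged when the same vector is added to all columns. This is the
    infinitesimal form of the independence of mean and covariance. *)
Lemma dres_mean e (y : 'M[R]_(r, n)) (v : 'cV[R]_r) : dres H e y (v *m one^T) = 0.
Proof.
rewrite /dres /dgram; have H1' : one^T *m H = 0 by rewrite -Ht -trmx_mul H1 trmx0.
have -> : (v *m one^T) *m H = 0 by rewrite -mulmxA H1' mulmx0.
rewrite mul0mx add0r trmx_mul trmxK -!mulmxA (mulmxA H) H1.
by rewrite mul0mx !(mulmx0, mul0mx) oppr0.
Qed.

(* E[v^T S Ybar] = 0 and E[(m' + Ybar)^T K Ybar] = E[tr (K Gam)] / n *)
Lemma Ex_linear_u e (v : 'cV[R]_r) : 0 < e ->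
  let S w := res H e (Y w) in
  [/\ L1 (fun w => (v^T *m S w *m u w) 0 0),
      L1 (fun w => \tr (S w *m (m' *m v^T))) &
      Ex (fun w => (v^T *m S w *m u w) 0 0) = Ex (fun w => \tr (S w *m (m' *m v^T)))].
Proof.
move=> e0 S.
have [i1 _ E1] := stein_colmean gY Psit GP n0 0 v (tame_res r Ht HH e0)
  (dres_mean e).
have j1 : L1 (fun w => (v^T *m S w *m colmean (Y w)) 0 0).
  by apply: eq_L1 i1 => w; rewrite scale0r addr0.
have E0 : Ex (fun w => (v^T *m S w *m colmean (Y w)) 0 0) = 0.
  transitivity (Ex (fun=> 0)); last exact: Ex_cst.
  rewrite -[RHS](_ : Ex (fun w => 0 / n%:R * \tr (res H e (Y w) *m Gam)) = _).
    rewrite -E1; apply: eq_Ex => w; by rewrite scale0r addr0.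
  by apply: eq_Ex => w; rewrite !mul0r.
have trE w : (v^T *m S w *m m') 0 0 = \tr (S w *m (m' *m v^T)).
  by rewrite mulmxA [RHS]mxtrace_mulC /mxtrace big_ord1 !mulmxA.
have lS : L1 (fun w => \tr (S w *m (m' *m v^T))).
  apply: (L1_bounded (c := e^-1 *+ (r * r) * norm1 (m' *m v^T))).
    by apply: measurable_mxtrace; apply: mxmeasM; [exact: mxmeas_resY|exact: mxmeas_cst].
  move=> w; apply: le_trans (norm1_trace _) _; apply: le_trans (norm1M _ _) _.
  by rewrite ler_wpM2r ?norm1_ge0// norm1_res_le.
have sE w : (v^T *m S w *m u w) 0 0 =
    \tr (S w *m (m' *m v^T)) + (v^T *m S w *m colmean (Y w)) 0 0.
  by rewrite -trE /u mulmxDr mxE.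
split=> //; first by apply: eq_L1 (L1D lS j1) => w; rewrite sE.
by rewrite (eq_Ex P sE) ExD// E0 addr0.
Qed.

(** Plays the role of independence of u and W. With K = S A S, the form u^T K u is m'^T K m' + m'^T
    K Ybar + u^T K Ybar; [stein_colmean] with s = 0 kills the second expectation, and with s = 1
    turns the third into E[tr (K Gam)] / n. *)
Lemma Ex_quadratic_u e (A : 'M[R]_r) : 0 < e -> A^T = A ->
  let S w := res H e (Y w) in
  [/\ L1 (fun w => qf (S w *m A *m S w) (u w)),
      L1 (fun w => \tr (S w *m A *m S w *m N)) &
      Ex (fun w => qf (S w *m A *m S w) (u w)) = Ex (fun w => \tr (S w *m A *m S w *m N))].
Proof.
move=> e0 At S.
have tS := tame_res r Ht HH e0.
pose K y := res H e y *m (A *m res H e y).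
have tK := @tameM R r n 0 0 0 0 0 _ _ _ _ _ _ _ isT isT tS (tameMl A tS).
have dK0 (y : 'M[R]_(r, n)) (v : 'cV[R]_r) :
    dres H e y (v *m one^T) *m (A *m res H e y) +
    res H e y *m (A *m dres H e y (v *m one^T)) = 0.
  by rewrite dres_mean mul0mx !mulmx0 addr0.
have Kt w : (K (Y w))^T = K (Y w).
  by rewrite /K !trmx_mul At (res_tr Ht (unitmx_reg Ht HH (Y w) e0)) mulmxA.
have [i1 _ E1] := stein_colmean gY Psit GP n0 0 m' tK dK0.
have [i2 i3 E2] := stein_colmean gY Psit GP n0 1 m' tK dK0.
pose c w := (m'^T *m K (Y w) *m colmean (Y w)) 0 0.
have j1 : L1 c by apply: eq_L1 i1 => w; rewrite scale0r addr0.
have E0 : Ex c = 0.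
  transitivity (Ex (fun=> 0)); last exact: Ex_cst.
  rewrite -[RHS](_ : Ex (fun w => 0 / n%:R * \tr (K (Y w) *m Gam)) = _).
    rewrite -E1; apply: eq_Ex => w; by rewrite scale0r addr0.
  by apply: eq_Ex => w; rewrite !mul0r.
pose b w := \tr (K (Y w) *m (m' *m m'^T)).
have lb : L1 b.
  have mb : mxmeas (fun w => K (Y w)).
    apply: mxmeasM; first exact: mxmeas_resY.
    by apply: mxmeasM; [exact: mxmeas_cst|exact: mxmeas_resY].
  apply: (L1_bounded (c := (e^-1 *+ (r * r)) * (norm1 A * (e^-1 *+ (r * r))) * norm1 (m' *m m'^T))).
    by apply: measurable_mxtrace; apply: mxmeasM; [exact: mb|exact: mxmeas_cst].
  move=> w; apply: le_trans (norm1_trace _) _; apply: le_trans (norm1M _ _) _.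
  rewrite ler_wpM2r ?norm1_ge0//; apply: le_trans (norm1M _ _) _.
  rewrite ler_pM ?norm1_ge0 ?norm1_res_le//; apply: le_trans (norm1M _ _) _.
  by rewrite ler_wpM2l ?norm1_ge0 ?norm1_res_le.
have KE w : S w *m A *m S w = K (Y w) by rewrite /K mulmxA.
have q2 w : ((m' + 1 *: colmean (Y w))^T *m K (Y w) *m colmean (Y w)) 0 0 =
   ((u w)^T *m K (Y w) *m colmean (Y w)) 0 0 by rewrite scale1r.
pose q w := ((u w)^T *m K (Y w) *m colmean (Y w)) 0 0.
have lq : L1 q by apply: eq_L1 i2.
have qE w : qf (S w *m A *m S w) (u w) = b w + c w + q w.
  rewrite KE /qf {2}/u mulmxDr mx11D -/(q w); congr (_ + _).
  rewrite /u linearD/= mulmxDl mulmxDl mx11D; congr (_ + _).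
    by rewrite /b mulmxA [in RHS]mxtrace_mulC /mxtrace big_ord1 !mulmxA.
  rewrite /c -(mx11_tr (m'^T *m K (Y w) *m _)).
  by rewrite trmx_mul [(m'^T *m K (Y w))^T]trmx_mul Kt trmxK mulmxA.
have NE w : \tr (S w *m A *m S w *m N) = b w + 1 / n%:R * \tr (K (Y w) *m Gam).
  by rewrite KE /N mulmxDr mxtraceD -scalemxAr mxtraceZ mul1r.
split.
- by apply: eq_L1 (L1D (L1D lb j1) lq) => w; rewrite qE.
- by apply: eq_L1 (L1D lb i3) => w; rewrite NE.
rewrite (eq_Ex P qE) (eq_Ex P NE) ExD//; last exact: L1D.
rewrite ExD// E0 addr0 ExD//; congr (_ + _).
by rewrite -[RHS]E2; apply: eq_Ex => w; rewrite q2.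
Qed.

Lemma L1_sqn_res0_u : L1 (fun w => sqn (res H 0 (Y w) *m u w)).
Proof.
have sq e w : 0 < e -> sqn (res H e (Y w) *m u w) =
    qf (res H e (Y w) *m 1%:M *m res H e (Y w)) (u w).
  move=> e0; rewrite /sqn /qf mulmx1 trmx_mul.
  by rewrite (res_tr Ht (unitmx_reg Ht HH (Y w) e0)) !mulmxA.
have mu : mxmeas u.
  apply: mxmeasD; first exact: mxmeas_cst.
  have mn : measurable_fun setT (fun _ : T => n%:R^-1 : R) by exact: measurable_cst.
  apply: (mxmeasZ mn); apply: mxmeasM; [exact: mxmeas_Y|exact: mxmeas_cst].
have lk k : L1 (fun w => sqn (res H (eps k) (Y w) *m u w)).
  have [l1 _ _] := Ex_quadratic_u (eps0 k) (trmx1 R r).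
  by apply: eq_L1 l1 => w; rewrite sq.
(* From tr (S S N) <= norm1 N * norm1 S ^+ 2 and norm1 S ^+ 2 <= (r r)^2 frob S, the latter having a
   uniformly bounded mean. *)
pose K := norm1 N * (r * r)%:R ^+ 2.
apply: (fatou_L1 measurable_singular P_singular
  (f := fun k w => sqn (res H (eps k) (Y w) *m u w)) (C := K * C ^+ 2)).
- by move=> k w; exact: sqn_ge0.
- by move=> w; exact: sqn_ge0.
- exact: lk.
- move=> k; have [l1 l2 E12] := Ex_quadratic_u (eps0 k) (trmx1 R r).
  have [lf Ef] := Ex_frob_res (eps0 k).
  rewrite (eq_Ex P (fun w => sq _ w (eps0 k))) E12.
  have lK : L1 (fun w => K * frob (res H (eps k) (Y w))) by exact: L1Z.
  apply: le_trans (le_Ex l2 lK _) _; last first.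
    by rewrite ExZ// ler_wpM2l// mulr_ge0 ?norm1_ge0 ?sqr_ge0.
  move=> w; apply: le_trans (ler_norm _) _; apply: le_trans (norm1_trace _) _.
  apply: le_trans (norm1M _ _) _; rewrite mulrC /K -mulrA ler_wpM2l ?norm1_ge0//.
  rewrite mulmx1; apply: le_trans (norm1M _ _) _; rewrite -expr2.
  have h := norm1_le_frob (res H (eps k) (Y w)).
  by rewrite -[frob _]sqr_sqrtr ?frob_ge0// -exprMn lerXn2r ?nnegrE ?norm1_ge0//.
- have mz : mxmeas (fun w => res H 0 (Y w) *m u w).
    by apply: mxmeasM => //; exact: mxmeas_resY.
  have -> : (fun w => sqn (res H 0 (Y w) *m u w)) =
      fun w => \sum_i (res H 0 (Y w) *m u w) i 0 ^+ 2.
    by apply/funext => w; rewrite sqnE.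
  by apply: measurable_sum => i; exact: measurable_funX.
- move=> w /negP; rewrite negbK => u0.
  have cv : mxcvg \oo (fun k => res H (eps k) (Y w) *m u w) (res H 0 (Y w) *m u w).
    by apply: mxcvgM; [exact: res_mxcvg|exact: mxcvg_cst].
  have cv2 : mxcvg \oo (fun k => (res H (eps k) (Y w) *m u w)^T *m (res H (eps k) (Y w) *m u w))
      ((res H 0 (Y w) *m u w)^T *m (res H 0 (Y w) *m u w)).
    by apply: mxcvgM => //; exact: mxcvg_tr.
  exact: cv2.
Qed.

End quadratic.
End uniform_bounds.

(** * Dominated passage to the limit, with degrees *)

Section domination.
Context d (T : measurableType d) (R : realType) (P : probability T R).
Variables (N : set T) (tau : T -> R).
Hypotheses (mN : measurable N) (PN : P N = 0%E).
Hypotheses (tau1 : forall w, 1 <= tau w) (ltau : L1 P (fun w => tau w ^+ 2)).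

(* f k --> g off the null set N, dominated by a multiple of tau ^+ a *)
Record sdom (a : nat) (f : nat -> T -> R) (g : T -> R) : Prop := Sdom {
  sdom_meas : forall k, measurable_fun setT (f k);
  sdom_lim_meas : measurable_fun setT g;
  sdom_bound : exists2 C : R, 0 <= C &
    forall k w, ~ N w -> `|f k w| <= C * tau w ^+ a;
  sdom_cvg : forall w, ~ N w -> f k w @[k --> \oo] --> g w }.

Record mdom (a : nat) m n (f : nat -> T -> 'M[R]_(m, n)) (g : T -> 'M[R]_(m, n)) :
    Prop := Mdom {
  mdom_meas : forall k, mxmeas (f k);
  mdom_lim_meas : mxmeas g;
  mdom_bound : exists2 C : R, 0 <= C &
    forall k w, ~ N w -> norm1 (f k w) <= C * tau w ^+ a;
  mdom_cvg : forall w, ~ N w -> mxcvg \oo (f ^~ w) (g w) }.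

Lemma mdom_cst m n (A : 'M[R]_(m, n)) : mdom 0 (fun _ _ => A) (fun=> A).
Proof.
split.
- by move=> k; exact: mxmeas_cst.
- exact: mxmeas_cst.
- by exists (norm1 A); [exact: norm1_ge0|move=> k w _; rewrite expr0 mulr1].
- by move=> w _; exact: mxcvg_cst.
Qed.

Lemma mdomM a b m n p (f : nat -> T -> 'M[R]_(m, n)) (f' : nat -> T -> 'M[R]_(n, p)) g g' :
  mdom a f g -> mdom b f' g' ->
  mdom (a + b) (fun k w => f k w *m f' k w) (fun w => g w *m g' w).
Proof.
move=> [mf mg [C C0 fC] fg] [mf' mg' [C' C0' fC'] fg']; split.
- by move=> k; exact: mxmeasM.
- exact: mxmeasM.
- exists (C * C'); first exact: mulr_ge0.
  move=> k w nw; apply: le_trans (norm1M _ _) _.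
  by rewrite exprD mulrACA ler_pM ?norm1_ge0 ?fC ?fC'.
- by move=> w nw; apply: mxcvgM; [exact: fg|exact: fg'].
Qed.

Lemma mdom_tr a m n (f : nat -> T -> 'M[R]_(m, n)) g : mdom a f g ->
  mdom a (fun k w => (f k w)^T) (fun w => (g w)^T).
Proof.
move=> [mf mg [C C0 fC] fg]; split.
- by move=> k; exact: mxmeas_tr.
- exact: mxmeas_tr.
- by exists C => // k w nw; rewrite norm1_tr; exact: fC.
- by move=> w nw; apply: mxcvg_tr; exact: fg.
Qed.

Lemma sdom_trace a n (f : nat -> T -> 'M[R]_n) g : mdom a f g ->
  sdom a (fun k w => \tr (f k w)) (fun w => \tr (g w)).
Proof.
move=> [mf mg [C C0 fC] fg]; split.
- by move=> k; exact: measurable_mxtrace.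
- exact: measurable_mxtrace.
- by exists C => // k w nw; apply: le_trans (norm1_trace _) _; exact: fC.
- by move=> w nw; apply: cvg_mxtrace; exact: fg.
Qed.

Lemma sdomM a b f f' g g' : sdom a f g -> sdom b f' g' ->
  sdom (a + b) (fun k w => f k w * f' k w) (fun w => g w * g' w).
Proof.
move=> [mf mg [C C0 fC] fg] [mf' mg' [C' C0' fC'] fg']; split.
- by move=> k; exact: measurable_funM.
- exact: measurable_funM.
- exists (C * C'); first exact: mulr_ge0.
  by move=> k w nw; rewrite normrM exprD mulrACA ler_pM ?fC ?fC'.
- by move=> w nw; apply: cvgM; [exact: fg|exact: fg'].
Qed.

Lemma sdomD a f f' g g' : sdom a f g -> sdom a f' g' ->
  sdom a (fun k w => f k w + f' k w) (fun w => g w + g' w).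
Proof.
move=> [mf mg [C C0 fC] fg] [mf' mg' [C' C0' fC'] fg']; split.
- by move=> k; exact: measurable_funD.
- exact: measurable_funD.
- exists (C + C'); first exact: addr_ge0.
  by move=> k w nw; rewrite mulrDl; apply: le_trans (ler_normD _ _) _; rewrite lerD ?fC ?fC'.
- by move=> w nw; apply: (@cvgD _ R^o); [exact: fg|exact: fg'].
Qed.

Lemma sdomZ a c f g : sdom a f g -> sdom a (fun k w => c * f k w) (fun w => c * g w).
Proof.
move=> [mf mg [C C0 fC] fg]; split.
- by move=> k; exact: measurable_funM.
- exact: measurable_funM.
- exists (`|c| * C); first exact: mulr_ge0.
  by move=> k w nw; rewrite normrM -mulrA ler_wpM2l ?fC.
- by move=> w nw; apply: cvgM; [exact: cvg_cst|exact: fg].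
Qed.

Lemma sdomB a f f' g g' : sdom a f g -> sdom a f' g' ->
  sdom a (fun k w => f k w - f' k w) (fun w => g w - g' w).
Proof.
move=> df /(sdomZ (-1)) df'; have := sdomD df df'.
by under eq_fun do under eq_fun do rewrite mulN1r;
  under [X in sdom _ _ X -> _]eq_fun do rewrite mulN1r.
Qed.

Lemma sdom_weaken a b f g : (a <= b)%N -> sdom a f g -> sdom b f g.
Proof.
move=> ab [mf mg [C C0 fC] fg]; split => //; exists C => // k w nw.
by apply: le_trans (fC k w nw) _; rewrite ler_wpM2l//; exact: ler_weXn2l.
Qed.

Lemma Ex_sdom f g : sdom 2 f g ->
  [/\ forall k, L1 P (f k), L1 P g & Ex P (f k) @[k --> \oo] --> Ex P g].
Proof.
move=> [mf mg [C C0 fC] fg].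
by apply: (dominated_Ex mN PN mf mg (L1Z C ltau)).
Qed.

(** Carries an identity that holds at every regularization level over to the limit. Degree 2 is the
    ceiling because only tau ^+ 2 is known to be integrable. *)
Lemma Ex_sdom_eq f g f' g' : sdom 2 f g -> sdom 2 f' g' ->
  (forall k, Ex P (f k) = Ex P (f' k)) -> Ex P g = Ex P g'.
Proof.
move=> /Ex_sdom[_ _ c] /Ex_sdom[_ _ c'] ff'.
move: c; under eq_fun do rewrite ff'.
by move=> /cvg_unique /(_ c'); apply; exact: Rhausdorff.
Qed.

End domination.

(** * Moments of the inverse of W *)

Section inverse_moments.
Context (R : realType) (r n : nat) d (T : measurableType d) (P : probability T R).
Context (Y : T -> 'M[R]_(r, n)) (Gam Psi : 'M[R]_r).
Hypothesis gY : gaussian_columns P Y Gam.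
Hypotheses (Psit : Psi^T = Psi) (GP : Gam *m Psi = 1%:M).
Variable H : 'M[R]_n.
Hypotheses (Ht : H^T = H) (HH : H *m H = H) (trH : \tr H = n%:R - 1).
Hypothesis H1 : H *m (const_mx 1 : 'cV[R]_n) = 0.
Hypothesis nr : (r + 5 <= n)%N.
Local Notation Ex := (Ex P).
Local Notation L1 := (L1 P).
Local Notation W w := (gram H (Y w)).
Local Notation S0 w := (res H 0 (Y w)).
Local Notation kappa := (n%:R - r%:R - 2 : R).

Variable m' : 'cV[R]_r.
Let u w := m' + colmean (Y w).
Let Nq : 'M[R]_r := m' *m m'^T + n%:R^-1 *: Gam.
Let N := singular Y H.
Let mN : measurable N := measurable_singular gY H.
Let PN : P N = 0%E := P_singular gY Psit GP Ht HH trH nr.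

Let eps (k : nat) : R := harmonic k.

Let eps0 k : 0 < eps k.
Proof. by rewrite /eps/= invr_gt0 ltr0n. Qed.

Let uN w : ~ N w -> W w \in unitmx.
Proof. by move=> /negP; rewrite negbK. Qed.

Let mu : mxmeas u.
Proof.
apply: mxmeasD; first exact: mxmeas_cst.
apply: (mxmeasZ (measurable_cst _)).
by apply: mxmeasM; [exact: (mxmeas_Y gY)|exact: mxmeas_cst].
Qed.

(** One weight that dominates S and S u simultaneously, for all e, and whose square is integrable;
    the summand 1 makes its powers monotone. *)
Let tau w := Num.sqrt (1 + frob (S0 w) + sqn (S0 w *m u w)).

Let tauE w : tau w ^+ 2 = 1 + frob (S0 w) + sqn (S0 w *m u w).
Proof. by rewrite sqr_sqrtr// !addr_ge0 ?frob_ge0 ?sqn_ge0. Qed.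

Let tau1 w : 1 <= tau w.
Proof.
rewrite -[leLHS]sqrtr1 ler_wsqrtr// -addrA lerDl.
by rewrite addr_ge0 ?frob_ge0 ?sqn_ge0.
Qed.

Let ltau : L1 (fun w => tau w ^+ 2).
Proof.
apply: eq_L1 (fun w => esym (tauE w)) _; apply: L1D.
  by apply: L1D; [exact: L1_cst|exact: (L1_frob_res0 gY Psit GP Ht HH trH nr)].
exact: (L1_sqn_res0_u gY Psit GP Ht HH trH nr H1).
Qed.

Local Notation mdom := (mdom N tau).
Local Notation sdom := (sdom N tau).

Let dS : mdom 1 (fun k w => res H (eps k) (Y w)) (fun w => S0 w).
Proof.
split.
- by move=> k; exact: (mxmeas_resY gY).
- exact: (mxmeas_resY gY).
- exists (r * r)%:R => // k w /uN u0; apply: le_trans (norm1_le_frob _) _.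
  rewrite ler_wpM2l// expr1 ler_wsqrtr//.
  apply: le_trans (frob_res_le_res0 Ht HH (eps0 k) u0) _.
  by rewrite addrAC lerDr addr_ge0 ?sqn_ge0.
- by move=> w /uN u0; exact: (res_mxcvg Ht HH u0).
Qed.

Let uW0 w : W w \in unitmx -> W w + 0%:M \in unitmx.
Proof. by rewrite raddf0 addr0. Qed.

(** Keeping W S together costs no degree, so terms with three or four resolvents still have degree
    at most 2. *)
Let dWS : mdom 0 (fun k w => W w *m res H (eps k) (Y w)) (fun=> 1%:M).
Proof.
split.
- by move=> k; apply: mxmeasM; [exact: (mxmeas_gramY gY)|exact: (mxmeas_resY gY)].
- exact: mxmeas_cst.
- exists (norm1 (1%:M : 'M[R]_r) + 1 *+ (r * r)).
    by rewrite addr_ge0 ?norm1_ge0 ?mulrn_wge0.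
  by move=> k w _; rewrite expr0 mulr1; exact: norm1_gram_res_le.
- move=> w /uN u0; have -> : 1%:M = W w *m S0 w.
    by rewrite (gram_res (uW0 u0)) scale0r subr0.
  by apply: mxcvgM; [exact: mxcvg_cst|exact: (res_mxcvg Ht HH u0)].
Qed.

(** S u is dominated as one object, through |S u| <= |S0 u| <= tau, instead of bounding S and u
    separately. *)
Let dSu : mdom 1 (fun k w => res H (eps k) (Y w) *m u w) (fun w => S0 w *m u w).
Proof.
split.
- by move=> k; apply: mxmeasM => //; exact: (mxmeas_resY gY).
- by apply: mxmeasM => //; exact: (mxmeas_resY gY).
- exists (r * 1)%:R => // k w /uN u0; apply: le_trans (norm1_le_frob _) _.
  rewrite ler_wpM2l// expr1 ler_wsqrtr//.
  have -> : frob (res H (eps k) (Y w) *m u w) = sqn (res H (eps k) (Y w) *m u w).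
    by rewrite sqnE; apply: eq_bigr => i _; rewrite big_ord1.
  apply: le_trans (sqn_res_le_res0 Ht HH (eps0 k) u0 _) _.
  by rewrite lerDr addr_ge0 ?frob_ge0.
- by move=> w /uN u0; apply: mxcvgM; [exact: (res_mxcvg Ht HH u0)|exact: mxcvg_cst].
Qed.

Let dcst k l (A : 'M[R]_(k, l)) := mdom_cst N tau A.

Let w12 f g : sdom 1 f g -> sdom 2 f g. Proof. exact: sdom_weaken. Qed.
Let w02 f g : sdom 0 f g -> sdom 2 f g. Proof. exact: sdom_weaken. Qed.

Let kappa_gt1 : 1 < kappa.
Proof.
have : (r + 5)%:R <= n%:R :> R by rewrite ler_nat.
by rewrite natrD; lra.
Qed.

(** The classical mean of an inverse Wishart matrix with n - 1 degrees of freedom, as the limit of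
    [haff_res]; the coefficient is (n - 1) - 1 - r. *)
Lemma inverse_moment1 (A : 'M[R]_r) :
  L1 (fun w => \tr (S0 w *m A)) /\
  kappa * Ex (fun w => \tr (S0 w *m A)) = \tr (Psi *m A).
Proof.
have dSA := mdomM dS (dcst A).
have dl := sdom_trace (mdomM (mdomM (dcst Psi) dWS) (dcst A)).
have dtr := sdom_trace dSA.
have [_ lSA _] := Ex_sdom mN PN ltau (w12 dtr).
split=> //.
have d2 := sdom_trace (mdomM (mdomM dS dWS) (dcst A)).
have d3 := sdomM (sdom_trace dWS) dtr.
have dr := sdomB (sdomB (sdomZ (\tr H) (w12 dtr)) (w12 d2)) (w12 d3).
have E := Ex_sdom_eq mN PN ltau (w02 dl) dr.
transitivity (Ex (fun w => \tr H * \tr (S0 w *m A) - \tr (S0 w *m 1%:M *m A) -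
  \tr (1%:M : 'M[R]_r) * \tr (S0 w *m A))).
  rewrite -ExZ//; apply: eq_Ex => w; rewrite mulmx1 trH mxtrace1; ring.
rewrite -E.
  by transitivity (Ex (fun=> \tr (Psi *m A))); [apply: eq_Ex => w; rewrite mulmx1|exact: Ex_cst].
move=> k; have [_ _ Ek] := haff_res gY Psit GP Ht HH (eps0 k) A.
transitivity (Ex (fun w => \tr (Psi *m W w *m res H (eps k) (Y w) *m A))).
  by apply: eq_Ex => w; rewrite !mulmxA.
by rewrite Ek; apply: eq_Ex => w; rewrite !mulmxA.
Qed.

(** The limit of [haff_quadratic], with coefficient (n - 1) - 1 - r - 1. Its left side is still
    linear in S0 and is evaluated by the first moment with B Psi A. *)
Lemma inverse_moment2 (A B : 'M[R]_r) : A^T = A ->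
  [/\ L1 (fun w => \tr (S0 w *m A *m S0 w *m B)),
      L1 (fun w => \tr (A *m S0 w) * \tr (S0 w *m B)) &
      (kappa - 1) * Ex (fun w => \tr (S0 w *m A *m S0 w *m B)) =
      \tr (Psi *m A *m Psi *m B) / kappa +
      Ex (fun w => \tr (A *m S0 w) * \tr (S0 w *m B))].
Proof.
move=> At.
have dSA := mdomM dS (dcst A).
have dSB := mdomM dS (dcst B).
have dl := sdom_trace (mdomM (mdomM (dcst Psi) dWS) (mdomM (dcst A) dSB)).
have dq := sdom_trace (mdomM dSA dSB).
have d2 := sdom_trace (mdomM (mdomM dS dWS) (mdomM (dcst A) dSB)).
have d3 := sdomM (sdom_trace dWS) dq.
have d4 := sdom_trace (mdomM dSA (mdomM dS (mdomM dWS (dcst B)))).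
have d5 := sdomM (sdom_trace (mdomM (mdomM (dcst A) dS) dWS)) (sdom_trace dSB).
have [_ lq _] := Ex_sdom mN PN ltau dq.
have [_ l5 _] := Ex_sdom mN PN ltau d5.
have dr := sdomB (sdomB (sdomB (sdomB (sdomZ (\tr H) dq) d2) d3) d4) d5.
have E := Ex_sdom_eq mN PN ltau (w12 dl) dr.
have lq' : L1 (fun w => \tr (S0 w *m A *m S0 w *m B)).
  by apply: eq_L1 lq => w; rewrite !mulmxA.
have l5' : L1 (fun w => \tr (A *m S0 w) * \tr (S0 w *m B)).
  by apply: eq_L1 l5 => w; rewrite mulmx1.
split=> //.
have [lm Em] := inverse_moment1 (B *m Psi *m A).
have kappa0 : kappa != 0 by rewrite gt_eqF// (lt_trans ltr01).
have -> : \tr (Psi *m A *m Psi *m B) / kappa = Ex (fun w => \tr (Psi *m A *m S0 w *m B)).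
  apply: (mulfI kappa0); rewrite mulrC divfK//.
  transitivity (kappa * Ex (fun w => \tr (S0 w *m (B *m Psi *m A)))); last first.
    by congr (_ * _); apply: eq_Ex => w; rewrite [RHS]mxtrace_mulC !mulmxA mxtrace_mulC !mulmxA.
  by rewrite Em !mulmxA [RHS]mxtrace_mulC !mulmxA mxtrace_mulC !mulmxA.
apply/eqP; rewrite -subr_eq; apply/eqP.
rewrite -ExZ// -ExB//; last exact: L1Z.
have EQ k : Ex (fun w => \tr (Psi *m (W w *m res H (eps k) (Y w)) *m
    (A *m (res H (eps k) (Y w) *m B)))) =
  Ex (fun w => \tr H * \tr (res H (eps k) (Y w) *m A *m (res H (eps k) (Y w) *m B))
   - \tr (res H (eps k) (Y w) *m (W w *m res H (eps k) (Y w)) *m (A *m (res H (eps k) (Y w) *m B)))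
   - \tr (W w *m res H (eps k) (Y w)) * \tr (res H (eps k) (Y w) *m A *m (res H (eps k) (Y w) *m B))
   - \tr (res H (eps k) (Y w) *m A *m (res H (eps k) (Y w) *m (W w *m res H (eps k) (Y w) *m B)))
   - \tr (A *m res H (eps k) (Y w) *m (W w *m res H (eps k) (Y w))) * \tr (res H (eps k) (Y w) *m B)).
  have [_ _ Ek] := haff_quadratic gY Psit GP Ht HH (eps0 k) B At.
  transitivity (Ex (fun w => \tr (Psi *m W w *m res H (eps k) (Y w) *m A *m res H (eps k) (Y w) *m B))).
    by apply: eq_Ex => w; rewrite !mulmxA.
  by rewrite Ek; apply: eq_Ex => w; rewrite !mulmxA.
have {}E := E EQ.
transitivity (Ex (fun w => \tr (Psi *m 1%:M *m (A *m (S0 w *m B))))); last first.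
  by apply: eq_Ex => w; rewrite mulmx1 !mulmxA.
rewrite E; apply: eq_Ex => w; rewrite !mulmx1 !mul1mx mxtrace1 trH !mulmxA; ring.
Qed.

(** Stated for every w, including those with singular W: the adjugate of a symmetric matrix is
    symmetric. *)
Let resT e w : (res H e (Y w))^T = res H e (Y w).
Proof.
rewrite resE /adjinv linearZ/= trmx_adj gram_reg_tr//.
Qed.

Let mxtrace1x1 (A : 'M[R]_1) : \tr A = A 0 0. Proof. by rewrite /mxtrace big_ord1. Qed.

Lemma inverse_moment_quadratic (A : 'M[R]_r) : A^T = A ->
  L1 (fun w => qf (S0 w *m A *m S0 w) (u w)) /\
  Ex (fun w => qf (S0 w *m A *m S0 w) (u w)) =
  Ex (fun w => \tr (S0 w *m A *m S0 w *m Nq)).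
Proof.
move=> At.
have dl := sdom_trace (mdomM (mdom_tr dSu) (mdomM (dcst A) dSu)).
have dr := sdom_trace (mdomM (mdomM dS (dcst A)) (mdomM dS (dcst Nq))).
have qE e w : qf (res H e (Y w) *m A *m res H e (Y w)) (u w) =
    \tr ((res H e (Y w) *m u w)^T *m (A *m (res H e (Y w) *m u w))).
  by rewrite mxtrace1x1 trmx_mul resT /qf !mulmxA.
have [_ ll _] := Ex_sdom mN PN ltau dl.
split; first by apply: eq_L1 ll => w; rewrite qE.
rewrite (eq_Ex P (qE 0)).
transitivity (Ex (fun w => \tr (S0 w *m A *m (S0 w *m Nq)))); last first.
  by apply: eq_Ex => w; rewrite !mulmxA.
apply: (Ex_sdom_eq mN PN ltau dl dr) => k.
have [_ _ Ek] := Ex_quadratic_u gY Psit GP Ht HH nr H1 m' (eps0 k) At.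
rewrite -(eq_Ex P (qE (eps k))) Ek.
by apply: eq_Ex => w; rewrite !mulmxA.
Qed.

Lemma inverse_moment_linear (v : 'cV[R]_r) :
  L1 (fun w => (v^T *m S0 w *m u w) 0 0) /\
  kappa * Ex (fun w => (v^T *m S0 w *m u w) 0 0) = (v^T *m Psi *m m') 0 0.
Proof.
have dl := sdom_trace (mdomM (dcst v^T) dSu).
have dr := sdom_trace (mdomM dS (dcst (m' *m v^T))).
have lE e w : (v^T *m res H e (Y w) *m u w) 0 0 = \tr (v^T *m (res H e (Y w) *m u w)).
  by rewrite mxtrace1x1 mulmxA.
have [_ ll _] := Ex_sdom mN PN ltau (w12 dl).
split; first by apply: eq_L1 ll => w; rewrite lE.
have [_ Em] := inverse_moment1 (m' *m v^T).
transitivity (\tr (Psi *m (m' *m v^T))); last first.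
  by rewrite mulmxA mxtrace_mulC mxtrace1x1 !mulmxA.
rewrite -Em; congr (_ * _); rewrite (eq_Ex P (lE 0)).
apply: (Ex_sdom_eq mN PN ltau (w12 dl) (w12 dr)) => k.
have [_ _ Ek] := Ex_linear_u gY Psit GP Ht HH nr H1 m' v (eps0 k).
by rewrite -(eq_Ex P (lE (eps k))) Ek.
Qed.

(** On the singular set the conventional value 0 of the inverse keeps the form nonnegative, so the
    sign holds at every point. *)
Lemma res0_psd w (v : 'cV[R]_r) : 0 <= qf (S0 w) v.
Proof.
have [u0|u0] := boolP (W w \in unitmx).
  by rewrite (qf_res Ht (uW0 u0)) mul0r addr0 qf_gram_ge0.
rewrite resE /adjinv raddf0 addr0; move: u0.
rewrite unitmxE unitfE negbK => /eqP ->.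
by rewrite invr0 scale0r /qf mulmx0 mul0mx mxE.
Qed.

(* The lower bound drops the nonnegative term E[tr (A S0) tr (S0 Nq)]. *)
Lemma inverse_moment_lower p (C : 'M[R]_(r, p)) l (L : 'M[R]_(r, l)) (A : 'M[R]_r) :
  L *m L^T = Gam -> A = C *m C^T ->
  \tr (Psi *m A *m Psi *m Nq) / (kappa * (kappa - 1)) <=
  Ex (fun w => qf (S0 w *m A *m S0 w) (u w)).
Proof.
move=> LG AE; have At : A^T = A by rewrite AE trmx_mul trmxK.
have [_ ->] := inverse_moment_quadratic At.
have [_ _ E] := inverse_moment2 Nq At.
have k1 : 0 < kappa - 1 by rewrite subr_gt0 kappa_gt1.
have k0 : 0 < kappa by rewrite (lt_trans ltr01).
rewrite invfM mulrA ler_pdivrMr// [leRHS]mulrC E lerDl.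
apply: Ex_ge0 => w; rewrite mulr_ge0//.
  by rewrite AE mxtrace_mulC mxtrace_qf sumr_ge0// => j _; exact: res0_psd.
rewrite mulmxDr -scalemxAr mxtraceD mxtraceZ addr_ge0//.
  by rewrite mxtrace_qf sumr_ge0// => j _; exact: res0_psd.
rewrite mulr_ge0 ?invr_ge0// -LG mxtrace_qf.
by apply: sumr_ge0 => j _; exact: res0_psd.
Qed.

End inverse_moments.

(** * Reduction to an invertible covariance *)

Section ae_integral.
Import HBNNSimple.

(** A simple function below f, set to 0 on N, keeps its integral and lies below g. This is used
    because the losses contain [mpinv], which is defined by choice, and are identified with
    measurable functions only off a null set. *)
Lemma ge0_integral_ae d (T : measurableType d) (R : realType)
    (P : {measure set T -> \bar R}) (N : set T) (f g : T -> \bar R) :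
  measurable N -> P N = 0%E -> (forall w, 0 <= f w)%E -> (forall w, 0 <= g w)%E ->
  (forall w, ~ N w -> f w = g w) -> (\int[P]_w f w <= \int[P]_w g w)%E.
Proof.
move=> mN PN f0 g0 fg; rewrite !ge0_integralTE//.
apply: ge_ereal_sup => _ [h hf <-].
have mNc : measurable (~` N) by exact: measurableC.
pose h' := mul_nnsfun h (indic_nnsfun R mNc).
have -> : sintegral P h = sintegral P h'.
  rewrite -!integralT_nnsfun; apply: ae_eq_integral => //.
  - exact/measurable_EFinP.
  - exact/measurable_EFinP.
  - exists N; split => // w /= nQ; apply: contrapT => nN; apply: nQ => _.
    by rewrite /h' /= /mindic indicE mem_set// mulr1.
apply: ereal_sup_ubound; exists h' => // w.
rewrite /h' /= /mindic indicE; have [nN|nN] := pselect (N w).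
  by rewrite memNset ?mulr0//; apply.
by rewrite mem_set// mulr1 -fg.
Qed.

(* No measurability is required of f and g: the integral of a function is defined
   from the simple functions below its positive and negative parts. *)
Lemma eq_integral_ae d (T : measurableType d) (R : realType)
    (P : {measure set T -> \bar R}) (N : set T) (f g : T -> \bar R) :
  measurable N -> P N = 0%E -> (forall w, ~ N w -> f w = g w) ->
  (\int[P]_w f w = \int[P]_w g w)%E.
Proof.
move=> mN PN fg; rewrite [LHS]integralE [RHS]integralE; congr (_ - _)%E.
  apply/eqP; rewrite eq_le; apply/andP; split.
    by apply: (ge0_integral_ae mN PN) => // w nw; rewrite !funeposE fg.
  by apply: (ge0_integral_ae mN PN) => // w nw; rewrite !funeposE fg.
apply/eqP; rewrite eq_le; apply/andP; split.
  by apply: (ge0_integral_ae mN PN) => // w nw; rewrite !funenegE fg.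
by apply: (ge0_integral_ae mN PN) => // w nw; rewrite !funenegE fg.
Qed.

End ae_integral.

(** * Factorization of a singular covariance *)

Section factorization.
Context (R : realType) (p r : nat) (B : 'M[R]_(p, r)) (C : 'M[R]_(r, p)).
Hypotheses (CB : C *m B = 1%:M) (BCt : (B *m C)^T = B *m C).

(** The hypotheses make C the Moore-Penrose inverse of B. The same pair (B, C) serves for Sigma,
    with G = Gam, and for the sample covariance, with G = W / n. *)
Lemma mpinv_factor (G : 'M[R]_r) : G \in unitmx ->
  mpinv (B *m G *m B^T) = C^T *m invmx G *m C.
Proof.
move=> uG; apply: (penrose_uniq (penrose_mpinv _)).
have BtCt : B^T *m C^T = 1%:M by rewrite -trmx_mul CB trmx1.
have E1 : B *m G *m B^T *m (C^T *m invmx G *m C) = B *m C.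
  rewrite !mulmxA -(mulmxA _ B^T) BtCt mulmx1 -(mulmxA B) mulmxV// mulmx1.
  by [].
have E2 : C^T *m invmx G *m C *m (B *m G *m B^T) = B *m C.
  rewrite !mulmxA -(mulmxA _ C B) CB mulmx1 -(mulmxA C^T) mulVmx// mulmx1.
  by rewrite -trmx_mul.
split.
- by rewrite E1 !mulmxA -(mulmxA B C B) CB mulmx1.
- by rewrite E2 -BCt trmx_mul !mulmxA -(mulmxA C^T B^T) BtCt mulmx1.
- by rewrite E1.
- by rewrite E2.
Qed.

End factorization.

(** B is a basis of the column space and C = (B^T B)^-1 B^T, so B C is the orthogonal projection
    onto that space. It fixes Sigma on the left, and on the right by symmetry; the core C Sigma C^T
    then cannot have smaller rank than Sigma. *)
Lemma psd_factor (R : realType) (p : nat) (Sigma : 'M[R]_p) : Sigma^T = Sigma ->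
  exists (B : 'M[R]_(p, \rank Sigma)) (C : 'M[R]_(\rank Sigma, p)),
    [/\ C *m B = 1%:M, (B *m C)^T = B *m C,
        B *m (C *m Sigma *m C^T) *m B^T = Sigma &
        C *m Sigma *m C^T \in unitmx].
Proof.
move=> St.
have [B [F [SBF uB]]] : exists (B : 'M[R]_(p, \rank Sigma)) (F : 'M[R]_(\rank Sigma, p)),
    Sigma = B *m F /\ B^T *m B \in unitmx.
  exists (col_base Sigma), (row_base Sigma); split; first by rewrite mulmx_base.
  have : row_free (col_base Sigma)^T by rewrite /row_free mxrank_tr; exact: col_base_full.
  by move=> /row_free_gram; rewrite trmxK.
have [C [CB BCt]] : exists C : 'M[R]_(\rank Sigma, p),
    C *m B = 1%:M /\ (B *m C)^T = B *m C.
  exists (invmx (B^T *m B) *m B^T); split; first by rewrite -mulmxA mulVmx.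
  by rewrite !trmx_mul trmxK trmx_inv trmx_mul trmxK mulmxA.
have BCS : B *m C *m Sigma = Sigma.
  transitivity (B *m C *m (B *m F)); first by rewrite -SBF.
  by rewrite mulmxA -(mulmxA B C B) CB mulmx1 -SBF.
have SBC : B *m (C *m Sigma *m C^T) *m B^T = Sigma.
  rewrite !mulmxA BCS -mulmxA -trmx_mul BCt.
  by rewrite -[LHS]trmxK trmx_mul BCt St BCS St.
exists B, C; split=> //.
rewrite -row_free_unit /row_free eqn_leq rank_leq_row.
rewrite -{1}SBC; apply: leq_trans (mxrankM_maxl _ _) _.
exact: mxrankM_maxr.
Qed.

Section centering.
Context (R : realType) (n : nat).
Hypothesis n0 : (0 < n)%N.
Local Notation one := (const_mx 1 : 'cV[R]_n).

Definition centermx : 'M[R]_n := 1%:M - n%:R^-1 *: (one *m one^T).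

Let nR : n%:R != 0 :> R. Proof. by rewrite pnatr_eq0 -lt0n. Qed.

Let one_one : one^T *m one = (n%:R)%:M.
Proof.
apply/matrixP => i j; rewrite !ord1 !mxE eqxx mulr1n.
by under eq_bigr do rewrite !mxE mulr1; rewrite sumr_const card_ord.
Qed.

Lemma centermx_tr : centermx^T = centermx.
Proof. by rewrite /centermx linearB linearZ/= trmx1 trmx_mul trmxK. Qed.

Lemma centermx_one : centermx *m one = 0.
Proof.
rewrite /centermx mulmxBl mul1mx -scalemxAl -mulmxA one_one mul_mx_scalar.
by rewrite scalerA mulVf// scale1r subrr.
Qed.

Lemma centermx_idem : centermx *m centermx = centermx.
Proof.
by rewrite {2}/centermx mulmxBr mulmx1 -scalemxAr mulmxA centermx_one mul0mx scaler0 subr0.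
Qed.

Lemma centermx_trace : \tr centermx = n%:R - 1.
Proof.
rewrite /centermx linearB/= mxtrace1 mxtraceZ mxtrace_mulC one_one mxtrace_scalar.
by rewrite mulVf.
Qed.

Lemma gram_centermx r (y : 'M[R]_(r, n)) :
  gram centermx y = \sum_i (col i y - colmean y) *m (col i y - colmean y)^T.
Proof.
have yH i : col i (y *m centermx) = col i y - colmean y.
  rewrite /centermx mulmxBr mulmx1 -scalemxAr mulmxA linearB linearZ/=.
  congr (_ - _ *: _); apply/colP => a; rewrite mxE [LHS]mxE big_ord1.
  by rewrite [one^T _ _]mxE [one _ _]mxE mulr1.
rewrite gram_gram ?centermx_tr ?centermx_idem//.
under eq_bigr do rewrite -yH.
apply/matrixP => a b; rewrite mxE summxE; apply: eq_bigr => i _.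
by rewrite !mxE big_ord1 !mxE.
Qed.

End centering.

Lemma mxtrace_gram_gt0 (R : realType) k l (G : 'M[R]_(k, l)) : G != 0 -> 0 < \tr (G *m G^T).
Proof.
have g0 i : 0 <= \sum_j G i j ^+ 2 by apply: sumr_ge0 => j _; exact: sqr_ge0.
rewrite mxtrace_gram lt_def sumr_ge0// andbT; apply: contra_neq => /eqP.
rewrite psumr_eq0// => /allP G0; apply/matrixP => i j; rewrite mxE.
have := G0 i (mem_index_enum _); rewrite /= psumr_eq0 => [/allP /(_ j)|]; last first.
  by move=> ? _; exact: sqr_ge0.
by rewrite mem_index_enum sqrf_eq0 => /(_ isT) /eqP.
Qed.

(** * From the observations to the reduced data *)

Section reduction.
Context (R : realType) (n p r : nat) d (T : measurableType d) (P : probability T R).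
Context (X : 'I_n -> {mfun T >-> 'cV[R]_p}) (mu : 'cV[R]_p) (Sigma : 'M[R]_p).
Hypothesis XN : iid_mvnormal P X mu Sigma.
Variables (B : 'M[R]_(p, r)) (C : 'M[R]_(r, p)).
Hypotheses (CB : C *m B = 1%:M) (BCt : (B *m C)^T = B *m C).
Local Notation Gam := (C *m Sigma *m C^T).
Hypotheses (SB : B *m Gam *m B^T = Sigma) (uG : Gam \in unitmx).
Hypothesis St : Sigma^T = Sigma.
Hypothesis nr : (r + 5 <= n)%N.

Definition reduced_data (w : T) : 'M[R]_(r, n) :=
  \matrix_(a, i) (C *m (X i w - mu)) a 0.
Local Notation Y := reduced_data.

Let n0 : (0 < n)%N. Proof. by apply: leq_trans nr; rewrite addnC. Qed.

Lemma col_reduced_data j w : col j (Y w) = C *m (X j w - mu).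
Proof. by apply/colP => a; rewrite !mxE. Qed.

Let mshift k (K : 'M[R]_(k, p)) : measurable_fun setT (fun x : 'cV[R]_p => K *m (x - mu)).
Proof.
apply: measurable_mxP; apply: mxmeasM; first exact: mxmeas_cst.
apply: mxmeasD; last exact: mxmeas_cst.
by move=> i j; exact: measurable_mxentry.
Qed.

Lemma gaussian_reduced_data : gaussian_columns P Y Gam.
Proof.
have [indep law] := XN.
have mS (D : set 'cV[R]_r) : measurable D -> measurable [set x | D (C *m (x - mu))].
  by move=> mD; have := mshift C measurableT mD; rewrite setTI.
split.
- apply: measurable_mxP => a i; under eq_fun do rewrite mxE.
  have me : measurable_fun setT (fun x : 'cV[R]_p => (C *m (x - mu)) a 0).
    exact: measurableT_comp (measurable_mxentry a 0) (mshift C).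
  exact: measurableT_comp me (measurable_funPT (X i)).
- move=> J D mD.
  have := indep J (fun j => [set x | D j (C *m (x - mu))]) (fun j => mS _ (mD j)).
  rewrite (_ : mkset _ = [set w | forall j, j \in J -> D j (col j (Y w))]).
    move=> ->; apply: eq_bigr => j _; congr (P _).
    by apply/seteqP; split=> w /=; rewrite col_reduced_data.
  by apply/seteqP; split=> w /= H j /H; rewrite col_reduced_data.
- move=> j; have [A [nu [AA nuN XA]]] := law j.
  exists p, (C *m A), nu; split=> //.
    by rewrite trmx_mul mulmxA -(mulmxA C A) AA.
  move=> D mD; have := XA _ (mS D mD).
  rewrite /distribution /pushforward => XAD.
  transitivity (P (X j @^-1` [set x | D (C *m (x - mu))])).
    by congr (P _); apply/seteqP; split=> w /=; rewrite col_reduced_data.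
  rewrite [LHS]XAD; congr (nu _); apply/seteqP; split=> z /=;
    by rewrite addrC addrA addNr add0r mulmxA.
Qed.

(* Off a null set, X_j = mu + B Y_j. *)
Definition off_range : set T :=
  \bigcup_(j in [set: 'I_n]) [set w | (1%:M - B *m C) *m (X j w - mu) != 0].

Let mneq0 k : measurable [set v : 'cV[R]_k | v != 0].
Proof.
have -> : [set v : 'cV[R]_k | v != 0] =
    \bigcup_(i in [set: 'I_k]) ((fun v : 'cV[R]_k => v i 0) @^-1` (~` [set 0])).
  apply/seteqP; split=> v /=.
    move=> v0; apply: contrapT => nv; move/negP : v0; apply; apply/eqP/colP => i.
    by rewrite mxE; apply: contrapT => vi; apply: nv; exists i.
  by move=> [i _ /= vi]; apply/eqP => v0; apply: vi; rewrite v0 mxE.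
apply: fin_bigcup_measurable => // i _.
have := @measurable_mxentry R k 1 i 0 measurableT (~` [set 0]).
by rewrite setTI; apply; apply: measurableC; exact: measurable_set1.
Qed.

Let mO : measurable [set x : 'cV[R]_p | (1%:M - B *m C) *m (x - mu) != 0].
Proof. by have := mshift (1%:M - B *m C) measurableT (@mneq0 p); rewrite setTI. Qed.

Let mOX j : measurable [set w | (1%:M - B *m C) *m (X j w - mu) != 0].
Proof. by have := measurable_funPT (X j) measurableT _ mO; rewrite setTI. Qed.

Lemma measurable_off_range : measurable off_range.
Proof. by apply: fin_bigcup_measurable => // j _; exact: mOX. Qed.

(** If A A^T = Sigma then Q = (1 - B C) A satisfies Q Q^T = 0, hence Q = 0: the vector mu + A z lies
    in the range for every z, not merely for almost every one. *)
Lemma P_off_range : P off_range = 0%E.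
Proof.
have [_ law] := XN.
have PX0 j : P [set w | (1%:M - B *m C) *m (X j w - mu) != 0] = 0%E.
  have [A [nu [AA nuN XA]]] := law j.
  have KA : (1%:M - B *m C) *m A = 0.
    have K0 : (1%:M - B *m C) *m Sigma = 0.
      by rewrite -SB !mulmxA mulmxBl mul1mx -(mulmxA B C B) CB mulmx1 subrr !mul0mx.
    set Q := _ *m A; have QQ : Q *m Q^T = 0.
      by rewrite /Q trmx_mul !mulmxA -(mulmxA _ A A^T) AA K0 mul0mx.
    move: Q QQ => Q QQ; apply/matrixP => i k.
    have := congr1 (fun Z : 'M[R]_p => Z i i) QQ; rewrite mxE mxE => /eqP.
    rewrite psumr_eq0 => [/allP /(_ k)|l _]; last first.
      by rewrite mxE -expr2 sqr_ge0.
    by rewrite mem_index_enum mxE -expr2 sqrf_eq0 mxE => /(_ isT) /eqP.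
  have := XA _ mO; rewrite /distribution /pushforward => XAD.
  rewrite [LHS]XAD (_ : mkset _ = set0) ?measure0//.
  apply/seteqP; split=> // z /=.
  by rewrite [mu + _]addrC addrK mulmxA KA mul0mx eqxx.
apply/negligibleP; first exact: measurable_off_range.
(* The finite union is reindexed over all natural numbers, with empty terms beyond n, to use
   countable subadditivity. *)
pose F k := [set w | exists2 j : 'I_n, val j = k & (1%:M - B *m C) *m (X j w - mu) != 0].
apply: (@negligibleS _ _ _ P (\bigcup_k F k)).
  by move=> w [j _ /= wj]; exists (val j) => //; exists j.
apply: negligible_bigcup => k; have [kn|kn] := ltnP k n; last first.
  rewrite (_ : F k = set0); first exact: negligible_set0.
  by apply/seteqP; split=> // w [j jk _]; move: kn; rewrite -jk leqNgt ltn_ord.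
apply: (negligibleS _ (_ : P.-negligible _)); last first.
  by apply/negligibleP; [exact: mOX (Ordinal kn)|exact: PX0].
by move=> w [j jk wj] /=; rewrite (_ : Ordinal kn = j)//; exact/val_inj.
Qed.

Local Notation Psi := (invmx Gam).
Local Notation H := (@centermx R n).
Local Notation S0 w := (res H 0 (Y w)).
Local Notation m' := (C *m mu).
Local Notation u w := (m' + colmean (Y w)).
Local Notation A := (C *m C^T).

Let GP : Gam *m Psi = 1%:M. Proof. exact: mulmxV. Qed.

Let Psit : Psi^T = Psi.
Proof. by rewrite trmx_inv trmx_mul trmxK [(C *m _)^T]trmx_mul St mulmxA. Qed.

Definition bad_set : set T := off_range `|` singular Y H.

Lemma eta_reduced : eta mu Sigma = C^T *m (Psi *m m').
Proof. by rewrite /eta -{1}SB (mpinv_factor CB BCt)// !mulmxA. Qed.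

Lemma measurable_bad_set : measurable bad_set.
Proof.
apply: measurableU; first exact: measurable_off_range.
exact: (measurable_singular gaussian_reduced_data).
Qed.

Lemma P_bad_set : P bad_set = 0%E.
Proof.
apply/negligibleP; first exact: measurable_bad_set.
apply: negligibleU; apply/negligibleP.
- exact: measurable_off_range.
- exact: P_off_range.
- exact: (measurable_singular gaussian_reduced_data).
- exact: (P_singular gaussian_reduced_data Psit GP
    (@centermx_tr R n) (centermx_idem R n0) (centermx_trace R n0)).
Qed.

Lemma good_data w : ~ bad_set w -> forall j, X j w = mu + B *m col j (Y w).
Proof.
move=> nb j; rewrite col_reduced_data.
have : (1%:M - B *m C) *m (X j w - mu) = 0.
  by apply: contrapT => /eqP h; apply: nb; left; exists j.
by rewrite mulmxBl mul1mx => /eqP; rewrite subr_eq0 mulmxA => /eqP <-; rewrite addrC subrK.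
Qed.

Lemma smean_reduced w : ~ bad_set w ->
  smean (fun i => X i w) = mu + B *m colmean (Y w).
Proof.
move=> nb; rewrite /smean (eq_bigr _ (fun i _ => good_data nb i)).
rewrite big_split/= sumr_const card_ord -mulmx_sumr scalerDr -[mu *+ n]scaler_nat scalerA.
rewrite mulVf ?pnatr_eq0 -?lt0n// scale1r /colmean -scalemxAr.
congr (_ + _ *: (_ *m _)); apply/colP => a.
by rewrite summxE mxE; apply: eq_bigr => i _; rewrite !mxE mulr1.
Qed.

Lemma scov_reduced w : ~ bad_set w ->
  scov (fun i => X i w) = B *m (n%:R^-1 *: gram H (Y w)) *m B^T.
Proof.
move=> nb; rewrite /scov -scalemxAr -scalemxAl gram_centermx// mulmx_sumr mulmx_suml.
congr (_ *: _); apply: eq_bigr => i _; rewrite (smean_reduced nb) (good_data nb i).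
by rewrite opprD addrACA subrr add0r -mulmxBr trmx_mul !mulmxA.
Qed.

Lemma mpinv_scov_reduced w : ~ bad_set w ->
  mpinv (scov (fun i => X i w)) = C^T *m (n%:R *: S0 w) *m C.
Proof.
move=> nb; have uW : gram H (Y w) \in unitmx.
  by apply: contrapT => /negP h; apply: nb; right.
have n1 : n%:R^-1 \is a @GRing.unit R by rewrite unitfE invr_eq0 pnatr_eq0 -lt0n.
rewrite (scov_reduced nb) (mpinv_factor CB BCt) ?unitmxZ//.
by rewrite invmxZ ?unitmxZ// invrK resE raddf0 addr0 adjinvE.
Qed.

Lemma plugin_reduced w : ~ bad_set w ->
  plugin (fun i => X i w) = n%:R *: (C^T *m (S0 w *m u w)).
Proof.
move=> nb; rewrite /plugin (mpinv_scov_reduced nb) (smean_reduced nb).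
have -> : u w = C *m (mu + B *m colmean (Y w)) by rewrite mulmxDr mulmxA CB mul1mx.
by rewrite -scalemxAr -!scalemxAl !mulmxA.
Qed.

Let S0t w : ~ bad_set w -> (S0 w)^T = S0 w.
Proof.
move=> nb; apply: res_tr; first exact: centermx_tr.
by rewrite raddf0 addr0; apply: contrapT => /negP h; apply: nb; right.
Qed.

Lemma sqn_reduced w : ~ bad_set w ->
  sqn (C^T *m (S0 w *m u w)) = qf (S0 w *m A *m S0 w) (u w).
Proof. by move=> nb; rewrite /sqn /qf !trmx_mul trmxK (S0t nb) !mulmxA. Qed.

Lemma pinv_quad_reduced w : ~ bad_set w ->
  pinv_quad (fun i => X i w) = n%:R ^+ 2 * qf (S0 w *m A *m S0 w) (u w).
Proof.
move=> nb; have Mt : (mpinv (scov (fun i => X i w)))^T = mpinv (scov (fun i => X i w)).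
  rewrite (mpinv_scov_reduced nb) !trmx_mul trmxK linearZ/= (S0t nb).
  by rewrite mulmxA.
transitivity (sqn (plugin (fun i => X i w))).
  by rewrite /pinv_quad /sqn /plugin trmx_mul Mt !mulmxA.
rewrite (plugin_reduced nb) -(sqn_reduced nb) /sqn [(_ *: _)^T]linearZ/= -scalemxAl -scalemxAr.
by rewrite scalerA mx11Z expr2.
Qed.

Lemma loss_reduced (a : R) w : ~ bad_set w ->
  sqnorm2 (scaled_plugin a (fun i => X i w) - eta mu Sigma) =
  (a * n%:R) ^+ 2 * qf (S0 w *m A *m S0 w) (u w) -
  2 * (a * n%:R) * ((C *m eta mu Sigma)^T *m S0 w *m u w) 0 0 +
  sqn (eta mu Sigma).
Proof.
move=> nb; rewrite /sqnorm2 -sqnE -(sqn_reduced nb) /scaled_plugin (plugin_reduced nb).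
rewrite scalerA; move: (a * n%:R) (eta mu Sigma) => s x.
have -> : (C *m x)^T *m S0 w *m u w = x^T *m (C^T *m (S0 w *m u w)).
  by rewrite trmx_mul !mulmxA.
move: (C^T *m _) => v.
have xv : (v^T *m x) 0 0 = (x^T *m v) 0 0 by rewrite -(mx11_tr (v^T *m x)) trmx_mul trmxK.
have -> : sqn (s *: v - x) = ((s *: v^T - x^T) *m (s *: v - x)) 0 0.
  by congr ((_ *m _) 0 0); apply/matrixP => i j; rewrite !mxE.
rewrite /sqn mulmxBl !mulmxBr -!scalemxAl -!scalemxAr.
rewrite !(mx11D, mx11N, mx11Z) xv; ring.
Qed.

Local Notation kappa := (n%:R - r%:R - 2 : R).
Local Notation k0 := (sqn (eta mu Sigma)).

Let gY := gaussian_reduced_data.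
Let At : A^T = A. Proof. by rewrite trmx_mul trmxK. Qed.

(** The mean part is |C^T Psi m'|^2 = |eta|^2. The covariance part keeps the lower bound on Q
    positive even when eta = 0. *)
Lemma mxtrace_reduced : \tr (Psi *m A *m Psi *m (m' *m m'^T + n%:R^-1 *: Gam)) =
  k0 + n%:R^-1 * \tr (Psi *m A).
Proof.
rewrite mulmxDr mxtraceD -scalemxAr mxtraceZ -(mulmxA _ Psi Gam) mulVmx// mulmx1.
congr (_ + _); rewrite mulmxA mxtrace_mulC /mxtrace big_ord1 /sqn eta_reduced.
by rewrite !trmx_mul Psit !trmxK !mulmxA.
Qed.

(** Any factor L of Gam gives Psi = Psi L L^T Psi, so the trace is the squared norm of C^T Psi L. If
    that vanished, then C^T = C^T Psi Gam would be 0, against C B = 1 with r > 0. *)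
Lemma mxtrace_invmx_gt0 : (0 < r)%N -> 0 < \tr (Psi *m A).
Proof.
move=> r0; have [_ _ /(_ (Ordinal n0)) [l [L [nu [LL _ _]]]]] := gY.
have -> : \tr (Psi *m A) = \tr (C^T *m Psi *m L *m (C^T *m Psi *m L)^T).
  rewrite !trmx_mul trmxK Psit !mulmxA -(mulmxA _ L L^T) LL -(mulmxA C^T Psi Gam).
  by rewrite mulVmx// mulmx1 [LHS]mxtrace_mulC mulmxA.
apply: mxtrace_gram_gt0; apply/eqP => K0.
have : C^T *m Psi *m (L *m L^T) = 0 by rewrite mulmxA K0 mul0mx.
rewrite LL -mulmxA mulVmx// mulmx1 => /(congr1 trmx); rewrite trmxK trmx0 => C0.
move: CB; rewrite C0 mul0mx => /matrixP /(_ (Ordinal r0) (Ordinal r0)) /eqP.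
by rewrite !mxE eqxx eq_sym oner_eq0.
Qed.

Lemma reduced_moments : (0 < r)%N -> exists Q t : R,
  [/\ ('E_P[fun w => pinv_quad (fun i => X i w)] = Q%:E)%E,
      forall a : R, ('E_P[fun w => (sqnorm2
          (scaled_plugin a (fun i => X i w) - eta mu Sigma))%R] =
        (a ^+ 2 * Q - 2 * a * t + k0)%:E)%E,
      kappa * t = n%:R * k0, 0 < Q &
      n%:R ^+ 2 * k0 <= kappa * (kappa - 1) * Q].
Proof.
move=> r0; have H1 := centermx_one R n0; have HH := centermx_idem R n0.
have trH := centermx_trace R n0; have Ht := centermx_tr R n.
have [lq _] := inverse_moment_quadratic gY Psit GP Ht HH trH H1 nr m' At.
have [ll El] := inverse_moment_linear gY Psit GP Ht HH trH H1 nr m' (C *m eta mu Sigma).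
pose q w := qf (S0 w *m A *m S0 w) (u w).
pose l w := ((C *m eta mu Sigma)^T *m S0 w *m u w) 0 0.
have mb := measurable_bad_set; have Pb := P_bad_set.
exists (n%:R ^+ 2 * Ex P q), (n%:R * Ex P l).
have vE : ((C *m eta mu Sigma)^T *m Psi *m m') 0 0 = k0.
  by rewrite /sqn {3}eta_reduced trmx_mul !mulmxA.
have kr : (r%:R : R) + 5 <= n%:R by rewrite -natrD ler_nat.
have n0R : 0 < n%:R :> R by rewrite ltr0n.
have low : n%:R ^+ 2 * (k0 + n%:R^-1 * \tr (Psi *m A)) <=
    kappa * (kappa - 1) * (n%:R ^+ 2 * Ex P q).
  have [_ _ /(_ (Ordinal n0)) [l' [L [nu [LL _ _]]]]] := gY.
  have := inverse_moment_lower gY Psit GP Ht HH trH H1 nr m' LL (erefl A).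
  rewrite mxtrace_reduced ler_pdivrMr; last by apply: mulr_gt0; lra.
  by move=> low; rewrite mulrCA ler_pM2l ?exprn_gt0// [leRHS]mulrC.
have tau := mxtrace_invmx_gt0 r0.
split.
- rewrite unlock (eq_integral_ae mb Pb (g := fun w => (n%:R ^+ 2 * q w)%:E)).
    by rewrite ExE ?ExZ//; exact: L1Z.
  by move=> w nb; rewrite (pinv_quad_reduced nb).
- move=> a; rewrite unlock.
  pose g w := (a * n%:R) ^+ 2 * q w - 2 * (a * n%:R) * l w + k0.
  rewrite (eq_integral_ae mb Pb (g := EFin \o g)).
    have l1 : L1 P (fun w => (a * n%:R) ^+ 2 * q w) by exact: L1Z.
    have l2 : L1 P (fun w => 2 * (a * n%:R) * l w) by exact: L1Z.
    have l3 : L1 P (fun=> k0) by exact: L1_cst.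
    have l12 := L1B l1 l2.
    rewrite ExE; last by apply: L1D.
    rewrite /g ExD// ExB// !ExZ// Ex_cst; congr EFin; ring.
  by move=> w nb; rewrite (loss_reduced a nb).
- by rewrite mulrCA El vE.
- have : 0 < kappa * (kappa - 1) * (n%:R ^+ 2 * Ex P q).
    apply: lt_le_trans low; apply: mulr_gt0; first exact: exprn_gt0.
    by apply: ltr_wpDl; [exact: sqn_ge0|apply: mulr_gt0; rewrite ?invr_gt0].
  by rewrite pmulr_rgt0//; apply: mulr_gt0; lra.
- apply: le_trans low; rewrite ler_wpM2l ?exprn_ge0 ?ler0n//.
  by rewrite lerDl; apply: mulr_ge0; rewrite ?invr_ge0 ?ler0n// ltW.
Qed.
End reduction.

(** The last inequality locates the vertex t / Q of the risk parabola: kappa n t = n^2 |eta|^2 <=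
    kappa (kappa - 1) Q, divided by kappa n. *)
Lemma plugin_moments (R : realType) (n p r : nat) (d : measure_display)
    (T : measurableType d) (P : probability T R) (X : 'I_n -> {mfun T >-> 'cV[R]_p})
    (mu : 'cV[R]_p) (Sigma : 'M[R]_p) : param_space r (mu, Sigma) ->
  iid_mvnormal P X mu Sigma -> (0 < r)%N -> (r + 5 <= n)%N ->
  exists Q t k : R,
  [/\ ('E_P[fun w => pinv_quad (fun i => X i w)] = Q%:E)%E,
      forall a : R, ('E_P[fun w => (sqnorm2
          (scaled_plugin a (fun i => X i w) - eta mu Sigma))%R] =
        (a ^+ 2 * Q - 2 * a * t + k)%:E)%E,
      0 < Q & t <= (n%:R - r%:R - 3) / n%:R * Q].
Proof.
move=> [/= [St _] rS] XN r0 nr; have [B [C]] := psd_factor St.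
rewrite rS in B C * => -[CB BCt SB uG].
have [Q [t [EQ Ef kt Q0 low]]] := reduced_moments XN CB BCt SB uG St nr r0.
exists Q, t, (sqn (eta mu Sigma)); split=> //.
have kr : (r%:R : R) + 5 <= n%:R by rewrite -natrD ler_nat.
have n0R : 0 < n%:R :> R by rewrite ltr0n; apply: leq_trans nr; rewrite addnC.
have k0 : 0 < n%:R - r%:R - 2 :> R by lra.
rewrite mulrAC ler_pdivlMr// -(ler_pM2l k0).
move: low; rewrite expr2 -(mulrA n%:R) -kt.
set N := n%:R; set s := r%:R => low.
have -> : (N - s - 2) * (t * N) = N * ((N - s - 2) * t) by ring.
apply: le_trans low _; rewrite le_eqVlt; apply/orP; left; apply/eqP; ring.
Qed.

(** Domination asks for one parameter with strict inequality, so the parameter space must be shown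
    nonempty. *)
Lemma param_space_pid (R : realType) p r : (r <= p)%N ->
  param_space r (0 : 'cV[R]_p, pid_mx r : 'M[R]_p).
Proof.
move=> rp; split=> /=; last exact: rank_pid_mx.
split=> [|x]; first exact: tr_pid_mx.
rewrite mxE; apply: sumr_ge0 => i _; rewrite mxE (bigD1 i)//= big1 => [|j ji].
  by rewrite !mxE eqxx addr0 mulrAC -expr2 mulr_ge0 ?sqr_ge0 ?ler0n//.
by rewrite !mxE (inj_eq val_inj) (negPf ji) mulr0.
Qed.

Theorem proposition5 (R : realType) (n p r : nat)
    (d : measure_display) (T : measurableType d)
    (P : 'cV[R]_p -> 'M[R]_p -> probability T R)
    (X : 'I_n -> {mfun T >-> 'cV[R]_p})
    (hrank : (r < minn n p)%N)
    (hr : (1 <= r <= n - 5)%N)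
    (hX : normal_experiment r P X) :
  [/\ forall (mu : 'cV[R]_p) (Sigma : 'M[R]_p), param_space r (mu, Sigma) ->
        forall a : R, a <= (n%:R - r%:R - 2) / n%:R ->
          (risk P X (scaled_plugin a) mu Sigma <= risk_bound r P X a mu Sigma)%E,
      forall (mu : 'cV[R]_p) (Sigma : 'M[R]_p), param_space r (mu, Sigma) ->
        forall a : R, a != (n%:R - r%:R - 3) / n%:R ->
          (risk_bound r P X ((n%:R - r%:R - 3) / n%:R) mu Sigma
             < risk_bound r P X a mu Sigma)%E,
      dominates r P X
        (scaled_plugin ((n%:R - r%:R - 3) / n%:R))
        (scaled_plugin ((n%:R - r%:R - 2) / n%:R)) &
      dominates r P X
        (scaled_plugin ((n%:R - r%:R - 2) / n%:R))
        (@plugin R n p)].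
Proof.
have [r0 rn] := andP hr.
(* Subtraction on [nat] truncates, but 1 <= r <= n - 5 forces n > 5, so the 5 may be moved
   across. *)
have nr : (r + 5 <= n)%N.
  by rewrite addnC -leq_subRL// ltnW// -subn_gt0 (leq_trans r0 rn).
have rp : (r <= p)%N by apply: ltnW; move: hrank; rewrite leq_min => /andP[].
have n0 : 0 < n%:R :> R by rewrite ltr0n; apply: leq_trans nr; rewrite addnC.
set c := (n%:R - r%:R - 2) / n%:R : R.
(* With step e = 1 / n, the constants with n - r - 2, n - r - 3 and n - r - 4 are c, c - e and c - 2
   e. *)
set e := n%:R^-1 : R.
have e0 : 0 < e by rewrite invr_gt0.
have c3 : (n%:R - r%:R - 3) / n%:R = c - e :> R by rewrite /c /e; ring.
have c4 : (n%:R - r%:R - 4) / n%:R = c - 2 * e :> R by rewrite /c /e; ring.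
have c1 : c < 1.
  have r0R : 0 <= r%:R :> R := ler0n R r.
  by rewrite ltr_pdivrMr// mul1r; lra.
have mom mu Sigma : param_space r (mu, Sigma) -> exists Q t k : R,
  [/\ 0 < Q, t <= (c - e) * Q,
      forall a, risk P X (scaled_plugin a) mu Sigma = (a ^+ 2 * Q - 2 * a * t + k)%:E &
      forall a, risk_bound r P X a mu Sigma =
        (c ^+ 2 * Q - 2 * c * t + k + (a - c) * (a - (c - 2 * e)) * Q)%:E].
  move=> th; have [Q [t [k [EQ Ef Q0 tQ]]]] := plugin_moments th (hX mu Sigma th) r0 nr.
  exists Q, t, k; split=> //; first by rewrite -c3.
  by move=> a; rewrite /risk_bound -/c c4 EQ /risk Ef -EFinM -EFinD.
have risk1 mu Sigma :
    risk P X (@plugin R n p) mu Sigma = risk P X (scaled_plugin 1) mu Sigma.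
  by congr (risk P X _ mu Sigma); apply/funext => x; rewrite /scaled_plugin scale1r.
have lt3 mu Sigma : param_space r (mu, Sigma) ->
    (risk P X (scaled_plugin (c - e)) mu Sigma < risk P X (scaled_plugin c) mu Sigma)%E.
  move=> /mom [Q [t [k [Q0 tQ rE _]]]]; rewrite !rE lte_fin -subr_gt0.
  (* The difference is written through (c - e) Q - t >= 0, the only information on t; strictness
     comes from Q > 0. *)
  rewrite (_ : _ - _ = 2 * (e * ((c - e) * Q - t)) + e ^+ 2 * Q); last ring.
  rewrite ltr_wpDl//; last by rewrite mulr_gt0// exprn_gt0.
  by rewrite !mulr_ge0// ?(ltW e0)// subr_ge0.
have lt2 mu Sigma : param_space r (mu, Sigma) ->
    (risk P X (scaled_plugin c) mu Sigma < risk P X (@plugin R n p) mu Sigma)%E.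
  move=> /mom [Q [t [k [Q0 tQ rE _]]]]; rewrite risk1 !rE lte_fin -subr_gt0.
  rewrite (_ : _ - _ = (1 - c) * (2 * ((c - e) * Q - t) + (1 - c + 2 * e) * Q)); last ring.
  rewrite mulr_gt0 ?subr_gt0// ltr_wpDl//; first by rewrite mulr_ge0// subr_ge0.
  by rewrite mulr_gt0//; lra.
(* Both improvements are strict at every parameter, so any member of the parameter space is a
   witness. *)
have dom delta1 delta2 : (forall mu Sigma, param_space r (mu, Sigma) ->
    (risk P X delta1 mu Sigma < risk P X delta2 mu Sigma)%E) ->
    dominates r P X delta1 delta2.
  move=> lt12; split=> [mu Sigma th|]; first exact/ltW/lt12.
  by exists 0, (pid_mx r); split; [|apply: lt12]; exact: param_space_pid.
rewrite c3; split.
- move=> mu Sigma /mom [Q [t [k [Q0 tQ rE bE]]]] a ac; rewrite rE bE lee_fin -subr_ge0.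
  (* The gap between bound and risk is linear in a, the quadratic terms a^2 Q cancelling, and it
     changes sign at a = c; hence the restriction a <= c. *)
  rewrite (_ : _ - _ = 2 * ((c - a) * ((c - e) * Q - t))); last ring.
  by rewrite !mulr_ge0// subr_ge0.
- move=> mu Sigma /mom [Q [t [k [Q0 tQ rE bE]]]] a ac; rewrite !bE lte_fin -subr_gt0.
  (* The roots c and c - 2 e of the correction are symmetric about c - e; completing the square
     shows that the minimizer is unique. *)
  rewrite (_ : _ - _ = (a - (c - e)) ^+ 2 * Q); last ring.
  by rewrite mulr_gt0// lt_def sqr_ge0 sqrf_eq0 subr_eq0 ac.
- exact: dom lt3.
- exact: dom lt2.
Qed.
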